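(* Let $G\in\mathcal{T}(n,r)$. Then a.a.s. the following bounds hold: (1) If $r=r(n)\to\infty$ and $r\le\sqrt n/4$, then $\beta(G)=\Omega\big(\max(n/r^2,\ r^{4/3}/\log^{1/3}n)\big)$. (2) If $\log^{3/2}n\le r\le\sqrt n/4$, then $\beta(G)=O\big(n\log^{2/3}n/r^{2/3}\big)$.
   Context: The torus $T_n$ is $[0,\sqrt n]^2$ with opposite sides identified, with induced flat metric $d_T$. $G\in\mathcal{T}(n,r)$ has as vertices $n$ independent uniform random points of $T_n$ (identified with positions), distinct vertices adjacent iff their $d_T$-distance is at most $r$; a.a.s. means with probability tending to $1$ as $n\to\infty$; $\log$ is natural. The metric dimension $\beta(G)$ is the minimum size of a set $W=\{w_1,\dots,w_k\}$ of vertices such that the vectors $(d_G(w_1,v),\dots,d_G(w_k,v))$, $v\in V(G)$, are pairwise distinct, where $d_G$ is graph distance in $G$. *)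

(* Defs.v *)
From HB Require Import structures.
From mathcomp Require Import all_boot all_order all_algebra.
From mathcomp Require Import all_classical all_reals all_analysis.

Set Implicit Arguments.
Unset Strict Implicit.
Unset Printing Implicit Defensive.

Import Order.TTheory GRing.Theory Num.Theory.
Import numFieldNormedType.Exports.

Local Open Scope classical_set_scope.
Local Open Scope ring_scope.

Section graph.
Variables (V : finType) (e : rel V).

Definition has_walk (x y : V) (k : nat) : bool :=
  [exists p : k.-tuple V, path e x p && (last x p == y)].

(* [None] is the infinite distance between distinct connected components. *)
Definition graph_dist (x y : V) : option nat :=
  if pselect (exists k, has_walk x y k) is left h then Some (ex_minn h)
  else None.

Definition resolving (W : {set V}) : bool :=
  [forall u, forall v,
    [forall w in W, graph_dist w u == graph_dist w v] ==> (u == v)].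

Definition metric_dim : nat :=
  #|[arg min_(W < [set: V]%SET | resolving W) #|W| ]|.

Lemma graph_dist_eq0 x y : graph_dist x y = Some 0%N -> x = y.
Proof.
rewrite /graph_dist; case: pselect => // h [].
case: ex_minnP => -[|k] // /existsP[p /andP[_ /eqP <-]] _ _.
by rewrite (tuple0 p).
Qed.

Lemma graph_distxx x : graph_dist x x = Some 0%N.
Proof.
have h0 : has_walk x x 0 by apply/existsP; exists [tuple]; rewrite /= eqxx.
rewrite /graph_dist; case: pselect => [h|[]]; last by exists 0%N.
by case: ex_minnP => k _ /(_ _ h0); rewrite leqn0 => /eqP ->.
Qed.

(* Makes the [arg min] in [metric_dim] a genuine minimum. *)
Lemma resolving_setT : resolving [set: V]%SET.
Proof.
apply/forallP => u; apply/forallP => v; apply/implyP => /forallP/(_ u).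
by rewrite finset.in_setT graph_distxx => /eqP/esym/graph_dist_eq0 ->.
Qed.

End graph.

Section torus.
Variable R : realType.

(* The quotient metric of the plane modulo the lattice (L Z)^2, on
   representatives. *)
Definition torus_dist (L : R) (x y : R * R) : R :=
  inf [set Num.sqrt ((x.1 - y.1 + L * k.1%:~R) ^+ 2 +
                     (x.2 - y.2 + L * k.2%:~R) ^+ 2) | k in [set: int * int]].

Definition torus_side (n : nat) : R := Num.sqrt n%:R.

Definition torus_graph (n : nat) (r : R) (x : 'I_n -> R * R) : rel 'I_n :=
  fun i j => (i != j) && (torus_dist (torus_side n) (x i) (x j) <= r).

Definition torus_square (n : nat) : set (R * R) :=
  `[0, torus_side n] `*` `[0, torus_side n].

Definition mutually_independent (d d' : measure_display)
    (T : measurableType d) (T' : measurableType d') (P : probability T R)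
    (I : finType) (X : I -> {RV P >-> T'}) : Prop :=
  forall (J : {set I}) (A : I -> set T'), (forall i, measurable (A i)) ->
    P (\bigcap_(i in [set` J]) (X i @^-1` A i)) =
    (\prod_(i in J) P (X i @^-1` A i))%E.

Definition uniform_on_torus (n : nat) (d : measure_display)
    (T : measurableType d) (P : probability T R)
    (X : {RV P >-> (R * R)%type}) : Prop :=
  forall A : set (R * R), measurable A ->
    distribution P X A =
    ((lebesgue_measure \x lebesgue_measure)%E (A `&` torus_square n) *
      (n%:R^-1)%:E)%E.

(* "A.a.s. [G] in T(n, r n) satisfies [E n]", over every realization of the
   model; [n] points are sampled afresh for each [n], possibly on different
   probability spaces.  The events are measurable, as [E n] depends on the
   sample only through finitely many measurable adjacency indicators. *)
Definition aas_torus (r : nat -> R) (E : forall n, rel 'I_n -> Prop) : Prop :=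
  forall (d : nat -> measure_display) (T : forall n, measurableType (d n))
    (P : forall n, probability (T n) R)
    (X : forall n, 'I_n -> {RV (P n) >-> (R * R)%type}),
    (forall n, mutually_independent (X n)) ->
    (forall n i, uniform_on_torus n (X n i)) ->
    P n [set w | E n (torus_graph (r n) (fun i => X n i w))]
      @[n --> \oo] --> 1%E.

End torus.

(* Main.v *)
Require Import Defs.
From HB Require Import structures.
From mathcomp Require Import all_boot all_order all_algebra perm.
From mathcomp Require Import all_classical all_reals all_analysis.
From mathcomp Require Import measurable_realfun.
From mathcomp Require Import zify ring lra.

(**
Rounding the points to a fine grid replaces the model by a uniform function
from ['I_n] to a discrete torus: only pairs whose difference lies in a thin
annulus of radius [r] can change adjacency, so for fixed [n] the error vanishes
as the grid is refined, and all estimates become finite counting.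

Upper bound: two points at distance at least [eta] are told apart by every
point at distance at most [r] from exactly one of them, a region of area of
order [r * eta].  Hence the first [m] vertices, with [m] of order
[n * ln n / (r * eta)], resolve all such pairs, and adding a vertex of each of
the [O(n * eta ^ 2)] closer pairs gives a resolving set; one takes
[eta ^ 3 = ln n / r].

Lower bound [n / r ^ 2]: two vertices in a cell of width of order [1 / r] are
twins as soon as the annulus of radius [r] and width of order [1 / r] around
the cell is empty; every resolving set contains one of them, and a second
moment computation shows that there are order [n / r ^ 2] such cells.

Lower bound [r ^ (4/3) / ln n ^ (1/3)]: the vertices in a square block of side
[r / 40] form a clique [J].  The distances from [w] outside [J] to [J] take two
consecutive values, according to whether a vertex is adjacent to the set [U]
reached from [w] by the last step avoiding [J].  The union of the discs of
radius [r] around [U] is crossed only along a curve, so that among the [K ^ 2]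
cells of the block at most order [K] are not constant for it, and since [U]
does not depend on the points of the block, at most order [ln n] of these cells
contain two vertices when their width is [(ln n / r) ^ (1/3)].  So each landmark
resolves [O(ln n)] of the cells that contain exactly two vertices.
*)

Set Implicit Arguments.
Unset Strict Implicit.
Unset Printing Implicit Defensive.

Import Order.TTheory GRing.Theory Num.Theory.
Import numFieldNormedType.Exports.

Local Open Scope ring_scope.

(** * Finite probability *)

(** The exponents come from balancing costs. In the upper bound, [eta ^ 3 = ln n / r] equates
    [n * ln n / (r * eta)] with [n * eta ^ 2]. In the last lower bound, a block with cells of width
    [s] has order [(r / s) ^ 2] cells, a proportion of order [s ^ 4] of which holds two points,
    while a curve meets order [r / s] cells, of which order [r * s ^ 3] are expected to hold two
    points. Landmarks are chosen after the sample, so this last count must be controlled for all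
    landmarks and all layers at once, which costs a deviation of order [ln n]. The width [s] is the
    largest one for which [r * s ^ 3] stays of that order, and [r ^ 2 * s ^ 2 / ln n] is the
    resulting bound. The obstacle is that [U] depends on the graph. It is defined by walks avoiding
    [J] so that the points of the block can be resampled inside the block without changing it. On
    the grid all lengths are counted in fine cells, so that the radius becomes [rho = r * M.+1 / L]
    with [L] the side of the torus. For fixed [n] arbitrarily large [M] are available, which leaves
    the freedom to make [M.+1] a multiple of a number of coarse cells. *)

Section FiniteProbability.
Variable R : realType.

(** On an empty type the convention for division by 0 gives average 0, so upper bounds such as
    [avg_le_cst] hold without nonemptiness. *)
Definition avg (T : finType) (Y : T -> R) : R := (\sum_t Y t) / #|T|%:R.

Definition Pr (T : finType) (A : pred T) : R := avg (fun t => (A t)%:R).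

Section Average.
Variable T : finType.
Implicit Types (Y Z : T -> R) (A B : pred T).

Lemma eq_avg Y Z : Y =1 Z -> avg Y = avg Z.
Proof. by move=> YZ; rewrite /avg (eq_bigr Z) // => t _; rewrite YZ. Qed.

Lemma le_avg Y Z : (forall t, Y t <= Z t) -> avg Y <= avg Z.
Proof.
by move=> YZ; rewrite ler_wpM2r ?invr_ge0 ?ler0n//; apply: ler_sum => t _.
Qed.

Lemma avg_ge0 Y : (forall t, 0 <= Y t) -> 0 <= avg Y.
Proof. by move=> Y0; rewrite divr_ge0 ?ler0n// sumr_ge0. Qed.

Lemma avg_sum (I : Type) (s : seq I) (P : pred I) (F : I -> T -> R) :
  avg (fun t => \sum_(i <- s | P i) F i t) = \sum_(i <- s | P i) avg (F i).
Proof. by rewrite /avg exchange_big /= mulr_suml. Qed.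

Lemma avgD Y Z : avg (fun t => Y t + Z t) = avg Y + avg Z.
Proof. by rewrite /avg big_split /= mulrDl. Qed.

Lemma avgZ a Y : avg (fun t => a * Y t) = a * avg Y.
Proof. by rewrite /avg -mulr_sumr mulrA. Qed.

Lemma avgZr a Y : avg (fun t => Y t * a) = avg Y * a.
Proof. by rewrite mulrC -avgZ; apply: eq_avg => t; rewrite mulrC. Qed.

Lemma avg_cst a : (0 < #|T|)%N -> avg (fun _ : T => a) = a.
Proof.
move=> T0; rewrite /avg sumr_const cardT -cardT -[a *+ _]mulr_natr mulfK//.
by rewrite pnatr_eq0 -lt0n.
Qed.

Lemma avg_le_cst a Y : 0 <= a -> (forall t, Y t <= a) -> avg Y <= a.
Proof.
move=> a0 Ya; have [T0|] := posnP #|T|.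
  by rewrite /avg T0 invr0 mulr0.
by move=> T0; rewrite -[leRHS](avg_cst _ T0); apply: le_avg.
Qed.

Lemma Pr_ge0 A : 0 <= Pr A. Proof. by apply: avg_ge0. Qed.

Lemma Pr_le1 A : Pr A <= 1.
Proof. by apply: avg_le_cst => // t; case: (A t). Qed.

Lemma PrE A : Pr A = #|A|%:R / #|T|%:R.
Proof.
rewrite /Pr /avg -sum1_card natr_sum; congr (_ / _).
by rewrite [RHS]big_mkcond; apply: eq_bigr => t _; rewrite unfold_in; case: (A t).
Qed.

Lemma eq_Pr A B : A =1 B -> Pr A = Pr B.
Proof. by move=> AB; apply: eq_avg => t; rewrite AB. Qed.

Lemma sub_Pr A B : (forall t, A t -> B t) -> Pr A <= Pr B.
Proof.
move=> AB; apply: le_avg => t.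
by have := AB t; case: (A t) => [/(_ isT) ->|_] //; rewrite ler0n.
Qed.

Lemma Pr_or A B : Pr (fun t => A t || B t) <= Pr A + Pr B.
Proof.
rewrite /Pr -avgD; apply: le_avg => t.
by case: (A t); case: (B t); rewrite /= ?addr0 ?add0r ?lerDl ?ler01.
Qed.

Lemma Pr_exists (I : finType) (A : I -> pred T) :
  Pr (fun t => [exists i, A i t]) <= \sum_i Pr (A i).
Proof.
rewrite /Pr -avg_sum; apply: le_avg => t.
case: existsP => [[i Ai]|_] /=; last by apply: sumr_ge0 => i _; rewrite ler0n.
by rewrite (bigD1 i)//= Ai lerDl sumr_ge0// => j _; rewrite ler0n.
Qed.

Lemma Pr_not A : (0 < #|T|)%N -> Pr (fun t => ~~ A t) = 1 - Pr A.
Proof.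
move=> T0; apply/eqP; rewrite eq_sym subr_eq -avgD -[X in X == _](avg_cst 1 T0).
by apply/eqP/eq_avg => t; case: (A t); rewrite /= ?addr0 ?add0r.
Qed.

Lemma chebyshev_avg Y (a c : R) : 0 < c ->
  Pr (fun t => c <= `|Y t - a|) <=
    (avg (fun t => Y t ^+ 2) - 2 * a * avg Y + a ^+ 2) / c ^+ 2.
Proof.
move=> c0; have [T0|T0] := posnP #|T|.
  rewrite /Pr /avg T0 invr0 !mulr0 subr0 add0r.
  by rewrite divr_ge0 ?sqr_ge0.
rewrite ler_pdivlMr ?exprn_gt0// -avgZr.
rewrite -(avg_cst (a ^+ 2) T0) -mulNr -avgZ -!avgD.
apply: le_avg => t; have -> : Y t ^+ 2 + - (2 * a) * Y t + a ^+ 2 = `|Y t - a| ^+ 2.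
  by rewrite real_normK ?num_real//; ring.
case: (leP c `|Y t - a|) => [cle|_]; rewrite ?mul0r ?sqr_ge0// mul1r.
by rewrite lerXn2r ?nnegrE// ltW.
Qed.

(** [v] is the relative excess of the second moment over the squared mean; Chebyshev's inequality at
    distance half the mean costs the factor 4. *)
Lemma chebyshev_lower Y (v : R) : 0 < avg Y ->
  avg (fun t => Y t ^+ 2) <= avg Y ^+ 2 * (1 + v) ->
  Pr (fun t => Y t < avg Y / 2) <= 4 * v.
Proof.
set m := avg Y => m0 hv.
have /le_trans -> // : Pr (fun t => Y t < m / 2) <=
    Pr (fun t => m / 2 <= `|Y t - m|).
  by apply: sub_Pr => t Yt; rewrite ler0_norm; lra.
have m2 : 0 < m / 2 by rewrite divr_gt0.
apply: le_trans (chebyshev_avg Y m m2) _.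
rewrite ler_pdivrMr ?exprn_gt0// -/m.
have -> : 4 * v * (m / 2) ^+ 2 = m ^+ 2 * v by field.
by rewrite mulrDr mulr1 in hv; lra.
Qed.

(* Pairwise uncorrelated indicators have variance at most their mean. *)
Lemma uncorrelated_count_upper (I : finType) (D : {set I}) (Z : I -> pred T) (p m : R) :
  0 < m -> #|D|%:R * p <= m -> 0 <= p ->
  (forall i, i \in D -> Pr (Z i) = p) ->
  (forall i j, i \in D -> j \in D -> i != j ->
     Pr (fun t => Z i t && Z j t) <= p ^+ 2) ->
  Pr (fun t => 2 * m <= #|[set i in D | Z i t]|%:R) <= m^-1.
Proof.
move=> m0 Dp p0 Zp Zij.
pose Y t : R := \sum_(i in D) (Z i t)%:R.
have YE t : #|[set i in D | Z i t]|%:R = Y t :> R.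
  rewrite -sum1_card natr_sum /Y big_mkcond [RHS]big_mkcond /=.
  by apply: eq_bigr => i _; rewrite inE; case: (i \in D); case: (Z i t).
have EY : avg Y = #|D|%:R * p.
  rewrite avg_sum (eq_bigr (fun=> p)) => [|i iD]; last exact: Zp.
  by rewrite sumr_const mulr_natl.
have EY2 : avg (fun t => Y t ^+ 2) <= avg Y + avg Y ^+ 2.
  have -> : avg (fun t => Y t ^+ 2) =
      \sum_(i in D) \sum_(j in D) Pr (fun t => Z i t && Z j t).
    rewrite /Pr; under eq_bigr do rewrite -avg_sum.
    rewrite -avg_sum; apply: eq_avg => t; rewrite expr2 /Y mulr_suml.
    apply: eq_bigr => i _; rewrite mulr_sumr; apply: eq_bigr => j _.
    by case: (Z i t); case: (Z j t); rewrite ?mulr1 ?mulr0.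
  have -> : avg Y + avg Y ^+ 2 = \sum_(i in D) (p + #|D|%:R * p ^+ 2).
    by rewrite sumr_const -[RHS]mulr_natl EY; ring.
  apply: ler_sum => i iD; rewrite (bigD1 i iD) /= lerD//.
    by rewrite -(Zp i iD) le_eqVlt; apply/orP; left; apply/eqP/eq_Pr => t; rewrite andbb.
  apply: (@le_trans _ _ (\sum_(j in D | j != i) p ^+ 2)).
    by apply: ler_sum => j /andP[jD ji]; apply: Zij; rewrite // eq_sym.
  rewrite mulr_natl -sumr_const.
  rewrite [leRHS](bigID (fun j => j != i))/= lerDl sumr_ge0// => *.
  exact: sqr_ge0.
have /le_trans -> // : Pr (fun t => 2 * m <= #|[set i in D | Z i t]|%:R) <=
    Pr (fun t => m <= `|Y t - avg Y|).
  apply: sub_Pr => t; rewrite YE EY => Yt; rewrite ger0_norm; lra.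
apply: le_trans (chebyshev_avg Y (avg Y) m0) _.
rewrite ler_pdivrMr ?exprn_gt0//.
have -> : m^-1 * m ^+ 2 = m by rewrite expr2 mulKf ?gt_eqF.
have : avg Y <= m by rewrite EY.
move: EY2; set a := avg Y; set b := avg _; rewrite -mulrA -!expr2; lra.
Qed.

End Average.

Lemma Pr_set (X : finType) (S : {set X}) : Pr (mem S) = #|S|%:R / #|X|%:R.
Proof. by rewrite PrE. Qed.

Section Product.
Variables (I X : finType).
Implicit Types f : {ffun I -> X}.

(** Independence of the coordinates of a uniform function, by distributing the product over the
    sums. *)
Lemma avg_prod (F : I -> X -> R) :
  avg (fun f : {ffun I -> X} => \prod_i F i (f i)) = \prod_i avg (F i).
Proof.
transitivity ((\sum_(f : {ffun I -> X}) \prod_i F i (f i)) / #|{ffun I -> X}|%:R) => //.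
rewrite card_ffun natrX -prodr_const /avg big_split /= prodfV; congr (_ / _).
by rewrite bigA_distr_bigA.
Qed.

Lemma Pr_prod (A : I -> pred X) :
  Pr (fun f : {ffun I -> X} => [forall i, A i (f i)]) = \prod_i Pr (A i).
Proof.
rewrite -avg_prod; apply: eq_avg => f.
case: forallP => [Af|nA]; first by rewrite big1// => i _; rewrite Af.
case: (pickP (fun i => ~~ A i (f i))) => [i nAi|Ai].
  by rewrite (bigD1 i)//= (negPf nAi) mul0r.
by case: nA => i; rewrite -[A _ _]negbK Ai.
Qed.

(* Each map [g i] sends uniform pairs to uniform points, so replacing every
   coordinate of a uniform function by [g i] keeps it uniform. *)
Lemma avg_resample (Y : finType) (g : I -> X -> Y -> X)
    (H : {ffun I -> X} -> R) :
  (forall i x, #|[pred ay : X * Y | g i ay.1 ay.2 == x]| = #|Y|) ->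
  (0 < #|Y|)%N ->
  avg (fun f => avg (fun h : {ffun I -> Y} => H [ffun i => g i (f i) (h i)])) =
  avg H.
Proof.
move=> gE Y0; have Yn0 : #|Y|%:R != 0 :> R by rewrite pnatr_eq0 -lt0n.
(* Group the pairs [(f, h)] by the function [f0] that they produce. *)
have -> : avg (fun f => avg (fun h : {ffun I -> Y} => H [ffun i => g i (f i) (h i)]))
    = (\sum_f0 H f0 * (\sum_(f : {ffun I -> X}) \sum_(h : {ffun I -> Y})
        ([ffun i => g i (f i) (h i)] == f0)%:R)) / #|{ffun I -> Y}|%:R / #|{ffun I -> X}|%:R.
  rewrite /avg -mulr_suml; congr (_ / _ / _).
  under [RHS]eq_bigr do rewrite mulr_sumr; rewrite [RHS]exchange_big /=.
  apply: eq_bigr => f _; under [RHS]eq_bigr do rewrite mulr_sumr.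
  rewrite [RHS]exchange_big /=; apply: eq_bigr => h _.
  rewrite (bigD1 [ffun i => g i (f i) (h i)])//= eqxx mulr1 big1 ?addr0// => f0.
  by rewrite eq_sym => /negPf ->; rewrite mulr0.
rewrite /avg; congr (_ / _); rewrite mulr_suml; apply: eq_bigr => f0 _.
(* Every [f0] is produced by [#|Y| ^ #|I|] pairs: the count factors over the coordinates, and the
   hypothesis on [g] evaluates each factor. *)
suff -> : \sum_(f : {ffun I -> X}) \sum_(h : {ffun I -> Y})
        ([ffun i => g i (f i) (h i)] == f0)%:R = #|{ffun I -> Y}|%:R :> R.
  by rewrite mulfK// card_ffun natrX expf_neq0.
transitivity (\prod_i (\sum_a \sum_y (g i a y == f0 i)%:R : R)).
  rewrite bigA_distr_bigA /=; apply: eq_bigr => f _.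
  rewrite bigA_distr_bigA /=; apply: eq_bigr => h _.
  have -> : ([ffun i => g i (f i) (h i)] == f0) = [forall i, g i (f i) (h i) == f0 i].
    apply/eqP/forallP => [<- i|e]; first by rewrite ffunE.
    by apply/ffunP => i; rewrite ffunE; apply/eqP.
  case: forallP => [Af|nA]; first by rewrite big1// => i _; rewrite Af.
  case: (pickP (fun i => g i (f i) (h i) != f0 i)) => [i nAi|Ai].
    by rewrite (bigD1 i)//= (negPf nAi) mul0r.
  by case: nA => i; rewrite -[_ == _]negbK Ai.
rewrite card_ffun natrX -prodr_const; apply: eq_bigr => i _.
rewrite pair_big -(gE i (f0 i)) -sum1_card natr_sum [RHS]big_mkcond /=.
by apply: eq_bigr => -[a y] _; rewrite inE; case: eqP.
Qed.

End Product.
End FiniteProbability.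

(** * Second moment of the number of cells holding exactly two points *)

Section IsolatedPairs.
Variable R : realType.

Lemma prod_if_set (I : finType) (S : {set I}) (a b : R) :
  \prod_i (if i \in S then a else b) = a ^+ #|S| * b ^+ (#|I| - #|S|).
Proof.
rewrite (bigID (mem S)) /=; congr (_ * _).
  by rewrite (eq_bigr (fun=> a)) ?prodr_const// => i ->.
rewrite (eq_bigr (fun=> b)) => [|i /negPf ->//].
have -> : (#|I| - #|S| = #|~: S|)%N by rewrite [in RHS]cardsCs finset.setCK.
by rewrite -prodr_const; apply: eq_bigl => i; rewrite inE.
Qed.

Definition ordered_pairs (n : nat) : {set 'I_n * 'I_n} :=
  [set ij : 'I_n * 'I_n | (ij.1 < ij.2)%N].

Lemma card_ordered_pairs n : #|ordered_pairs n| = 'C(n, 2).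
Proof.
rewrite -bin2_sum big_mkord -sum1_card.
rewrite (eq_bigl (fun ij : 'I_n * 'I_n => true && (ij.1 < ij.2)%N)); last first.
  by move=> ij; rewrite inE.
rewrite -(pair_big_dep xpredT (fun i j : 'I_n => (i < j)%N) (fun _ _ => 1%N)) /=.
rewrite (exchange_big_dep xpredT) //=; apply: eq_bigr => j _.
rewrite -(big_ord_widen n (fun=> 1%N) (ltnW (ltn_ord j))).
by rewrite sum_nat_const card_ord muln1.
Qed.

Lemma card_ordered_pairs_ge n : (2 <= n)%N ->
  n%:R ^+ 2 / 4 <= #|ordered_pairs n|%:R :> R.
Proof.
move=> n2; rewrite card_ordered_pairs ler_pdivrMr// -natrX -natrM ler_nat.
have := bin2 n; have := odd_double_half (n * n.-1)%N.
rewrite oddM; case: n n2 => [|n]//= n2; rewrite andNb/= add0n => e b.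
by rewrite b expnS expn1; nia.
Qed.

Lemma card_pair_set (n : nat) (ij : 'I_n * 'I_n) : ij \in ordered_pairs n ->
  #|[set ij.1; ij.2]| = 2%N.
Proof. by rewrite inE cards2 => h; rewrite neq_ltn h. Qed.

Section Family.
Variables (n : nat) (X Qt : finType) (Qs Bs : Qt -> {set X}).
Hypothesis sQB : forall q, Qs q \subset Bs q.

(** [Bs q] is the region that all other points must avoid: the cell with its annulus in the first
    lower bound, the cell alone in the second. *)
Definition pair_in (q : Qt) (ij : 'I_n * 'I_n) (f : {ffun 'I_n -> X}) : bool :=
  [forall l, if l \in [set ij.1; ij.2] then f l \in Qs q else f l \notin Bs q].

Definition isolated_pair (q : Qt) (f : {ffun 'I_n -> X}) : bool :=
  [exists ij, (ij \in ordered_pairs n) && pair_in q ij f].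

Lemma pair_inE q ij f : pair_in q ij f ->
  [set l | f l \in Qs q] = [set ij.1; ij.2]%SET.
Proof.
move=> /forallP h; apply/setP => l; rewrite inE; move: (h l); case: ifP => // _.
by apply: contraNF => /(fintype.subsetP (sQB q)).
Qed.

Lemma ordered_pair_set_inj (ij kl : 'I_n * 'I_n) :
  ij \in ordered_pairs n -> kl \in ordered_pairs n ->
  [set ij.1; ij.2]%SET = [set kl.1; kl.2]%SET -> ij = kl.
Proof.
case: ij kl => [i j] [k l]; rewrite !inE /= => ij kl /setP e.
have := e i; have := e j; have := e k; have := e l; rewrite !inE !eqxx /= !orbT.
have [ik|nik] := eqVneq i k.
  subst k.
  have [<-//|njl] := eqVneq j l; have [li|//] := eqVneq l i.
  by move: ij kl; rewrite li ltnn.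
move=> + + _ _; move=> /orP[/eqP li|/eqP lj] /= /eqP kj; subst.
  by move: ij kl; lia.
by move: kl; rewrite ltnn.
Qed.

(** The two indices are recovered as the set of all indices landing in [Qs q], so at most one
    ordered pair contributes and the existential is an exact sum. *)
Lemma isolated_sum q f :
  (isolated_pair q f)%:R = \sum_(ij in ordered_pairs n) (pair_in q ij f)%:R :> R.
Proof.
rewrite /isolated_pair; case: existsP => [[ij /andP[ijn h]]|nh]; last first.
  rewrite big1// => ij ijn; case: (boolP (pair_in _ _ _)) => // h.
  by case: nh; exists ij; rewrite ijn.
rewrite (bigD1 ij)//= h big1 ?addr0// => kl /andP[kln nkl].
case: (boolP (pair_in q kl f)) => // h'; case/eqP: nkl.
by apply: ordered_pair_set_inj => //; rewrite -(pair_inE h) (pair_inE h').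
Qed.

Hypothesis X0 : (0 < #|X|)%N.
Variable p : R.
Hypothesis Qp : forall q, #|Qs q|%:R / #|X|%:R = p.
Let b q : R := #|Bs q|%:R / #|X|%:R.

Lemma Pr_in (S : {set X}) : Pr R (fun x => x \in S) = #|S|%:R / #|X|%:R.
Proof. by rewrite -Pr_set. Qed.

Lemma Pr_notin (S : {set X}) : Pr R (fun x => x \notin S) = 1 - #|S|%:R / #|X|%:R.
Proof. by rewrite Pr_not// Pr_in. Qed.

Lemma Pr_pair_in q ij : ij \in ordered_pairs n ->
  Pr R (pair_in q ij) = p ^+ 2 * (1 - b q) ^+ (n - 2).
Proof.
move=> ijn; rewrite /pair_in.
rewrite (Pr_prod R (fun l x => if l \in [set ij.1; ij.2]%SET then x \in Qs q else x \notin Bs q)).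
rewrite -[n in (n - 2)%N]card_ord -(card_pair_set ijn) -prod_if_set; apply: eq_bigr => l _.
by case: ifP => _; rewrite ?Pr_in ?Pr_notin.
Qed.

Lemma Pr_isolated q :
  Pr R (isolated_pair q) = #|ordered_pairs n|%:R * (p ^+ 2 * (1 - b q) ^+ (n - 2)).
Proof.
rewrite {1}/Pr (eq_avg (isolated_sum q)) avg_sum.
rewrite (eq_bigr (fun=> p ^+ 2 * (1 - b q) ^+ (n - 2))).
  by rewrite sumr_const mulr_natl.
by move=> ij ijn; apply: Pr_pair_in.
Qed.

(** Pairs sharing an index are incompatible because the cells are disjoint. Otherwise four
    coordinates lie in prescribed cells and the other [n - 4] avoid both regions; that the points of
    one pair also avoid the region of the other is dropped, whence an inequality. *)
Lemma Pr_pair_in2 q q' ij kl : [disjoint Qs q & Qs q'] ->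
  ij \in ordered_pairs n -> kl \in ordered_pairs n ->
  Pr R (fun f => pair_in q ij f && pair_in q' kl f) <=
    p ^+ 4 * (1 - #|Bs q :|: Bs q'|%:R / #|X|%:R) ^+ (n - 4).
Proof.
move=> dQ ijn kln; set c := 1 - _.
have c0 : 0 <= c by rewrite /c -Pr_notin Pr_ge0.
have p0 : 0 <= p by rewrite -(Qp q) divr_ge0 ?ler0n.
case: (boolP [disjoint [set ij.1; ij.2]%SET & [set kl.1; kl.2]%SET]) => dI; last first.
  rewrite -(@eq_Pr _ _ xpred0) => [|f].
    by rewrite /Pr /avg big1// mul0r mulr_ge0// exprn_ge0.
  apply/esym/negbTE/negP => /andP[/pair_inE h /pair_inE h'].
  move: dI; rewrite -h -h' => /negP; apply; rewrite -setI_eq0; apply/eqP/setP => l.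
  rewrite !inE; apply/negP => /andP[l1 l2]; move: dQ; rewrite -setI_eq0 => /eqP/setP/(_ (f l)).
  by rewrite !inE l1 l2.
set S := [set ij.1; ij.2]%SET in dI *; set S' := [set kl.1; kl.2]%SET in dI *.
apply: (@le_trans _ _ (Pr R (fun f : {ffun 'I_n -> X} => [forall l,
    if l \in S then f l \in Qs q else if l \in S' then f l \in Qs q' else
      f l \notin Bs q :|: Bs q']))).
  apply: sub_Pr => f /andP[/forallP h /forallP h']; apply/forallP => l.
  move: (h l) (h' l); rewrite -/S -/S' finset.in_setU negb_or.
  by case: (l \in S) => //; case: (l \in S') => // -> ->.
rewrite (Pr_prod R (fun l x => if l \in S then x \in Qs q else
   if l \in S' then x \in Qs q' else x \notin Bs q :|: Bs q')).
rewrite (eq_bigr (fun l => if l \in S :|: S' then p else c)); last first.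
  move=> l _; rewrite (finset.in_setU l); case: (l \in S) => /=; rewrite ?Pr_in//.
  by case: (l \in S'); rewrite ?Pr_in ?Pr_notin.
rewrite prod_if_set cardsU card_ord !card_pair_set//.
by move: dI; rewrite -setI_eq0 => /eqP ->; rewrite cards0.
Qed.

Lemma Pr_isolated2 q q' : [disjoint Qs q & Qs q'] ->
  Pr R (fun f => isolated_pair q f && isolated_pair q' f) <=
    (#|ordered_pairs n|%:R * p ^+ 2) ^+ 2 *
      (1 - #|Bs q :|: Bs q'|%:R / #|X|%:R) ^+ (n - 4).
Proof.
move=> dQ; set c := (_ ^+ (n - 4)).
have -> : Pr R (fun f => isolated_pair q f && isolated_pair q' f) =
    \sum_(ij in ordered_pairs n) \sum_(kl in ordered_pairs n)
      Pr R (fun f => pair_in q ij f && pair_in q' kl f).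
  rewrite /Pr; under eq_bigr do rewrite -avg_sum.
  rewrite -avg_sum; apply: eq_avg => f; rewrite -mulnb natrM !isolated_sum mulr_suml.
  by apply: eq_bigr => ij _; rewrite mulr_sumr; apply: eq_bigr => kl _; rewrite -mulnb natrM.
have -> : (#|ordered_pairs n|%:R * p ^+ 2) ^+ 2 * c = \sum_(ij in ordered_pairs n)
     \sum_(kl in ordered_pairs n) (p ^+ 4 * c).
  by rewrite !sumr_const -mulrnA -(mulr_natr _ (_ * _)) natrM; ring.
by apply: ler_sum => ij ijn; apply: ler_sum => kl kln; apply: Pr_pair_in2.
Qed.


(** Rests on [(1 - x) * (1 + 2 * x) >= 1] for [x] in [[0, 1 / 2]], together with
    [1 + 2 * x <= expR (2 * x)]. *)
Lemma expR_bernoulli (x y : R) (k : nat) : 0 <= x <= 1 / 2 -> k%:R * x <= y ->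
  expR (- (2 * y)) <= (1 - x) ^+ k.
Proof.
move=> /andP[x0 x1] kxy; apply: (@le_trans _ _ (expR (- (2 * x)) ^+ k)).
  by rewrite -expRM_natl ler_expR; lra.
rewrite lerXn2r ?nnegrE ?expR_ge0//; first lra.
rewrite expRN -[leLHS]mul1r ler_pdivrMr ?expR_gt0//.
apply: (@le_trans _ _ ((1 - x) * (1 + 2 * x))); first nra.
by rewrite ler_wpM2l ?expR_ge1Dx//; lra.
Qed.

Variable near_ : rel Qt.

(** The three terms are the diagonal, the far pairs and the near pairs of cells. For far pairs only
    the exponent [n - 4] in place of [n - 2] is lost, hence four factors [1 - bb]. For near pairs
    the avoidance probability is bounded by 1, and comparison with the mean then costs
    [(1 - bb) ^ (n - 2)] twice. *)
Lemma avg_isolated_sqr (bb Dl : R) :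
  let m := avg (fun f => #|[set q | isolated_pair q f]|%:R : R) in
  {in Qt &, forall q q', q != q' -> [disjoint Qs q & Qs q']} ->
  {in Qt &, forall q q', ~~ near_ q q' -> [disjoint Bs q & Bs q']} ->
  (forall q, #|[set q' | near_ q q']|%:R <= Dl) ->
  (forall q, b q <= bb) -> bb < 1 -> 0 < m -> (4 <= n)%N ->
  avg (fun f => #|[set q | isolated_pair q f]|%:R ^+ 2 : R) <=
    m ^+ 2 * (m^-1 + (1 - bb) ^- 4 + Dl / #|Qt|%:R * (1 - bb) ^- (2 * (n - 2))).
Proof.
move=> m dQ dB nearD bbb bb1 m0 n4.
pose e q := #|ordered_pairs n|%:R * (p ^+ 2 * (1 - b q) ^+ (n - 2)).
pose N : R := #|ordered_pairs n|%:R * p ^+ 2.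
have N0 : 0 <= N by rewrite mulr_ge0 ?sqr_ge0.
have b1 q : 1 - bb <= 1 - b q by have := bbb q; lra.
have b0 q : 0 <= b q by rewrite /b divr_ge0.
have bbp : 0 < 1 - bb by lra.
have cardE f : #|[set q | isolated_pair q f]|%:R = \sum_q (isolated_pair q f)%:R :> R.
  rewrite -sum1_card natr_sum big_mkcond /=.
  by apply: eq_bigr => q _; rewrite inE; case: (isolated_pair q f).
have mE : m = \sum_q e q.
  rewrite /m (eq_avg cardE) avg_sum; apply: eq_bigr => q _; exact: Pr_isolated.
have eN q : N * (1 - bb) ^+ (n - 2) <= e q.
  rewrite /e mulrA ler_wpM2l// lerXn2r ?nnegrE//; first exact: ltW.
  by apply: le_trans (b1 q); exact: ltW.
have e0 q : 0 <= e q by apply: le_trans (eN q); rewrite mulr_ge0// exprn_ge0// ltW.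
have -> : avg (fun f => #|[set q | isolated_pair q f]|%:R ^+ 2 : R) =
    \sum_q \sum_q' Pr R (fun f => isolated_pair q f && isolated_pair q' f).
  rewrite /Pr; under [RHS]eq_bigr do rewrite -avg_sum.
  rewrite -avg_sum; apply: eq_avg => f; rewrite cardE expr2 mulr_suml.
  by apply: eq_bigr => q _; rewrite mulr_sumr; apply: eq_bigr => q' _; rewrite -mulnb natrM.
have main q q' : q != q' -> Pr R (fun f => isolated_pair q f && isolated_pair q' f) <=
    e q * e q' * (1 - bb) ^- 4 + (near_ q q')%:R * N ^+ 2.
  move=> qq'; apply: le_trans (Pr_isolated2 (dQ _ _ isT isT qq')) _.
  rewrite -/N; set c := 1 - _.
  have c0 : 0 <= c by rewrite /c -Pr_notin Pr_ge0.
  case: (boolP (near_ q q')) => nqq'; rewrite ?mul1r ?mul0r ?addr0.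
    apply: (@le_trans _ _ (N ^+ 2)); last first.
      by rewrite lerDr (mulr_ge0 (mulr_ge0 (e0 q) (e0 q')))// invr_ge0 exprn_ge0// ltW.
    rewrite ler_piMr ?sqr_ge0// exprn_ile1//.
    by rewrite /c -Pr_notin Pr_le1.
  have dBB := dB _ _ isT isT nqq'.
  have cE : c = 1 - b q - b q'.
    rewrite /c cardsU; move: dBB; rewrite -setI_eq0 => /eqP ->.
    by rewrite cards0 subn0 natrD mulrDl /b; lra.
  (* Avoiding two disjoint regions: the events for the two regions are negatively correlated. *)
  have cb : c <= (1 - b q) * (1 - b q').
    by have := b0 q; have := b0 q'; rewrite cE; nra.
  rewrite ler_pdivlMr ?exprn_gt0//.
  have -> : e q * e q' = N ^+ 2 * (((1 - b q) * (1 - b q')) ^+ (n - 4) *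
      ((1 - b q) ^+ 2 * (1 - b q') ^+ 2)).
    rewrite /e /N; have -> : (n - 2 = (n - 4) + 2)%N by lia.
    move: (n - 4)%N => k; rewrite [((1 - b q) * _) ^+ k]exprMn !exprD; ring.
  rewrite -mulrA ler_wpM2l ?sqr_ge0// ler_pM ?exprn_ge0//; first by rewrite ltW.
    by rewrite lerXn2r ?nnegrE//; apply: le_trans cb.
  have -> : (1 - bb) ^+ 4 = (1 - bb) ^+ 2 * (1 - bb) ^+ 2 by ring.
  have h q0 : 1 - bb \is Num.nneg /\ 1 - b q0 \is Num.nneg.
    by rewrite !nnegrE; split; [|apply: le_trans (b1 q0)]; rewrite ltW.
  by rewrite ler_pM ?exprn_ge0 ?(ltW bbp)// lerXn2r//; case: (h q); case: (h q').
have QtN : #|Qt|%:R * N <= m * (1 - bb) ^- (n - 2).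
  rewrite ler_pdivlMr ?exprn_gt0// mE -mulrA mulr_natl -sumr_const.
  by apply: ler_sum => q _.
have Qt0 : 0 < #|Qt|%:R :> R.
  rewrite ltr0n lt0n; apply: contraTneq m0 => Q0; rewrite mE big1 ?ltxx// => q _.
  by have := fintype0 q; rewrite Q0; case.
apply: (@le_trans _ _ (\sum_q (e q + \sum_q' (e q * e q' * (1 - bb) ^- 4 + (near_ q q')%:R * N ^+ 2)))).
  apply: ler_sum => q _; rewrite (bigD1 q)//= lerD//.
    rewrite le_eqVlt; apply/orP; left; apply/eqP; rewrite /e -Pr_isolated//.
    by apply: eq_Pr => f; rewrite andbb.
  apply: (@le_trans _ _ (\sum_(q' | q' != q) (e q * e q' * (1 - bb) ^- 4 + (near_ q q')%:R * N ^+ 2))).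
    by apply: ler_sum => q' q'q; apply: main; rewrite eq_sym.
  rewrite [leRHS](bigD1 q)//= lerDr addr_ge0//; last by rewrite mulr_ge0 ?sqr_ge0.
  by rewrite (mulr_ge0 (mulr_ge0 (e0 q) (e0 q)))// invr_ge0 exprn_ge0// ltW.
rewrite big_split /= -mE !mulrDr expr2 mulfK ?gt_eqF// -addrA lerD2l.
under eq_bigr do rewrite big_split.
rewrite big_split /= lerD//.
  under eq_bigr do rewrite -mulr_suml -mulr_sumr -mE.
  by rewrite -!mulr_suml -mE -expr2.
apply: (@le_trans _ _ (\sum_(q : Qt) Dl * N ^+ 2)).
  apply: ler_sum => q _; rewrite -mulr_suml ler_wpM2r ?sqr_ge0//.
  apply: le_trans (nearD q); rewrite -sum1_card natr_sum [leRHS]big_mkcond /=.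
  by apply: ler_sum => q' _; rewrite inE; case: near_.
have Dl0 : 0 <= Dl.
  case: (pickP (xpredT : pred Qt)) => [q _|Q0].
    by apply: le_trans (nearD q).
  by move: Qt0; rewrite (eq_card0 (A := Qt))// ltxx.
rewrite (sumr_const Qt) -[leLHS]mulr_natl.
have -> : #|Qt|%:R * (Dl * N ^+ 2) = Dl / #|Qt|%:R * (#|Qt|%:R * N) ^+ 2.
  by field; rewrite gt_eqF.
rewrite [leRHS]mulrCA ler_wpM2l ?divr_ge0 ?ler0n//.
rewrite mulnC exprM -exprVn -exprMn lerXn2r ?nnegrE//; first exact: mulr_ge0.
by apply: mulr_ge0; rewrite ?(ltW m0)// invr_ge0 exprn_ge0// (ltW bbp).
Qed.

(** [be] bounds the expected number of points in a region, so a region stays empty with probability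
    at least [expR (- (2 * be))]. This makes [m0] a lower bound for the mean; [expR (4 * be)] is the
    square of the same loss, paid on near pairs. *)
Lemma Pr_few_isolated (bb Dl be : R) :
  let m0 := #|Qt|%:R * (n%:R ^+ 2 / 4 * p ^+ 2) / expR (2 * be) in
  {in Qt &, forall q q', q != q' -> [disjoint Qs q & Qs q']} ->
  {in Qt &, forall q q', ~~ near_ q q' -> [disjoint Bs q & Bs q']} ->
  (forall q, #|[set q' | near_ q q']|%:R <= Dl) ->
  (forall q, b q <= bb) -> 0 <= bb <= 1 / 8 -> n%:R * bb <= be ->
  0 < m0 -> (4 <= n)%N ->
  Pr R (fun f => #|[set q | isolated_pair q f]|%:R < m0 / 2) <=
    4 * (m0^-1 + 8 * bb + Dl / #|Qt|%:R * expR (4 * be)).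
Proof.
move=> m0 dQ dB nearD bbb /andP[bb0 bb8] nbe m00 n4.
set m := avg (fun f => #|[set q | isolated_pair q f]|%:R : R).
have bern : expR (- (2 * be)) <= (1 - bb) ^+ (n - 2).
  apply: expR_bernoulli; first by apply/andP; split; lra.
  by apply: le_trans nbe; rewrite ler_wpM2r// ler_nat leq_subr.
have m0m : m0 <= m.
  have cardE f : #|[set q | isolated_pair q f]|%:R = \sum_q (isolated_pair q f)%:R :> R.
    rewrite -sum1_card natr_sum big_mkcond /=.
    by apply: eq_bigr => q _; rewrite inE; case: (isolated_pair q f).
  rewrite /m (eq_avg cardE) avg_sum /m0 -mulrA mulr_natl -(sumr_const Qt).
  apply: ler_sum => q _; rewrite -[leRHS]/(Pr R (isolated_pair q)) Pr_isolated -expRN -(mulrA (_ / 4)).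
  apply: ler_pM; [by rewrite divr_ge0 ?sqr_ge0| |exact: card_ordered_pairs_ge (ltnW (ltnW n4))|].
    by rewrite mulr_ge0 ?expR_ge0 ?sqr_ge0.
  rewrite ler_wpM2l ?sqr_ge0//; apply: (le_trans bern).
  by rewrite lerXn2r ?nnegrE//; [lra| |]; have := bbb q; lra.
have mp : 0 < m by apply: lt_le_trans m0m.
have Qt0 : 0 <= Dl / #|Qt|%:R.
  rewrite divr_ge0 ?ler0n//; case: (pickP (xpredT : pred Qt)) => [q _|Q0].
    by apply: le_trans (nearD q).
  by move: m00; rewrite /m0 (eq_card0 (A := Qt))// !mul0r ltxx.
have bb1 : bb < 1 by lra.
have h := avg_isolated_sqr dQ dB nearD bbb bb1 mp n4.
apply: (@le_trans _ _ (Pr R (fun f => #|[set q | isolated_pair q f]|%:R < m / 2))).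
  by apply: sub_Pr => f /lt_le_trans -> //; rewrite ler_pM2r.
apply: chebyshev_lower => //; apply: le_trans h _; rewrite ler_wpM2l ?sqr_ge0//.
have h1 : m^-1 <= m0^-1 by rewrite lef_pV2.
(* The origin of [1 / 8]: [(1 + 8 * x) * (1 - 4 * x) >= 1] holds exactly for [x] in [[0, 1 / 8]]. *)
have h2 : (1 - bb) ^- 4 <= 1 + 8 * bb.
  rewrite -[leLHS]mul1r ler_pdivrMr ?exprn_gt0//; last lra.
  have : (1 - bb) ^+ 4 >= 1 - 4 * bb.
    have -> : (1 - bb) ^+ 4 = 1 - 4 * bb + bb ^+ 2 * (6 - 4 * bb + bb ^+ 2) by ring.
    rewrite lerDl mulr_ge0 ?sqr_ge0//; have := sqr_ge0 bb; lra.
  move=> h3; have : (1 + 8 * bb) * (1 - 4 * bb) <= (1 + 8 * bb) * (1 - bb) ^+ 4.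
    by rewrite ler_wpM2l//; lra.
  by apply: le_trans; nra.
have h3 : (1 - bb) ^- (2 * (n - 2)) <= expR (4 * be).
  rewrite mulnC exprM -exprVn.
  have -> : expR (4 * be) = expR (2 * be) ^+ 2 by rewrite -expRM_natl; congr expR; ring.
  have bp : 0 < (1 - bb) ^+ (n - 2) by rewrite exprn_gt0//; lra.
  rewrite lerXn2r ?nnegrE ?expR_ge0 ?invr_ge0 ?(ltW bp)//.
  by rewrite -[expR _]invrK lef_pV2 ?posrE ?invr_gt0 ?expR_gt0// -expRN.
have := ler_wpM2l Qt0 h3; lra.
Qed.

End Family.
End IsolatedPairs.

(** * Tail bound for the number of cells holding at least two points *)

Section DoubleCells.
Variable R : realType.
Variables (I Y Qt : finType) (Qs : Qt -> {set Y}).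
Hypothesis dQ : forall q q', q != q' -> [disjoint Qs q & Qs q'].

Definition has_pair (J : {set I}) (q : Qt) (h : {ffun I -> Y}) : bool :=
  [exists ij : I * I, [&& ij.1 \in J, ij.2 \in J, ij.1 != ij.2,
     h ij.1 \in Qs q & h ij.2 \in Qs q]].

Definition distinct_pairs (J : {set I}) : {set I * I} :=
  [set ij | [&& ij.1 \in J, ij.2 \in J & ij.1 != ij.2]].

Lemma card_distinct_pairs J : (#|distinct_pairs J| <= #|J| ^ 2)%N.
Proof.
rewrite expnS expn1 -cardsX; apply: subset_leq_card; apply/fintype.subsetP => -[i j].
by rewrite !inE /= => /and3P[-> ->].
Qed.

(** Let [S i] be the set of cells whose chosen pair contains [i]. The factor of coordinate [i] is at
    most [k ^ #|S i|]: it is 1 or at most [k] when [S i] has at most one element, and 0 otherwise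
    since the cells are disjoint. Overlapping pairs thus need no separate treatment, and the
    exponents add up to [2 * #|A|]. *)
Lemma Pr_pairs_in (A : {set Qt}) (pi : {ffun Qt -> I * I}) (k : R) :
  (forall q, #|Qs q|%:R / #|Y|%:R <= k) ->
  (forall q, q \in A -> (pi q).1 != (pi q).2) ->
  avg (fun h : {ffun I -> Y} => \prod_(q in A)
    ((h (pi q).1 \in Qs q) && (h (pi q).2 \in Qs q))%:R) <= k ^+ (2 * #|A|).
Proof.
move=> Qk pi12.
pose S i := [set q in A | (i == (pi q).1) || (i == (pi q).2)].
have -> : avg (fun h : {ffun I -> Y} => \prod_(q in A)
    ((h (pi q).1 \in Qs q) && (h (pi q).2 \in Qs q))%:R : R) =
    avg (fun h : {ffun I -> Y} => \prod_i \prod_(q in S i) (h i \in Qs q)%:R).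
  apply: eq_avg => h; rewrite (exchange_big_dep (mem A)) /=; last first.
    by move=> i q _; rewrite inE => /andP[].
  apply: eq_bigr => q qA.
  rewrite (eq_bigl (fun i => (i == (pi q).1) || (i == (pi q).2))); last first.
    by move=> i; rewrite inE qA.
  rewrite (bigD1 (pi q).1) ?eqxx//= (bigD1 (pi q).2) /=; last first.
    by rewrite eqxx orbT eq_sym pi12.
  rewrite big1 ?mulr1 -?natrM ?mulnb// => i.
  by case: eqP => //=; case: eqP.
rewrite (avg_prod (fun i x => \prod_(q in S i) (x \in Qs q)%:R : R)).
have Si i : avg (fun x => \prod_(q in S i) (x \in Qs q)%:R : R) <= k ^+ #|S i|.
  have k0 : S i != finset.set0 -> 0 <= k.
    by move=> /set0Pn[q _]; apply: le_trans (Qk q); rewrite divr_ge0.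
  have [S0|[q qS]] := set_0Vmem (S i).
    rewrite S0 cards0 expr0; apply: avg_le_cst => // x.
    by rewrite big_set0.
  have kk : 0 <= k by apply: k0; apply/set0Pn; exists q.
  have [S1|[q' q'S]] := set_0Vmem (S i :\ q).
    have -> : S i = [set q]%SET.
      apply/setP => q'; rewrite inE; move/setP/(_ q'): S1; rewrite !inE.
      by have [->|_] := eqVneq; [move: qS; rewrite inE => -> | move=> /= ->].
    rewrite cards1 expr1 (eq_avg (Z := fun x => (x \in Qs q)%:R)) => [|x].
      by apply: le_trans (Qk q); rewrite -Pr_set.
    by rewrite big_set1.
  apply: (@le_trans _ _ 0); last by rewrite exprn_ge0.
  apply: avg_le_cst => // x; rewrite (bigD1 q)//= (bigD1 q') /=; last first.
    by move: q'S; rewrite !inE => /andP[-> ->].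
  case: (boolP (x \in Qs q)) => xq; rewrite ?mul0r//.
  case: (boolP (x \in Qs q')) => xq'; rewrite ?mul0r ?mulr0//.
  have := dQ (q := q) (q' := q'); move: q'S; rewrite !inE eq_sym => /andP[-> _] /(_ isT).
  by rewrite -setI_eq0 => /eqP/setP/(_ x); rewrite !inE xq xq'.
apply: (@le_trans _ _ (\prod_i k ^+ #|S i|)).
  apply: ler_prod => i _; rewrite Si andbT; apply: avg_ge0 => x.
  by apply: prodr_ge0 => q _; rewrite ler0n.
rewrite prodrXr le_eqVlt; apply/orP; left; apply/eqP; congr (_ ^+ _).
under eq_bigr do rewrite -sum1_card.
rewrite (exchange_big_dep (mem A)) /=; last by move=> i q _; rewrite inE => /andP[].
rewrite (eq_bigr (fun=> 2%N)) ?sum_nat_const 1?mulnC// => q qA.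
rewrite (eq_bigl (mem [set (pi q).1; (pi q).2]%SET)); last first.
  by move=> i; rewrite !inE qA.
by rewrite sum1_card cards2 pi12.
Qed.

(** Union bound over the choice of a pair of indices for each cell of [A], obtained by expanding a
    product of sums; there are at most [#|J| ^ 2] choices per cell. *)
Lemma Pr_double_all (J : {set I}) (A : {set Qt}) (k : R) :
  (forall q, #|Qs q|%:R / #|Y|%:R <= k) ->
  Pr R (fun h => [forall q in A, has_pair J q h]) <= (#|J|%:R * k) ^+ (2 * #|A|).
Proof.
move=> Qk.
have [A0|[q0 q0A]] := set_0Vmem A.
  by rewrite A0 cards0 muln0 expr0 Pr_le1.
have k0 : 0 <= k by apply: le_trans (Qk q0); rewrite divr_ge0.
pose F h q (ij : I * I) : R := ((h ij.1 \in Qs q) && (h ij.2 \in Qs q))%:R.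
apply: (@le_trans _ _ (avg (fun h : {ffun I -> Y} =>
   \prod_(q in A) \sum_(ij in distinct_pairs J) F h q ij))).
  apply: le_avg => h; have F0 q ij : 0 <= F h q ij by rewrite ler0n.
  case: forallP => /= [hA|_]; last by apply: prodr_ge0 => q _; apply: sumr_ge0.
  apply: (big_ind (fun x : R => 1 <= x)) => //; first exact: mulr_ege1.
  move=> q qA; have /existsP[ij /and5P[i1 i2 i12 h1 h2]] := implyP (hA q) qA.
  rewrite (bigD1 ij) /=; last by rewrite inE i1 i2 i12.
  by rewrite {1}/F h1 h2 lerDl sumr_ge0.
case: (pickP (xpredT : pred (I * I))) => [ij0 _|I0]; last first.
  apply: (@le_trans _ _ 0); last by rewrite exprn_ge0 ?mulr_ge0.
  apply: avg_le_cst => // h; rewrite (bigD1 q0)//= big1 ?mul0r// => ij.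
  by have := I0 ij.
have -> : avg (fun h : {ffun I -> Y} =>
     \prod_(q in A) \sum_(ij in distinct_pairs J) F h q ij) =
   \sum_(pi in pffun_on ij0 (mem A) (mem (distinct_pairs J)))
     avg (fun h : {ffun I -> Y} => \prod_(q in A) F h q (pi q)).
  rewrite -avg_sum; apply: eq_avg => h.
  by rewrite (big_distr_big ij0 (mem A) (mem (distinct_pairs J))).
apply: (@le_trans _ _ (\sum_(pi in pffun_on ij0 (mem A) (mem (distinct_pairs J)))
   k ^+ (2 * #|A|))).
  apply: ler_sum => pi /pffun_onP[_ piJ].
  apply: Pr_pairs_in => // q qA; have := piJ (pi q).
  by rewrite fintype.image_f// => /(_ isT); rewrite inE => /and3P[].
rewrite sumr_const card_pffun_on -[leLHS]mulr_natl exprMn ler_wpM2r ?exprn_ge0//.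
by rewrite -natrX ler_nat expnM leq_exp2r ?card_distinct_pairs// lt0n; apply/pred0Pn; exists q0.
Qed.

(** Union bound over the subsets of [F] of size [l], at most [Ph ^ l / l!] in number: a Poisson type
    tail with mean parameter [Ph * (N * k) ^ 2]. *)
Lemma Pr_many_double (J : {set I}) (F : {set Qt}) (k N Ph : R) (l : nat) :
  (forall q, #|Qs q|%:R / #|Y|%:R <= k) -> 0 <= k ->
  #|J|%:R <= N -> #|F|%:R <= Ph ->
  Pr R (fun h => (l <= #|[set q in F | has_pair J q h]|)%N) <=
    (Ph * (N * k) ^+ 2) ^+ l / l`!%:R.
Proof.
move=> Qk k0 JN FP.
pose C := [set A : {set Qt} | A \subset F & #|A| == l].
apply: (@le_trans _ _ (\sum_(A in C) Pr R (fun h => [forall q in A, has_pair J q h]))).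
  rewrite /Pr -avg_sum; apply: le_avg => h.
  case: leqP => [lF|_]; last by apply: sumr_ge0 => A _; rewrite ler0n.
  pose D := [set q in F | has_pair J q h].
  pose A := [set:: take l (enum D)].
  have cA : #|A| = l.
    rewrite cardsE (card_uniqP _) ?take_uniq ?enum_uniq// size_takel//.
    by rewrite -cardE.
  have sA : A \subset D.
    by apply/fintype.subsetP => q; rewrite inE => /mem_take; rewrite mem_enum.
  rewrite (bigD1 A) /=; last first.
    rewrite inE cA eqxx andbT; apply: fintype.subset_trans sA _.
    by apply/fintype.subsetP => q; rewrite inE => /andP[].
  have -> : [forall q in A, has_pair J q h].
    by apply/forallP => q; apply/implyP => /(fintype.subsetP sA); rewrite inE => /andP[].
  by rewrite lerDl sumr_ge0// => B _; rewrite ler0n.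
apply: (@le_trans _ _ (\sum_(A in C) (N * k) ^+ (2 * l))).
  apply: ler_sum => A; rewrite inE => /andP[_ /eqP <-].
  apply: le_trans (Pr_double_all _ _ Qk) _; rewrite lerXn2r ?nnegrE ?mulr_ge0//.
    by apply: le_trans JN.
  by rewrite ler_wpM2r.
rewrite sumr_const cards_draws -[leLHS]mulr_natl exprM [(Ph * _) ^+ l]exprMn [leRHS]mulrAC.
apply: ler_wpM2r; first by rewrite exprn_ge0// exprn_even_ge0.
rewrite ler_pdivlMr ?ltr0n ?fact_gt0//.
rewrite -natrM bin_ffact; apply: (@le_trans _ _ (#|F| ^ l)%:R).
  rewrite ler_nat ffact_prod -[X in (_ <= _ ^ X)%N]card_ord -prod_nat_const.
  by apply: leq_prod => i _; rewrite leq_subr.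
by rewrite natrX lerXn2r ?nnegrE//; apply: le_trans FP.
Qed.

End DoubleCells.

(** * Independence by resampling coordinates *)

Section Resampling.
Variables (R : realType) (I X : finType).

Lemma card_pred_fst (A B : finType) (x : A) :
  #|[pred ab : A * B | ab.1 == x]| = #|B|.
Proof.
rewrite -[RHS](card_imset _ (f := fun b => (x, b))); last by move=> ? ? [].
apply: eq_card => -[a b]; rewrite !inE /=; apply/eqP/imsetP => [->|[b' _ [->]]//].
by exists b.
Qed.

Lemma card_pred_snd (A B : finType) (y : B) :
  #|[pred ab : A * B | ab.2 == y]| = #|A|.
Proof.
rewrite -[RHS](card_imset _ (f := fun a => (a, y))); last by move=> ? ? [].
apply: eq_card => -[a b]; rewrite !inE /=; apply/eqP/imsetP => [->|[a' _ [_ ->]]//].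
by exists a.
Qed.

Lemma avg_coord (i : I) (A : X -> R) : (0 < #|X|)%N ->
  avg (fun h : {ffun I -> X} => A (h i)) = avg A.
Proof.
move=> X0; have := avg_prod (I := I) (fun l x => if l == i then A x else 1).
rewrite (bigD1 i)//= eqxx big1 ?mulr1 => [<-|l /negPf ->]; last exact: avg_cst.
apply: eq_avg => h; rewrite (bigD1 i)//= eqxx big1 ?mulr1// => l /negPf -> //.
Qed.

(** [F] may depend on coordinate [j]: redrawing coordinate [i] alone leaves [F] unchanged, and the
    conditional probability of [A] is [p] whatever [f j] is. This gives independence of relations
    between pairs of points that share a point. *)
Lemma Pr_resample_coord (F : pred {ffun I -> X}) (A : X -> X -> bool) i j (p : R) :
  i != j -> (forall f g : {ffun I -> X}, (forall l, l != i -> f l = g l) -> F f = F g) ->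
  (0 < #|X|)%N -> (forall y, Pr R (A^~ y) = p) ->
  Pr R (fun f => F f && A (f i) (f j)) = Pr R F * p.
Proof.
move=> ij FE X0 Ap.
rewrite {1}/Pr -(avg_resample (Y := X) (g := fun l a y => if l == i then y else a)) //; last first.
  by move=> l x; case: (l == i); [exact: card_pred_snd|exact: card_pred_fst].
rewrite /Pr -avgZr; apply: eq_avg => f.
transitivity ((F f)%:R * avg (fun h : {ffun I -> X} => (A (h i) (f j))%:R : R)).
  rewrite -avgZ; apply: eq_avg => h; rewrite !ffunE eqxx eq_sym (negPf ij).
  rewrite (FE _ f) => [|l /negPf li]; first by rewrite -natrM mulnb.
  by rewrite ffunE li.
by rewrite (avg_coord i (fun x => (A x (f j))%:R)) // -[avg _]/(Pr R (A^~ (f j))) Ap.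
Qed.

Lemma Pr_pair_rel (A : X -> X -> bool) i j (p : R) :
  i != j -> (0 < #|X|)%N -> (forall y, Pr R (A^~ y) = p) ->
  Pr R (fun f : {ffun I -> X} => A (f i) (f j)) = p.
Proof.
move=> ij X0 Ap; rewrite -[RHS]mul1r.
have <- : avg (fun _ : {ffun I -> X} => 1) = 1 :> R.
  by apply: avg_cst; rewrite card_ffun expn_gt0 X0.
exact: (@Pr_resample_coord xpredT A i j p ij).
Qed.

End Resampling.

(** * Translation invariance on the discrete torus *)

Section Translation.
Variables (R : realType) (M : nat).
Local Notation X := ('I_M.+1 * 'I_M.+1)%type.

Lemma card_translate (S : {set X}) (y : X) : #|[pred x : X | (x - y : X) \in S]| = #|S|.
Proof.
rewrite -[LHS](card_imset _ (f := fun x : X => (x - y : X))); last exact: addIr.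
apply: eq_card => x; apply/imsetP/idP => [[z + ->]|xS]; first by rewrite inE.
by exists (x + y); rewrite ?addrK// inE addrK.
Qed.

Lemma Pr_diff (I : finType) (S : {set X}) (i j : I) : i != j ->
  Pr R (fun f : {ffun I -> X} => f i - f j \in S) = #|S|%:R / #|{: X}|%:R.
Proof.
move=> ij; apply: (Pr_pair_rel (A := fun x y : X => (x - y : X) \in S)) => //.
  by apply/card_gt0P; exists (0 : X).
by move=> y; rewrite PrE card_translate.
Qed.

End Translation.

(** * Graph distances *)

Section Graphs.
Variables (V : finType) (e : rel V).

Lemma metric_dim_le (W : {set V}) : resolving e W -> (metric_dim e <= #|W|)%N.
Proof.
by move=> We; rewrite /metric_dim; case: arg_minnP => [|A _]; [exact: resolving_setT|apply].
Qed.

Lemma metric_dimP : exists2 W : {set V}, resolving e W & metric_dim e = #|W|.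
Proof.
rewrite /metric_dim; case: arg_minnP => [|W We _]; first exact: resolving_setT.
by exists W.
Qed.

Lemma has_walkP x y k :
  reflect (exists p, [/\ size p = k, path e x p & last x p = y]) (has_walk e x y k).
Proof.
apply: (iffP existsP) => [[p /andP[pe /eqP pl]]|[p [/eqP sp pe pl]]].
  by exists p; rewrite size_tuple.
by exists (Tuple sp); rewrite /= pe pl eqxx.
Qed.

Lemma has_walk0 x y : has_walk e x y 0 = (x == y).
Proof.
apply/has_walkP/eqP => [[p [/size0nil ->]]//|->]; by exists [::].
Qed.

Lemma has_walkS x y k :
  has_walk e x y k.+1 = [exists z, has_walk e x z k && e z y].
Proof.
apply/has_walkP/existsP => [[p []]|[z /andP[/has_walkP[p [sp pe pl]] ezy]]].
  case/lastP: p => // p a; rewrite size_rcons rcons_path last_rcons => -[sp] /andP[pe ea] <-.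
  by exists (last x p); rewrite ea andbT; apply/has_walkP; exists p.
by exists (rcons p y); rewrite size_rcons sp rcons_path pe pl ezy last_rcons.
Qed.

Lemma graph_dist_SomeP x y k :
  graph_dist e x y = Some k <->
  has_walk e x y k /\ forall j, (j < k)%N -> ~~ has_walk e x y j.
Proof.
rewrite /graph_dist; case: pselect => [h|nh]; last first.
  by split=> // -[hk _]; case: nh; exists k.
case: ex_minnP => m hm mmin; split=> [[<-]|[hk kmin]].
  by split=> // j; apply: contraTN => /mmin; rewrite leqNgt.
congr Some; apply/eqP; rewrite eqn_leq mmin//= leqNgt.
by apply/negP => /kmin; rewrite hm.
Qed.

Lemma graph_dist_None x y : (forall k, ~~ has_walk e x y k) -> graph_dist e x y = None.
Proof.
move=> nw; rewrite /graph_dist; case: pselect => // -[k hk].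
by exfalso; apply/negP: hk.
Qed.

Lemma graph_dist_adj x y : x != y -> (graph_dist e x y == Some 1%N) = e x y.
Proof.
move=> xy; apply/eqP/idP => [/graph_dist_SomeP[]|exy].
  by rewrite has_walkS => /existsP[z /andP[]]; rewrite has_walk0 => /eqP ->.
apply/graph_dist_SomeP; split.
  by rewrite has_walkS; apply/existsP; exists x; rewrite has_walk0 eqxx.
by case=> // _; rewrite has_walk0.
Qed.

Lemma resolvingP (W : {set V}) :
  reflect (forall u v, (forall w, w \in W -> graph_dist e w u = graph_dist e w v) -> u = v)
    (resolving e W).
Proof.
apply: (iffP forallP) => [We u v uv|h u].
  apply/eqP; move/forallP/(_ v)/implyP: (We u); apply.
  by apply/forallP => w; apply/implyP => wW; rewrite uv.
apply/forallP => v; apply/implyP => /forallP uv; apply/eqP/h => w wW.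
by apply/eqP; exact: implyP (uv w) wW.
Qed.

(** * Twins are resolved only by themselves *)

Section Twins.
Variables u v : V.
Hypothesis twin : forall x, x != u -> x != v -> e x u = e x v.
Hypothesis e_sym : symmetric e.
Hypothesis uu : e u u = e v v.

Let s := tperm u v.

Let e_tperm x y : e (s x) (s y) = e x y.
Proof.
have tw x' : x' != u -> x' != v -> e u x' = e v x'.
  by move=> *; rewrite ![e _ x']e_sym twin.
rewrite /s; case: (tpermP u v x) => [->|->|xu xv]; case: (tpermP u v y) => [->|->|yu yv] //.
- by apply/esym/tw; apply/eqP.
- by apply/tw; apply/eqP.
- by apply/esym/twin; apply/eqP.
- by apply/twin; apply/eqP.
Qed.

Let has_walk_tperm x y k : has_walk e x y k -> has_walk e (s x) (s y) k.
Proof.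
elim: k y => [|k IH] y; first by rewrite !has_walk0 (inj_eq perm_inj).
rewrite !has_walkS => /existsP[z /andP[/IH xz zy]]; apply/existsP; exists (s z).
by rewrite xz e_tperm.
Qed.

(** The transposition of [u] and [v] is an automorphism fixing [w], so it exchanges the walks from
    [w] to [u] with those from [w] to [v]. *)
Lemma twin_graph_dist w : w != u -> w != v -> graph_dist e w u = graph_dist e w v.
Proof.
move=> wu wv.
have hw k : has_walk e w u k = has_walk e w v k.
  have sw : s w = w by rewrite /s tpermD// eq_sym.
  apply/idP/idP => /has_walk_tperm; rewrite sw; first by rewrite /s tpermL.
  by rewrite /s tpermR.
case E : (graph_dist e w u) => [k|].
  apply/esym/graph_dist_SomeP; move/graph_dist_SomeP: E => [h1 h2].
  by rewrite -hw; split=> // j /h2; rewrite hw.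
apply/esym/graph_dist_None => k; rewrite -hw; apply/negP => hk.
by move: E; rewrite /graph_dist; case: pselect => // -[]; exists k.
Qed.

End Twins.

(** * Distances from an outside vertex to a clique *)

Section CliqueLayers.
Variables (J : {set V}) (w : V).
Hypothesis clique : {in J &, forall u v, u != v -> e u v}.
Hypothesis wJ : w \notin J.

Definition layer_step (X : {set V}) : {set V} :=
  w |: [set u | (u \notin J) && [exists a in X, e a u]].

(* The vertices reached from [w] in fewer than [k] steps outside [J]. *)
Definition layer (k : nat) : {set V} := iter k layer_step finset.set0.

Definition seen (X : {set V}) (v : V) : bool := [exists a in X, e a v].

Let layer_step_mono : {homo layer_step : X Y / X \subset Y}.
Proof.
move=> X Y /fintype.subsetP XY; apply: finset.setUS; apply/fintype.subsetP => u.
rewrite !inE => /andP[-> /existsP[a /andP[aX ea]]].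
by apply/existsP; exists a; rewrite XY.
Qed.

Let layer_mono j k : (j <= k)%N -> layer j \subset layer k.
Proof.
by move=> jk; apply: (subset_iter layer_step_mono).
Qed.

(** A monotone iteration starting from the empty set is stationary after [#|V|] steps. *)
Let layer_card k : layer k \subset layer #|V|.
Proof. exact: (iter_sub_fix layer_step_mono). Qed.

Let layer_walk k a : a \in layer k -> exists2 j, (j < k)%N & has_walk e w a j.
Proof.
elim: k a => [|k IH] a; first by rewrite inE.
rewrite /layer iterS !inE => /orP[/eqP ->|/andP[_ /existsP[b /andP[/IH[j jk wb] eba]]]].
  by exists 0%N => //; rewrite has_walk0.
by exists j.+1 => //; rewrite has_walkS; apply/existsP; exists b; rewrite wb.
Qed.

(** As long as the layer sees no vertex of [J], no walk can enter [J], so the layers capture every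
    short walk and not only those avoiding [J]. *)
Let walk_layer k : {in J, forall v, ~~ seen (layer k) v} ->
  forall j a, (j <= k)%N -> has_walk e w a j -> a \in layer j.+1.
Proof.
move=> nk; elim=> [|j IH] a jk.
  by rewrite has_walk0 => /eqP <-; rewrite !inE eqxx.
rewrite has_walkS => /existsP[z /andP[/(IH _ (ltnW jk)) zl eza]].
rewrite [layer _]iterS !inE; apply/orP; right; apply/andP; split; last first.
  by apply/existsP; exists z; rewrite zl.
apply/negP => /nk/negP; apply; apply/existsP; exists z; rewrite eza andbT.
exact: fintype.subsetP (layer_mono jk) _ zl.
Qed.

Lemma layer_notJ k a : a \in layer k -> a \notin J.
Proof.
case: k => [|k]; first by rewrite inE.
by rewrite [layer _]iterS !inE => /orP[/eqP ->//|/andP[]].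
Qed.

(** Take the least layer that sees a vertex of [J], of index [k.+1] because layer 0 is empty. No
    walk of length at most [k] ends in [J]; the seen vertices are at distance [k.+1], and the others
    at [k.+2] through one edge of the clique. If nothing is ever seen, all distances to [J] are
    infinite. The bound by [#|V|] leaves finitely many layers for a later union bound. *)
Lemma clique_graph_dist : exists2 k, (k <= #|V|)%N &
  {in J &, forall u v, seen (layer k) u = seen (layer k) v ->
     graph_dist e w u = graph_dist e w v}.
Proof.
case: (boolP [exists v in J, seen (layer #|V|) v]) => [|nV]; last first.
  exists 0%N => // u v uJ vJ _.
  have nk k : {in J, forall v, ~~ seen (layer k) v}.
    move=> a aJ; apply: contraNN nV => /existsP[b /andP[bk eba]].
    apply/existsP; exists a; rewrite aJ; apply/existsP; exists b.
    by rewrite eba (fintype.subsetP (layer_card k)).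
  have nw a : a \in J -> graph_dist e w a = None.
    move=> aJ; apply: graph_dist_None => k; apply: contraTN aJ => /(walk_layer (nk k)).
    by move=> /(_ (leqnn k))/layer_notJ.
  by rewrite !nw.
move=> VV.
have ex : exists k, [exists v in J, seen (layer k) v] by exists #|V|.
case: (ex_minnP ex) => -[|k] /existsP[a /andP[aJ ak]] kmin.
  by move: ak => /existsP[b]; rewrite inE.
exists k.+1; first exact: kmin.
have nk : {in J, forall v, ~~ seen (layer k) v}.
  move=> v vJ; apply/negP => vk; have /kmin : [exists v in J, seen (layer k) v].
    by apply/existsP; exists v; rewrite vJ.
  by rewrite ltnn.
have nowalk v j : v \in J -> (j <= k)%N -> ~~ has_walk e w v j.
  by move=> vJ jk; apply: contraTN vJ => /(walk_layer nk jk)/layer_notJ.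
have dseen v : v \in J -> seen (layer k.+1) v -> has_walk e w v k.+1.
  move=> vJ /existsP[b /andP[/layer_walk[j jk wb] ebv]].
  have wv : has_walk e w v j.+1.
    by rewrite has_walkS; apply/existsP; exists b; rewrite wb.
  have [jk'|kj] := leqP j.+1 k; first by move: (nowalk _ _ vJ jk'); rewrite wv.
  by have <- : j.+1 = k.+1 by apply/eqP; rewrite eqn_leq jk kj.
have d1 v : v \in J -> seen (layer k.+1) v -> graph_dist e w v = Some k.+1.
  move=> vJ vs; apply/graph_dist_SomeP; split; first exact: dseen.
  by move=> j jk; apply: nowalk.
have d2 v : v \in J -> ~~ seen (layer k.+1) v -> graph_dist e w v = Some k.+2.
  move=> vJ vs; apply/graph_dist_SomeP; split.
    rewrite has_walkS; apply/existsP; exists a; rewrite dseen//=.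
    by apply: clique => //; apply: contraNneq vs => <-.
  move=> j; rewrite ltnS leq_eqVlt => /orP[/eqP ->|jk]; last exact: nowalk.
  (* The last but one vertex of a walk of length [k.+1] would lie in layer [k.+1] and make [v]
     seen. *)
  rewrite has_walkS; apply/negP => /existsP[z /andP[/(walk_layer nk (leqnn k)) zl ezv]].
  by move/negP: vs; apply; apply/existsP; exists z; rewrite zl.
move=> u v uJ vJ; case: (boolP (seen _ u)) => us /esym vs.
  by rewrite !d1.
by rewrite !d2// vs.
Qed.

End CliqueLayers.
End Graphs.

(** Layers are determined by the edges outside [J]; hence they survive a resampling of the points of
    [J]. *)
Lemma eq_layer (V : finType) (e1 e2 : rel V) (J : {set V}) (w : V) (k : nat) :
  w \notin J -> (forall a u, a \notin J -> u \notin J -> e1 a u = e2 a u) ->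
  layer e1 J w k = layer e2 J w k.
Proof.
move=> wJ e12; elim: k => // k IH; rewrite /layer !iterS -!/(layer _ _ _ _) IH.
congr (_ |: _); apply/setP => u; rewrite !inE; have [//|/= uJ] := boolP (u \in J).
apply: eq_existsb => a; case: (boolP (a \in _)) => //= /(layer_notJ wJ) aJ.
exact: e12.
Qed.

(** * The discrete torus *)

Section DiscreteTorus.
Variable M : nat.
Implicit Types a b : 'I_M.+1.

(** Distance to 0 on the cycle of length [M.+1]. *)
Definition nrm a : nat := minn a (M.+1 - a).

(** Branches replace [modn], which puts statements about [nrm] within reach of [lia]. *)
Lemma val_ordD a b : val (a + b) = (if a + b < M.+1 then a + b else a + b - M.+1)%N.
Proof.
have la := ltn_ord a; have lb := ltn_ord b; rewrite /=; case: ltnP => h.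
  by rewrite modn_small.
have -> : (a + b = a + b - M.+1 + M.+1)%N by lia.
by rewrite modnDr modn_small ?addnK//; lia.
Qed.

Lemma val_ordN a : val (- a) = (if a == 0 :> nat then 0 else M.+1 - a)%N.
Proof.
have la := ltn_ord a; rewrite /=; case: eqP => [->|h]; first by rewrite subn0 modnn.
by rewrite modn_small//; lia.
Qed.

Lemma val_ordB a b : val (a - b) = (if b <= a then a - b else M.+1 + a - b)%N.
Proof.
have la := ltn_ord a; have lb := ltn_ord b.
by rewrite val_ordD val_ordN; case: eqP => hb; case: ltnP => h1; case: leqP => h2; lia.
Qed.

Lemma nrmN a : nrm (- a) = nrm a.
Proof. by have := ltn_ord a; rewrite /nrm val_ordN; case: eqP; lia. Qed.

Lemma nrmD a b : (nrm (a + b)%R <= nrm a + nrm b)%N.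
Proof.
have la := ltn_ord a; have lb := ltn_ord b.
by rewrite /nrm val_ordD; case: ltnP; lia.
Qed.

Lemma nrm_le_half a : (2 * nrm a <= M.+1)%N.
Proof. by have := ltn_ord a; rewrite /nrm; lia. Qed.

Lemma nrm_sub a b : (b <= a)%N -> nrm (a - b) = minn (a - b) (M.+1 - (a - b)).
Proof. by move=> ba; rewrite /nrm val_ordB ba. Qed.

Lemma card_ord_interval k (lo hi : nat) :
  (#|[set i : 'I_k | (lo <= i <= hi)%N]| <= hi.+1 - lo)%N.
Proof.
rewrite cardE -(size_map val) -(size_iota lo (hi.+1 - lo)); apply: uniq_leq_size.
  by rewrite map_inj_uniq ?enum_uniq//; exact: val_inj.
by move=> i /mapP[j]; rewrite mem_enum inE => jj ->; rewrite mem_iota /=; lia.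
Qed.

Lemma card_nrm_interval lo hi : (#|[set a | lo <= nrm a <= hi]| <= 2 * (hi.+1 - lo))%N.
Proof.
have [lh|lh] := leqP lo hi; last first.
  rewrite (_ : [set a | _] = finset.set0) ?cards0//.
  by apply/setP => a; rewrite !inE; lia.
pose S := [set i : 'I_M.+1 | (lo <= i <= hi)%N].
pose T := [set i : 'I_M.+1 | (M.+1 - hi <= i <= M.+1 - lo)%N].
have cS : (#|S| <= _)%N := card_ord_interval M.+1 lo hi.
have cT : (#|T| <= _)%N := card_ord_interval M.+1 (M.+1 - hi) (M.+1 - lo).
apply: (@leq_trans #|S :|: T|); last by have := cardsUI S T; lia.
apply: subset_leq_card; apply/fintype.subsetP => a; rewrite !inE /nrm.
by have := ltn_ord a; lia.
Qed.

Lemma card_ord_le_diam k (S : {set 'I_k}) (d : nat) :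
  (forall i j, i \in S -> j \in S -> (i <= j + d)%N) -> (#|S| <= d.+1)%N.
Proof.
move=> Sd; have [->|[i0 i0S]] := set_0Vmem S; first by rewrite cards0.
case: (arg_minnP (val : 'I_k -> nat) i0S) => i iS imin.
apply: (@leq_trans #|[set j : 'I_k | (i <= j <= i + d)%N]|).
  by apply/subset_leq_card/fintype.subsetP => j jS; rewrite inE imin// Sd.
by apply: leq_trans (card_ord_interval _ _ _) _; lia.
Qed.

End DiscreteTorus.

(** * Lattice point counts for annuli and differences of discs *)

Section Geometry.
Variables (R : realType) (M : nat).
Local Notation G := ('I_M.+1 * 'I_M.+1)%type.

(** A norm value is taken by at most two residues, and the values fill an interval with at most
    [d + 1] integers. *)
Lemma card_nrm_diam (S : {set 'I_M.+1}) (d : R) : 0 <= d ->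
  (forall a b, a \in S -> b \in S -> (nrm a)%:R <= (nrm b)%:R + d) ->
  #|S|%:R <= 2 * d + 2.
Proof.
move=> d0 Sd; have [->|[a0 a0S]] := set_0Vmem S; first by rewrite cards0; lra.
case: (arg_minnP (@nrm M) a0S) => a aS amin.
apply: (@le_trans _ _ (2 * ((Num.truncn d)%:R + 1))); last first.
  by have := truncn_le d; rewrite d0; lra.
rewrite -[X in _ + X]/(1%:R) -natrD -natrM ler_nat.
apply: (@leq_trans #|[set b | (nrm a <= nrm b <= nrm a + Num.truncn d)%N]|).
  apply/subset_leq_card/fintype.subsetP => b bS; rewrite inE amin//= -leq_subLR.
  rewrite truncn_ge_nat//; have [ab|/ltnW ab] := leqP (nrm a) (nrm b).
    by rewrite natrB//; have := Sd _ _ bS aS; lra.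
  by move: ab; rewrite -subn_eq0 => /eqP ->.
by apply: leq_trans (card_nrm_interval _ _ _) _; lia.
Qed.

Definition n2 (z : G) : nat := (nrm z.1 ^ 2 + nrm z.2 ^ 2)%N.

Definition swap (z : G) : G := (z.2, z.1).

Lemma card_fibers (A B : finType) (S : {set A * B}) (T : {set B}) (c : R) :
  (forall z, z \in S -> z.2 \in T) ->
  (forall b, #|[set a | (a, b) \in S]|%:R <= c) ->
  #|S|%:R <= #|T|%:R * c.
Proof.
move=> ST Sc.
have -> : #|S| = (\sum_(b in T) #|[set a | (a, b) \in S]|)%N.
  rewrite -sum1_card (eq_bigl (fun z : A * B => true && (z \in S)))//.
  under [RHS]eq_bigr do rewrite -sum1_card.
  rewrite [RHS](exchange_big_dep xpredT)//= pair_big_dep /=.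
  apply: eq_bigl; case=> a b /=; rewrite inE.
  by case: (boolP ((a, b) \in S)) => [/ST ->|]; rewrite ?andbF.
by rewrite natr_sum mulr_natl -sumr_const; apply: ler_sum.
Qed.

(** By symmetry one may count the points whose first coordinate has the larger norm [x], so that
    [x >= rho / 2]. With the second coordinate fixed, [x ^ 2] varies by at most [4 * rho * w], hence
    [x] by at most [4 * w]; and the second coordinate takes order [rho] values. *)
Lemma card_annulus (rho w : R) : 1 <= w -> w <= rho / 4 ->
  #|[set z : G | (rho - w) ^+ 2 <= (n2 z)%:R <= (rho + w) ^+ 2]|%:R <= 100 * rho * w.
Proof.
move=> w1 w4; set S := [set z | _].
pose S1 := [set z in S | (nrm z.2 <= nrm z.1)%N].
have S1c : #|S1|%:R <= 50 * rho * w.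
  pose T : {set 'I_M.+1} := [set b | (nrm b)%:R <= 5 / 4 * rho].
  have Tc : #|T|%:R <= 2 * (5 / 4 * rho) + 2.
    apply: card_nrm_diam => [|a b]; first lra.
    by rewrite !inE => ha hb; have := ler0n R (nrm b); lra.
  apply: (@le_trans _ _ (#|T|%:R * (10 * w))); last by nra.
  apply: card_fibers => [z|b].
    rewrite !inE /n2 natrD !natrX => /andP[/andP[_ h] _].
    have := ler0n R (nrm z.1); have := ler0n R (nrm z.2); nra.
  apply: (@le_trans _ _ (2 * (4 * w) + 2)); last by lra.
  apply: card_nrm_diam => [|a a']; first lra.
  rewrite !inE /n2 /= !natrD !natrX.
  move=> /andP[/andP[h1 h2] h3] /andP[/andP[h1' h2'] h3'].
  move: h3 h3'; rewrite -!(ler_nat R).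
  have := ler0n R (nrm a); have := ler0n R (nrm a'); have := ler0n R (nrm b).
  move: (nrm a)%:R (nrm a')%:R (nrm b)%:R h1 h2 h1' h2' => x x' y h1 h2 h1' h2' y0 x'0 x0 yx yx'.
  have hx : rho / 2 <= x by nra.
  have hx' : rho / 2 <= x' by nra.
  have hd : x ^+ 2 - x' ^+ 2 <= 4 * rho * w by nra.
  rewrite leNgt; apply/negP => xx; nra.
have S2c : #|[set z in S | ~~ (nrm z.2 <= nrm z.1)%N]|%:R <= 50 * rho * w.
  apply: le_trans S1c; rewrite ler_nat.
  rewrite -(card_imset (mem [set z in S | _]) (f := swap)); last by move=> [? ?] [? ?] [-> ->].
  apply/subset_leq_card/fintype.subsetP => _ /imsetP[z + ->].
  by rewrite !inE /n2 /= addnC => /andP[-> /=]; lia.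
have -> : #|S| = (#|S1| + #|[set z in S | ~~ (nrm z.2 <= nrm z.1)%N]|)%N.
  rewrite -(cardsID [set z | (nrm z.2 <= nrm z.1)%N] S); congr (_ + _)%N; apply: eq_card => z.
    by rewrite !inE.
  by rewrite !inE andbC.
by rewrite natrD; lra.
Qed.

(** The residue at distance [x] from 0 on the side away from [v], so that passing from 0 to [v] adds
    the norms until they wrap around. *)
Definition opp_pt (v : 'I_M.+1) (x : nat) : 'I_M.+1 :=
  if (v <= M.+1 - v)%N then - inord x else inord x.

Lemma nrm_opp_pt v x : (x <= M)%N -> (nrm (opp_pt v x) <= x)%N.
Proof.
by move=> xM; rewrite /opp_pt; case: ifP => _; rewrite ?nrmN /nrm inordK; lia.
Qed.

Lemma nrm_opp_pt_sub v x : (x <= M)%N -> (x + nrm v <= M.+1)%N ->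
  nrm (opp_pt v x - v) = minn (x + nrm v) (M.+1 - (x + nrm v)).
Proof.
move=> xM; have lv := ltn_ord v; rewrite /opp_pt; case: ifP => hv.
  rewrite -opprD nrmN /nrm val_ordD inordK; last lia.
  by case: ltnP; lia.
rewrite /nrm val_ordB inordK; last lia.
by move=> h; case: leqP; lia.
Qed.

Lemma opp_pt_inj v x y : (x <= M)%N -> (y <= M)%N -> opp_pt v x = opp_pt v y -> x = y.
Proof.
move=> xM yM; rewrite /opp_pt; case: ifP => _; [move=> /oppr_inj|];
  by move=> /(congr1 val); rewrite /= !inordK; lia.
Qed.

Lemma opp_pt_pair_inj (v : G) (g g' t t' y y' : nat) :
  (g - t <= M)%N -> (g' - t' <= M)%N -> (y < M)%N -> (y' < M)%N ->
  opp_pt v.1 (g - t) = opp_pt v.1 (g' - t') -> opp_pt v.2 y.+1 = opp_pt v.2 y'.+1 ->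
  (g - t = g' - t')%N /\ y = y'.
Proof.
move=> gM g'M yM y'M e1 e2; split; first exact: opp_pt_inj e1.
by apply: succn_inj; exact: opp_pt_inj e2.
Qed.

Lemma opp_pt_bounds (v : G) (g t y b : nat) :
  (t < b)%N -> (b <= g)%N -> (4 * g <= M.+1)%N -> (8 * y.+1 <= M.+1)%N ->
  (b <= nrm v.1)%N ->
  [/\ (nrm (opp_pt v.1 (g - t)) <= g)%N, (nrm (opp_pt v.2 y.+1) <= y.+1)%N,
      (y.+1 <= nrm (opp_pt v.2 y.+1 - v.2)%R)%N &
      (g.+1 <= nrm (opp_pt v.1 (g - t) - v.1)%R)%N \/
      (M.+1 <= 2 * nrm (opp_pt v.1 (g - t) - v.1)%R + 2 * g)%N].
Proof.
move=> tb bg gM yM bv; have hv1 := nrm_le_half v.1; have hv2 := nrm_le_half v.2.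
have gtM : (g - t <= M)%N by lia.
have y1M : (y.+1 <= M)%N by lia.
have s1 : (g - t + nrm v.1 <= M.+1)%N by lia.
have s2 : (y.+1 + nrm v.2 <= M.+1)%N by lia.
have n1 := nrm_opp_pt v.1 gtM; have n2 := nrm_opp_pt v.2 y1M.
rewrite (nrm_opp_pt_sub gtM s1) (nrm_opp_pt_sub y1M s2).
move: (nrm v.1) (nrm v.2) (nrm _) (nrm _) bv hv1 hv2 s1 s2 n1 n2 => a1 a2 p q.
by move=> *; split; lia.
Qed.

(** In each of about [rho / 2] rows take the last [eta] or so points of the half chord of the disc
    around 0, on the side away from [v]. Shifting by [v] pushes them beyond the end of the chord.
    The second coordinate is also taken away from [v], so that it cannot compensate. *)
Lemma card_separating1 (rho eta : R) (v : G) :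
  4 * rho <= M.+1%:R -> 4 <= rho -> 2 <= eta -> eta <= rho / 2 ->
  eta <= (nrm v.1)%:R ->
  rho * eta / 8 <= #|[set z : G | ((n2 z)%:R <= rho ^+ 2) &&
                       (rho ^+ 2 < (n2 (z - v))%:R)]|%:R.
Proof.
move=> rM r4 e2 er ev.
pose a := Num.truncn (rho / 2); pose b := Num.truncn eta.
have ha : a%:R <= rho / 2 < a.+1%:R by apply: truncn_itv; lra.
have hb : b%:R <= eta < b.+1%:R by apply: truncn_itv; lra.
(* [g y] is the integer half length of the chord at height [y.+1]. *)
pose g (y : nat) := Num.truncn (Num.sqrt (rho ^+ 2 - y.+1%:R ^+ 2)).
have hg y : (y < a)%N -> (g y)%:R ^+ 2 + y.+1%:R ^+ 2 <= rho ^+ 2 < (g y).+1%:R ^+ 2 + y.+1%:R ^+ 2.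
  move=> ya; have yr : y.+1%:R <= rho / 2 by apply: le_trans (andP ha).1; rewrite ler_nat.
  have y0 : 1 <= y.+1%:R :> R by rewrite ler1n.
  have D0 : 0 <= rho ^+ 2 - y.+1%:R ^+ 2 by nra.
  have /andP[g1 g2] : (g y)%:R <= Num.sqrt (rho ^+ 2 - y.+1%:R ^+ 2) < (g y).+1%:R.
    by apply: truncn_itv; rewrite sqrtr_ge0.
  have s2 := sqr_sqrtr D0; have s0 := sqrtr_ge0 (rho ^+ 2 - y.+1%:R ^+ 2).
  have g0 := ler0n R (g y).
  by apply/andP; split; nra.
have gb y : (y < a)%N -> (b <= g y)%N.
  move=> ya; have yr : y.+1%:R <= rho / 2 by apply: le_trans (andP ha).1; rewrite ler_nat.
  have y0 : 1 <= y.+1%:R :> R by rewrite ler1n.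
  have /andP[_ g2] := hg _ ya; case/andP: hb => hb _.
  rewrite -ltnS -(ltr_nat R); have g0 := ler0n R (g y).+1; nra.
have gM y : (y < a)%N -> 4 * (g y)%:R <= M.+1%:R :> R.
  move=> ya; have /andP[g1 _] := hg _ ya; have g0 := ler0n R (g y).
  have y0 : 1 <= y.+1%:R :> R by rewrite ler1n.
  nra.
have gM' y : (y < a)%N -> (4 * g y <= M.+1)%N by move=> /gM; rewrite -natrM ler_nat.
have aM : (8 * a <= M.+1)%N.
  by rewrite -(ler_nat R) natrM; case/andP: ha => ha _; lra.
pose F (yt : 'I_a * 'I_b) : G := (opp_pt v.1 (g yt.1 - yt.2), opp_pt v.2 yt.1.+1).
have yM y : (y < a)%N -> (8 * y.+1 <= M.+1)%N.
  by move: aM; clear; lia.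
have Finj : injective F.
  move=> [y t] [y' t'] [] /= e1 e2'.
  have lt := ltn_ord t; have lt' := ltn_ord t'.
  have := gM' _ (ltn_ord y); have := gM' _ (ltn_ord y').
  have := gb _ (ltn_ord y); have := gb _ (ltn_ord y').
  have := yM _ (ltn_ord y); have := yM _ (ltn_ord y').
  move: (opp_pt_pair_inj (v := v) (g := g y) (g' := g y') (t := t) (t' := t')
    (y := y) (y' := y')) => h h1 h2 h3 h4 h5 h6.
  have [||||//|//|eg ey] := h; [by move: h6; clear; lia|by move: h5; clear; lia|
    by move: h2; clear; lia|by move: h1; clear; lia|].
  have {}ey : y = y' by apply: val_inj.
  subst y'; congr (_, _); apply: val_inj => /=.
  by move: eg lt lt' h4; clear; lia.
(* Rounding down costs at most half: [a >= rho / 4] as [rho >= 4], and [b >= eta / 2] as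
   [eta >= 2]. *)
apply: (@le_trans _ _ (a * b)%:R).
  rewrite natrM; case/andP: ha => _; case/andP: hb => _; rewrite -![in X in X -> _]natr1.
  nra.
rewrite -[a]card_ord -[b]card_ord -card_prod -(card_imset _ Finj) ler_nat.
apply/subset_leq_card/fintype.subsetP => _ /imsetP[[y t] _ ->]; rewrite inE.
have ly := ltn_ord y; have /andP[g1 g2] := hg _ ly.
have bv : (b <= nrm v.1)%N.
  by rewrite -(ler_nat R); apply: le_trans ev; case/andP: hb.
have [n1 n1' n2' n3'] := opp_pt_bounds (v := v) (ltn_ord t) (gb _ ly) (gM' _ ly) (yM _ ly) bv.
have sq (i j : nat) : (i <= j)%N -> i%:R ^+ 2 <= j%:R ^+ 2 :> R.
  by move=> ij; rewrite lerXn2r ?nnegrE// ler_nat.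
apply/andP; split.
  by apply: le_trans g1; rewrite /n2 natrD !natrX lerD// sq.
have -> : (n2 (F (y, t) - v))%:R = (nrm (opp_pt v.1 (g y - t) - v.1))%:R ^+ 2 +
    (nrm (opp_pt v.2 y.+1 - v.2))%:R ^+ 2 :> R by rewrite /n2 natrD !natrX.
case: n3' => [n3|].
  by apply: (lt_le_trans g2); rewrite lerD ?sq.
(* If the sum wraps around, the distance is at least half the side minus [g y], which exceeds [rho]
   because [4 * rho <= M.+1]. *)
have y0 : 1 <= y.+1%:R :> R by rewrite ler1n.
rewrite -(ler_nat R) natrD !natrM; have g0 := ler0n R (g y).
move: (nrm (opp_pt v.1 _ - v.1))%:R (nrm (opp_pt v.2 _ - v.2))%:R => p q hp.
have gr : (g y)%:R < rho by rewrite ltNge; apply/negP => h'; nra.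
have pr : rho < p by lra.
have q0 := sqr_ge0 q; nra.
Qed.

Lemma card_separating (rho eta : R) (v : G) :
  4 * rho <= M.+1%:R -> 4 <= rho -> 2 <= eta -> eta <= rho / 2 ->
  (eta <= (nrm v.1)%:R) || (eta <= (nrm v.2)%:R) ->
  rho * eta / 8 <= #|[set z : G | ((n2 z)%:R <= rho ^+ 2) &&
                       (rho ^+ 2 < (n2 (z - v))%:R)]|%:R.
Proof.
move=> rM r4 e2 er /orP[|] ev; first exact: card_separating1.
apply: le_trans (@card_separating1 rho eta (swap v) rM r4 e2 er ev) _.
rewrite ler_nat -(card_imset _ (f := swap)); last by move=> [? ?] [? ?] [-> ->].
apply/subset_leq_card/fintype.subsetP => _ /imsetP[z + ->].
by rewrite !inE /n2 /= addnC [X in (_ < X%:R)]addnC.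
Qed.

End Geometry.

(** * From the continuous torus to the grid *)

Section Discretize.
Local Open Scope classical_set_scope.

(** * Cyclic norms as minima over lattice translates *)

Section Lattice.
Variables (R : realType) (M : nat).

Lemma nrm_lattice_ge (a b : 'I_M.+1) (k : int) :
  (nrm (a - b))%:R <= `|a%:R - b%:R + M.+1%:R * k%:~R| :> R.
Proof.
have la : a%:R <= M%:R :> R by rewrite ler_nat -ltnS.
have lb : b%:R <= M%:R :> R by rewrite ler_nat -ltnS.
have a0 := ler0n R a; have b0 := ler0n R b.
have key : (nrm (a - b))%:R <= `|a%:R - b%:R| :> R /\
  (nrm (a - b))%:R <= M.+1%:R - `|a%:R - b%:R| :> R.
  wlog ba : a b la lb a0 b0 / (b <= a)%N.
    move=> H; have [/H|/ltnW/H] := leqP b a; first exact.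
    by rewrite -nrmN opprB distrC; apply.
  rewrite nrm_sub// ger0_norm ?subr_ge0 ?ler_nat// -!natrB//; last first.
    by have := ltn_ord a; lia.
  by rewrite !ler_nat; split; lia.
case: key => k1 k2; have [k0|kn0] := eqVneq k 0.
  by rewrite k0 mulr0 addr0.
have k3 : 1 <= `|k%:~R| :> R.
  by rewrite -intr_norm ler1z; have := normr_gt0 k; rewrite kn0; lia.
have M1 : `|M.+1%:R * k%:~R| = M.+1%:R * `|k%:~R| :> R by rewrite normrM ger0_norm.
have := ler_normB (a%:R - b%:R + M.+1%:R * k%:~R : R) (a%:R - b%:R).
have -> : a%:R - b%:R + M.+1%:R * k%:~R - (a%:R - b%:R) = M.+1%:R * k%:~R :> R by ring.
rewrite M1; have : M.+1%:R <= M.+1%:R * `|k%:~R| :> R by rewrite ler_peMr.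
lra.
Qed.

Lemma nrm_lattice_eq (a b : 'I_M.+1) :
  exists k : int, `|a%:R - b%:R + M.+1%:R * k%:~R| = (nrm (a - b))%:R :> R.
Proof.
wlog ba : a b / (b <= a)%N.
  move=> H; have [/H//|/ltnW/H[k kE]] := leqP b a; exists (- k).
  rewrite -nrmN opprB -kE -normrN rmorphN /=; congr `|_|; ring.
have lab : (a - b <= M.+1)%N by have := ltn_ord a; lia.
rewrite nrm_sub//; have [h|/ltnW h] := leqP (a - b)%N (M.+1 - (a - b))%N.
  exists 0; rewrite mulr0 addr0 natrB// ger0_norm// subr_ge0 ler_nat//.
exists (- 1); rewrite natrB// natrB// rmorphN /= mulrN1.
rewrite -normrN ger0_norm; first ring.
rewrite opprB -natrB// subr_ge0 ler_nat//.
Qed.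

End Lattice.

(** * Measurability of the torus metric *)

Section TorusDist.
Variables (R : realType) (L : R).

Let dists (x y : R * R) := [set Num.sqrt ((x.1 - y.1 + L * k.1%:~R) ^+ 2 +
                     (x.2 - y.2 + L * k.2%:~R) ^+ 2) | k in [set: int * int]].

Let dists_lb x y : lbound (dists x y) 0.
Proof. by move=> _ [k _ <-]; exact: sqrtr_ge0. Qed.

Let dists_nonempty x y : dists x y !=set0.
Proof. by eexists; exists (0, 0). Qed.

Lemma torus_dist_le x y k :
  torus_dist L x y <= Num.sqrt ((x.1 - y.1 + L * k.1%:~R) ^+ 2 +
                     (x.2 - y.2 + L * k.2%:~R) ^+ 2).
Proof. by apply: ge_inf; [exists 0; exact: dists_lb|exists k]. Qed.

Lemma torus_dist_ge x y (c : R) : (forall k : int * int,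
   c <= Num.sqrt ((x.1 - y.1 + L * k.1%:~R) ^+ 2 + (x.2 - y.2 + L * k.2%:~R) ^+ 2)) ->
  c <= torus_dist L x y.
Proof.
by move=> h; apply: lb_le_inf => [|_ [k _ <-]//]; exact: dists_nonempty.
Qed.

(** The slack [m.+1^-1] replaces attainment of the infimum and displays the condition as a countable
    intersection of countable unions. *)
Lemma torus_dist_leP x y r : torus_dist L x y <= r <->
  forall m : nat, exists k : int * int, Num.sqrt ((x.1 - y.1 + L * k.1%:~R) ^+ 2 +
                     (x.2 - y.2 + L * k.2%:~R) ^+ 2) < r + m.+1%:R^-1.
Proof.
split=> [h m|h].
  have : torus_dist L x y < r + m.+1%:R^-1 by apply: le_lt_trans h _; rewrite ltrDl invr_gt0.
  by move=> /(inf_lt (dists_nonempty x y))[_ [k _ <-]]; exists k.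
apply/ler_addgt0Pr => e e0.
have [m me] : exists m : nat, m.+1%:R^-1 < e.
  exists (Num.truncn e^-1); rewrite -[ltRHS]invrK ltf_pV2 ?posrE ?invr_gt0//.
  have e1 : 0 <= e^-1 by rewrite invr_ge0 ltW.
  by have /andP[] := truncn_itv e1.
have [k hk] := h m; apply: le_trans (torus_dist_le _ _ k) _.
by apply: le_trans (ltW hk) _; rewrite lerD2l ltW.
Qed.

Lemma measurable_torus_dist (d : measure_display) (T : measurableType d)
    (f g : T -> R * R) (r : R) :
  measurable_fun setT f -> measurable_fun setT g ->
  measurable [set w | torus_dist L (f w) (g w) <= r].
Proof.
move=> mf mg.
have -> : [set w | torus_dist L (f w) (g w) <= r] = \bigcap_m \bigcup_(k : int * int)
   [set w | Num.sqrt (((f w).1 - (g w).1 + L * k.1%:~R) ^+ 2 +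
                     ((f w).2 - (g w).2 + L * k.2%:~R) ^+ 2) < r + m.+1%:R^-1].
  apply/seteqP; split => w /=.
    by move=> /torus_dist_leP h m _; have [k hk] := h m; exists k.
  by move=> h; apply/torus_dist_leP => m; have [k _ hk] := h m Logic.I; exists k.
apply: bigcapT_measurable => m; apply: countable_bigcupT_measurable => // k.
set F := (fun w => Num.sqrt (((f w).1 - (g w).1 + L * k.1%:~R) ^+ 2 +
                     ((f w).2 - (g w).2 + L * k.2%:~R) ^+ 2)).
have mF : measurable_fun setT F.
  apply: (measurableT_comp (continuous_measurable_fun (@sqrt_continuous R))).
  have m1 : measurable_fun setT (fun w => (f w).1) by apply: measurableT_comp mf.
  have m2 : measurable_fun setT (fun w => (f w).2) by apply: measurableT_comp mf.
  have m3 : measurable_fun setT (fun w => (g w).1) by apply: measurableT_comp mg.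
  have m4 : measurable_fun setT (fun w => (g w).2) by apply: measurableT_comp mg.
  apply: measurable_funD; apply: measurable_funX; apply: measurable_funD => //;
   exact: measurable_funB.
have := measurable_fun_ltr mF (measurable_cst (r + m.+1%:R^-1) (D := setT)).
move=> /(_ measurableT [set true] Logic.I); by rewrite setTI.
Qed.

End TorusDist.

Definition grid_graph (R : realType) (n M : nat) (rho : R)
    (f : {ffun 'I_n -> 'I_M.+1 * 'I_M.+1}) : rel 'I_n :=
  fun i j => (i != j) && ((n2 (f i - f j))%:R <= rho ^+ 2).

(** * Rounding points to half-open cells *)

Section Cells.
Variables (R : realType) (M : nat) (h : R).
Hypothesis h0 : 0 < h.
Local Notation G := ('I_M.+1 * 'I_M.+1)%type.
Let L := h * M.+1%:R.

Definition cell (z : G) : set (R * R) :=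
  `[h * z.1%:R, h * z.1.+1%:R[ `*` `[h * z.2%:R, h * z.2.+1%:R[.

Lemma cellP z x : cell z x <->
  (h * z.1%:R <= x.1 < h * z.1.+1%:R) /\ (h * z.2%:R <= x.2 < h * z.2.+1%:R).
Proof. by rewrite /cell /=; split=> -[]; rewrite /= !in_itv /=. Qed.

Lemma cell_coordP (a : 'I_M.+1) (x : R) :
  h * a%:R <= x < h * a.+1%:R -> exists2 t, 0 <= t < 1 & x = h * (a%:R + t).
Proof.
move=> /andP[x1 x2]; exists (x / h - a%:R).
  rewrite subr_ge0 ltrBlDr ler_pdivlMr// ltr_pdivrMr// mulrC x1 /= mulrC addrC.
  by rewrite natr1.
by rewrite addrC subrK mulrCA divff ?gt_eqF// mulr1.
Qed.

Lemma cell_coord_le (a b : 'I_M.+1) (x y : R) :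
  h * a%:R <= x < h * a.+1%:R -> h * b%:R <= y < h * b.+1%:R ->
  exists k : int, `|x - y + L * k%:~R| <= h * ((nrm (a - b))%:R + 1).
Proof.
move=> /cell_coordP[t /andP[t0 t1] ->] /cell_coordP[u /andP[u0 u1] ->].
have [k kE] := nrm_lattice_eq R a b; exists k.
have -> : h * (a%:R + t) - h * (b%:R + u) + L * k%:~R =
    h * ((a%:R - b%:R + M.+1%:R * k%:~R) + (t - u)) by rewrite /L; ring.
rewrite normrM (gtr0_norm h0) ler_wpM2l ?(ltW h0)// -kE.
by apply: le_trans (ler_normD _ _) _; rewrite lerD2l ler_norml; lra.
Qed.

Lemma cell_coord_ge (a b : 'I_M.+1) (x y : R) (k : int) :
  h * a%:R <= x < h * a.+1%:R -> h * b%:R <= y < h * b.+1%:R ->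
  h * ((nrm (a - b))%:R - 1) <= `|x - y + L * k%:~R|.
Proof.
move=> /cell_coordP[t /andP[t0 t1] ->] /cell_coordP[u /andP[u0 u1] ->].
have kE := nrm_lattice_ge R a b k.
have -> : h * (a%:R + t) - h * (b%:R + u) + L * k%:~R =
    h * ((a%:R - b%:R + M.+1%:R * k%:~R) - (u - t)) by rewrite /L; ring.
rewrite normrM (gtr0_norm h0) ler_wpM2l ?(ltW h0)//.
apply: le_trans (lerB_dist _ _); apply: lerB => //.
by rewrite ler_norml; lra.
Qed.

(** Rounding changes each coordinate difference by at most one cell, hence distances by less than
    two cells; the margin 3 leaves room. *)
Lemma cell_torus_dist_le (rho : R) (z z' : G) x y : 3 <= rho ->
  cell z x -> cell z' y -> (n2 (z - z'))%:R < (rho - 3) ^+ 2 ->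
  torus_dist L x y <= h * rho.
Proof.
move=> rho3 /cellP[x1 x2] /cellP[y1 y2]; rewrite /n2 natrD !natrX => hn.
have [k1 kE1] := cell_coord_le x1 y1; have [k2 kE2] := cell_coord_le x2 y2.
apply: le_trans (torus_dist_le L x y (k1, k2)) _.
rewrite -[leRHS]ger0_norm; last by rewrite mulr_ge0 ?ltW//; lra.
rewrite -sqrtr_sqr ler_sqrt ?sqr_ge0// exprMn /=.
have := ler0n R (nrm (z.1 - z'.1)); have := ler0n R (nrm (z.2 - z'.2)).
move: (nrm _)%:R (nrm _)%:R hn kE1 kE2 => p q hn kE1 kE2 q0 p0.
have p3 : p <= rho - 3 by rewrite leNgt; apply/negP => ?; nra.
have q3 : q <= rho - 3 by rewrite leNgt; apply/negP => ?; nra.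
apply: (@le_trans _ _ (h ^+ 2 * ((p + 1) ^+ 2 + (q + 1) ^+ 2))); last first.
  by rewrite ler_wpM2l ?sqr_ge0//; nra.
have sq (u v : R) : `|u| <= v -> u ^+ 2 <= v ^+ 2.
  by move=> uv; rewrite -real_normK ?num_real// lerXn2r ?nnegrE//; apply: le_trans uv.
by rewrite mulrDr -!exprMn [leRHS]addrC lerD// sq.
Qed.

Lemma cell_torus_dist_gt (rho : R) (z z' : G) x y : 3 <= rho ->
  cell z x -> cell z' y -> (rho + 3) ^+ 2 < (n2 (z - z'))%:R ->
  h * rho < torus_dist L x y.
Proof.
move=> rho3 /cellP[x1 x2] /cellP[y1 y2]; rewrite /n2 natrD !natrX => hn.
apply: (@lt_le_trans _ _ (h * (rho + 1))); first by rewrite ltr_pM2l// ltrDl.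
apply: torus_dist_ge => -[k1 k2] /=.
rewrite -[leLHS]ger0_norm; last by rewrite mulr_ge0 ?ltW//; lra.
rewrite -sqrtr_sqr ler_sqrt ?addr_ge0 ?sqr_ge0//.
have kE1 := cell_coord_ge k1 x1 y1; have kE2 := cell_coord_ge k2 x2 y2.
rewrite -[(x.1 - _ + _) ^+ 2]real_normK ?num_real// -[(x.2 - _ + _) ^+ 2]real_normK ?num_real//.
move: kE1 kE2; have := normr_ge0 (x.1 - y.1 + L * k1%:~R); have := normr_ge0 (x.2 - y.2 + L * k2%:~R).
move: `|_| `|_| => u v v0 u0.
have -> : u = h * (u / h) by rewrite mulrCA divff ?gt_eqF// mulr1.
have -> : v = h * (v / h) by rewrite mulrCA divff ?gt_eqF// mulr1.
have := divr_ge0 u0 (ltW h0); have := divr_ge0 v0 (ltW h0).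
move: (u / h) (v / h) => {u0 v0}u {}v v0 u0; rewrite !ler_pM2l// => ku kv.
rewrite !exprMn -mulrDr ler_wpM2l ?sqr_ge0// leNgt; apply/negP => uv.
have := ler0n R (nrm (z.1 - z'.1)); have := ler0n R (nrm (z.2 - z'.2)).
move: (nrm _)%:R (nrm _)%:R hn ku kv => p q hn ku kv q0 p0.
have u1 : u <= rho + 1 by rewrite leNgt; apply/negP => ?; nra.
have v1 : v <= rho + 1 by rewrite leNgt; apply/negP => ?; nra.
have pu : p ^+ 2 <= (v + 1) ^+ 2 by rewrite lerXn2r ?nnegrE//; lra.
have qv : q ^+ 2 <= (u + 1) ^+ 2 by rewrite lerXn2r ?nnegrE//; lra.
nra.
Qed.

Lemma cell_disjoint (z z' : G) x : cell z x -> cell z' x -> z = z'.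
Proof.
have coord (a b : 'I_M.+1) u : h * a%:R <= u < h * a.+1%:R ->
    h * b%:R <= u < h * b.+1%:R -> a = b.
  move=> /andP[a1 a2] /andP[b1 b2]; apply: val_inj; apply/eqP => /=.
  have := le_lt_trans a1 b2; have := le_lt_trans b1 a2.
  by rewrite !ltr_pM2l// !ltr_nat; lia.
by case: z z' => [a b] [c d] /cellP[/= x1 x2] /cellP[/= y1 y2]; rewrite (coord _ _ _ x1 y1) (coord _ _ _ x2 y2).
Qed.

Lemma measurable_cell z : measurable (cell z).
Proof. by apply: measurableX; exact: measurable_itv. Qed.

Lemma cell_subset z (S : R) : S = L -> cell z `<=` `[0, S] `*` `[0, S].
Proof.
move=> -> x /cellP[/andP[x1 x2] /andP[y1 y2]] /=; rewrite !in_itv /=.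
have le (a : 'I_M.+1) : h * a.+1%:R <= L by rewrite /L ler_pM2l// ler_nat.
have ge (a : 'I_M.+1) : 0 <= h * a%:R by rewrite mulr_ge0// ltW.
rewrite (le_trans (ge z.1) x1) (le_trans (ge z.2) y1) /=.
by rewrite (ltW (lt_le_trans x2 (le _))) (ltW (lt_le_trans y2 (le _))).
Qed.

Lemma lebesgue_cell z :
  (lebesgue_measure \x lebesgue_measure)%E (cell z) = (h ^+ 2)%:E.
Proof.
rewrite product_measure1E; [|exact: measurable_itv..].
have side (a : 'I_M.+1) : lebesgue_measure `[h * a%:R, h * a.+1%:R[%classic = h%:E.
  rewrite lebesgue_measure_itv /= lte_fin ltr_pM2l// ltr_nat ltnSn.
  by rewrite -EFinB -mulrBr -natr1 addrAC subrr add0r mulr1.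
transitivity (h%:E * h%:E)%E; first by congr (_ * _)%E; exact: side.
by rewrite -EFinM expr2.
Qed.

End Cells.

(** * Comparison of the continuous model with the grid *)

Section Discretization.
Variables (R : realType) (n M : nat) (r : R).
Hypothesis n0 : (0 < n)%N.
Variables (d : measure_display) (T : measurableType d) (P : probability T R)
  (X : 'I_n -> {RV P >-> (R * R)%type}).
Hypothesis Xind : mutually_independent X.
Hypothesis Xunif : forall i, uniform_on_torus n (X i).
Variable E : rel 'I_n -> Prop.

Local Notation G := ('I_M.+1 * 'I_M.+1)%type.
Let L : R := torus_side R n.
Let h := L / M.+1%:R.
Let rho := r * M.+1%:R / L.

Let L0 : 0 < L.
Proof. by rewrite /L /torus_side sqrtr_gt0 ltr0n. Qed.

Let h0 : 0 < h.
Proof. by rewrite divr_gt0. Qed.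

Let LE : L = h * M.+1%:R.
Proof. by rewrite /h divfK// pnatr_eq0. Qed.

Let hrho : h * rho = r.
Proof. by rewrite /h /rho; field; rewrite gt_eqF//= pnatr_eq0. Qed.

Let event : set T := [set w | E (torus_graph r (fun i => X i w))].

(** [E] is an arbitrary property, so measurability comes from writing the event as a finite union
    over the adjacency tables that satisfy [E]. *)
Lemma measurable_event : measurable event.
Proof.
pose rels := [set g : {ffun 'I_n * 'I_n -> bool} | E (fun i j => g (i, j))].
have -> : event = \bigcup_(g in rels) \bigcap_(ij : 'I_n * 'I_n)
   [set w | torus_graph r (fun i => X i w) ij.1 ij.2 = g ij].
  apply/seteqP; split => w /=.
    move=> Ew; exists [ffun ij => torus_graph r (fun i => X i w) ij.1 ij.2].
      by congr E: Ew; apply/funext => i; apply/funext => j; rewrite ffunE.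
    by move=> ij _ /=; rewrite ffunE.
  move=> [g Eg gw]; congr E: Eg; apply/funext => i; apply/funext => j.
  by rewrite -(gw (i, j) Logic.I).
apply: fin_bigcup_measurable => [|g _]; first exact: finite_finset.
apply: fin_bigcap_measurable => [|[i j] _ /=]; first exact: finite_finset.
have mD := measurable_torus_dist L r (measurable_funPT (X i)) (measurable_funPT (X j)).
have [ij|ij] := eqVneq i j.
  have -> : [set w | torus_graph r (fun i0 => X i0 w) i j = g (i, j)] =
      [set w | false = g (i, j)].
    by apply/seteqP; split => w /=; rewrite /torus_graph ij eqxx.
  case: (g _); last by rewrite (_ : [set _ | _] = setT)//; apply/seteqP.
  by rewrite (_ : [set _ | _] = set0)//; apply/seteqP; split.
case: (g (i, j)).
  rewrite (_ : [set w | _] = [set w | torus_dist L (X i w) (X j w) <= r])//.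
  by apply/seteqP; split => w /=; rewrite /torus_graph ij /=.
rewrite (_ : [set w | _] = ~` [set w | torus_dist L (X i w) (X j w) <= r]).
  exact: measurableC.
by apply/seteqP; split => w /=; rewrite /torus_graph ij /=; [move=> -> | move/negP/negbTE].
Qed.

Let in_cells (f : {ffun 'I_n -> G}) : set T :=
  \bigcap_(i in [set` [set: 'I_n]%SET]) (X i @^-1` cell h (f i)).

(** Independence and equal areas of the cells make the cell indices a uniform function; this is
    where the distribution of the sample enters. *)
Let P_cells f : P (in_cells f) = ((#|{: G}|%:R ^- n : R))%:E.
Proof.
rewrite /in_cells (Xind [set: 'I_n]%SET (A := fun i => cell h (f i))); last first.
  by move=> i; exact: measurable_cell.
rewrite (eq_bigr (fun=> (#|{: G}|%:R^-1 : R)%:E)).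
  by rewrite prodEFin prodr_const cardsT card_ord exprVn.
move=> i _; rewrite -[LHS]/(distribution P (X i) (cell h (f i))) Xunif; last exact: measurable_cell.
rewrite setIidl; last by apply: cell_subset.
rewrite [X in (X * _)%E]lebesgue_cell// -EFinM; congr EFin.
have L2 : L ^+ 2 = n%:R by rewrite sqr_sqrtr.
rewrite card_prod card_ord natrM /h expr_div_n L2 -expr2.
by rewrite mulrAC divff ?mul1r// pnatr_eq0 -lt0n.
Qed.

Definition ambiguous : {set G} :=
  [set z : G | (rho - 3) ^+ 2 <= (n2 z)%:R <= (rho + 3) ^+ 2]%SET.

Lemma grid_graph_event (f : {ffun 'I_n -> G}) w : 3 <= rho ->
  (forall i j, i != j -> f i - f j \notin ambiguous) -> in_cells f w ->
  torus_graph r (fun i => X i w) = grid_graph rho f.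
Proof.
move=> rho3 nf fw; apply/funext => i; apply/funext => j.
rewrite /torus_graph /grid_graph; have [//|ij] := eqVneq i j.
have fi : cell h (f i) (X i w) by apply: fw; rewrite /= inE.
have fj : cell h (f j) (X j w) by apply: fw; rewrite /= inE.
have := nf _ _ ij; rewrite inE negb_and -!ltNge -/L LE => /orP[] nn.
  rewrite (le_trans (cell_torus_dist_le h0 rho3 fi fj nn)) ?hrho//=.
  by apply/esym/ltW/(lt_le_trans nn); rewrite lerXn2r ?nnegrE; lra.
have := cell_torus_dist_gt h0 rho3 fi fj nn; rewrite hrho ltNge => /negPf ->.
apply/esym/negbTE; rewrite -ltNge; apply: le_lt_trans nn.
by rewrite lerXn2r ?nnegrE; lra.
Qed.

(** The half-open cells miss two edges of the square, which is harmless since the event is only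
    bounded from below, by the samples whose cells form a good [f]. The error term is a union bound
    over pairs of [card_annulus] with half-width 3, which requires [rho >= 12]. *)
Lemma discretize (delta : R) : 12 <= rho ->
  Pr R (fun f : {ffun 'I_n -> G} => ~~ `[< E (grid_graph rho f) >]) <= delta ->
  ((1 - (delta + n%:R ^+ 2 * (300 * rho / #|{: G}|%:R)))%:E <= P event)%E.
Proof.
move=> rho12 Ed.
pose amb (f : {ffun 'I_n -> G}) := [exists ij : 'I_n * 'I_n, (ij.1 != ij.2) && (f ij.1 - f ij.2 \in ambiguous)].
pose good (f : {ffun 'I_n -> G}) := `[< E (grid_graph rho f) >] && ~~ amb f.
have G0 : (0 < #|{: G}|)%N by rewrite card_prod card_ord.
have Pamb : Pr R amb <= n%:R ^+ 2 * (300 * rho / #|{: G}|%:R).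
  apply: le_trans (Pr_exists _ _) _.
  have -> : n%:R ^+ 2 * (300 * rho / #|{: G}|%:R) =
      \sum_(ij : 'I_n * 'I_n) (300 * rho / #|{: G}|%:R).
    by rewrite sumr_const -[RHS]mulr_natl; congr (_ * _); rewrite card_prod !card_ord natrM.
  apply: ler_sum => -[i j] _ /=; have [_|ij] := eqVneq i j.
    have c0 : 0 <= 300 * rho / #|{: G}|%:R.
      apply: divr_ge0; last exact: ler0n.
      by apply: mulr_ge0; [exact: ler0n|apply: le_trans rho12].
    by apply: avg_le_cst.
  rewrite /= (Pr_diff R ambiguous ij) ler_wpM2r ?invr_ge0//.
  have h3 : 3 <= rho / 4 by lra.
  have := @card_annulus R M rho 3 (ler1n R 3) h3; rewrite -/ambiguous; lra.
have Pgood : 1 - (delta + n%:R ^+ 2 * (300 * rho / #|{: G}|%:R)) <= Pr R good.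
  have : Pr R (fun f => ~~ good f) <= delta + n%:R ^+ 2 * (300 * rho / #|{: G}|%:R).
    apply: le_trans (_ : _ <= Pr R (fun f => ~~ `[< E (grid_graph rho f) >] || amb f)) _.
      by apply: sub_Pr => f; rewrite /good negb_and negbK.
    by apply: le_trans (Pr_or _ _ _) _; apply: lerD.
  rewrite Pr_not; last by rewrite card_ffun expn_gt0 G0.
  lra.
have PU : P (\bigcup_(f in [set` good]) in_cells f) = (Pr R good)%:E.
  rewrite measure_fin_bigcup.
  - rewrite -(bigfs _ (r := index_enum {ffun 'I_n -> G})) ?index_enum_uniq//; last first.
      by move=> f _; rewrite mem_index_enum.
    rewrite (eq_bigr (fun=> (#|{: G}|%:R ^- n : R)%:E)) => [|f _]; last exact: P_cells.
    rewrite sumEFin; congr EFin; rewrite PrE.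
    rewrite (sumr_const good) -[LHS]mulr_natl; congr (_ * _^-1).
    by rewrite card_ffun natrX card_ord.
  - exact: finite_finset.
  - move=> f g _ _ [w [fw gw]]; apply/ffunP => i.
    by apply: (cell_disjoint h0 (fw i _) (gw i _)); rewrite /= inE.
  - move=> f _; apply: fin_bigcap_measurable => [|i _]; first exact: finite_finset.
    by apply: measurable_sfunP; exact: measurable_cell.
apply: (@le_trans _ _ (Pr R good)%:E); first by rewrite lee_fin.
rewrite -PU; apply: le_measure; rewrite ?inE//.
  apply: fin_bigcup_measurable => [|f _]; first exact: finite_finset.
  apply: fin_bigcap_measurable => [|i _]; first exact: finite_finset.
  by apply: measurable_sfunP; exact: measurable_cell.
  exact: measurable_event.
move=> w [f /andP[/asboolP Ef /existsPn namb] fw] /=; rewrite /event /=.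
rewrite (grid_graph_event _ _ fw)//; first lra.
by move=> i j ij; have := namb (i, j); rewrite /= ij.
Qed.

End Discretization.

(** [rho] grows like [M.+1] and the grid like its square, so for fixed [n] the rounding error is of
    order [1 / M.+1]. Half of [e] pays for it, the other half for the grid estimate. *)
Lemma aas_torus_grid (R : realType) (r : nat -> R) (E : forall n, rel 'I_n -> Prop) :
  (\forall n \near \oo, 0 < r n) ->
  (forall e : R, 0 < e -> \forall n \near \oo, forall M0 : nat,
     exists2 M, (M0 <= M)%N &
       Pr R (fun f : {ffun 'I_n -> 'I_M.+1 * 'I_M.+1} =>
         ~~ `[< E n (grid_graph (r n * M.+1%:R / torus_side R n) f) >]) <= e) ->
  aas_torus r E.
Proof.
move=> r0 hE d T P X Xind Xunif; apply/fine_cvgP; split.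
  by apply: nearW => n; rewrite fin_num_measure//;
    exact: measurable_event.
apply/cvgrPdist_le => e e0; have e20 : 0 < e / 2 by rewrite divr_gt0.
near=> n => /=.
have n0 : (0 < n)%N by near: n; exact: nbhs_infty_gt.
have rn0 : 0 < r n by near: n.
have hEn : forall M0 : nat, exists2 M, (M0 <= M)%N &
    Pr R (fun f : {ffun 'I_n -> 'I_M.+1 * 'I_M.+1} =>
         ~~ `[< E n (grid_graph (r n * M.+1%:R / torus_side R n) f) >]) <= e / 2.
  by near: n; exact: (hE _ e20).
set L := torus_side R n in hEn *.
have L0 : 0 < L by rewrite /L /torus_side sqrtr_gt0 ltr0n.
(* The first summand forces [rho >= 12], the second makes the rounding error at most [e / 2]. *)
pose c := 12 * L / r n + 600 * n%:R ^+ 2 * r n / (L * e).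
have c1 : 0 <= 12 * L / r n by rewrite divr_ge0 ?mulr_ge0// ltW.
have c2 : 0 <= 600 * n%:R ^+ 2 * r n / (L * e).
  apply: divr_ge0; last by rewrite mulr_ge0 ?(ltW L0) ?(ltW e0).
  apply: mulr_ge0; last exact: ltW.
  by apply: mulr_ge0; [exact: ler0n|exact: sqr_ge0].
have [M M0 hM] := hEn (Num.truncn c).
have cM : c <= M.+1%:R.
  have /andP[_ /ltW h] := truncn_itv (addr_ge0 c1 c2).
  by apply: le_trans h _; rewrite ler_nat ltnS.
have N0 : 0 < M.+1%:R :> R by rewrite ltr0n.
have rho12 : 12 <= r n * M.+1%:R / L.
  rewrite ler_pdivlMr// mulrC -ler_pdivrMl// mulrC; apply: le_trans cM.
  by rewrite /c [X in X <= _]mulrC lerDl.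
have := discretize n0 (Xind n) (Xunif n) rho12 hM.
have -> : #|{: 'I_M.+1 * 'I_M.+1}|%:R = M.+1%:R ^+ 2 :> R.
  by rewrite card_prod card_ord natrM.
set p := P n _; have pfin : p \is a fin_num.
  by rewrite fin_num_measure//; exact: measurable_event.
have p1 : (p <= 1)%E.
  by apply: probability_le1; exact: measurable_event.
move: p1; rewrite -(fineK pfin) !lee_fin => p1 hp.
rewrite /= -/p ger0_norm ?subr_ge0//; rewrite -/L in hp.
move: hp; set t := n%:R ^+ 2 * _ => hp.
suff : t <= e / 2 by move: hp; move: (fine p) t => q t; lra.
rewrite /t.
have -> : n%:R ^+ 2 * (300 * (r n * M.+1%:R / L) / M.+1%:R ^+ 2) =
    (600 * n%:R ^+ 2 * r n / (L * e)) * (e / 2) / M.+1%:R.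
  by field; rewrite ?gt_eqF//= ?lt0r_neq0.
rewrite ler_pdivrMr// mulrC ler_pM2l//; apply: le_trans cM.
by rewrite /c lerDr.
Unshelve. all: by end_near.
Qed.

End Discretize.

(** * Upper bound *)

Section UpperBound.
Variables (R : realType) (n M : nat) (rho eta : R).
Local Notation G := ('I_M.+1 * 'I_M.+1)%type.

Lemma grid_graph_sym (f : {ffun 'I_n -> G}) : symmetric (grid_graph rho f).
Proof.
move=> i j; rewrite /grid_graph eq_sym; congr (_ && (_%:R <= _)).
have -> : f i - f j = - (f j - f i) by rewrite opprB.
by rewrite /n2 !nrmN.
Qed.

(** The sup norm makes a difference outside this set have a coordinate of norm at least [eta], as
    [card_separating] requires. *)
Definition close : {set G} :=
  [set z : G | ((nrm z.1)%:R < eta) && ((nrm z.2)%:R < eta)].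

Lemma closeN (z : G) : (- z \in close) = (z \in close).
Proof. by rewrite !inE /= !nrmN. Qed.

Lemma card_close : 2 <= eta -> #|close|%:R <= 9 * eta ^+ 2.
Proof.
move=> eta2; pose S : {set 'I_M.+1} := [set a | (nrm a)%:R < eta].
have -> : close = finset.setX S S by apply/setP => z; rewrite !inE.
have Sc : #|S|%:R <= 2 * eta + 2.
  apply: card_nrm_diam => [|a b]; first lra.
  by rewrite !inE => ha hb; have := ler0n R (nrm b); lra.
rewrite cardsX natrM; have := ler0n R #|S|; nra.
Qed.

Definition close_pairs (f : {ffun 'I_n -> G}) : {set 'I_n * 'I_n} :=
  [set ij in ordered_pairs n | f ij.1 - f ij.2 \in close].

Lemma Pr_close_pair (i j : 'I_n) : i != j ->
  Pr R (fun f : {ffun 'I_n -> G} => f i - f j \in close) = #|close|%:R / #|{: G}|%:R.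
Proof. exact: Pr_diff. Qed.

Let G0 : (0 < #|{: G}|)%N.
Proof. by rewrite card_prod card_ord. Qed.

Lemma Pr_close_resample (a b k l : 'I_n) : a != b -> k != l -> a != k -> a != l ->
  Pr R (fun f : {ffun 'I_n -> G} => (f k - f l \in close) && (f a - f b \in close)) =
  (#|close|%:R / #|{: G}|%:R) ^+ 2.
Proof.
move=> ab kl ak al.
rewrite (Pr_resample_coord (F := fun f : {ffun 'I_n -> G} => f k - f l \in close)
  (A := fun x y : G => (x - y : G) \in close) (p := #|close|%:R / #|{: G}|%:R) ab) //.
- by rewrite (Pr_close_pair kl) expr2.
- by move=> f g fg; rewrite !fg// eq_sym.
- by move=> y; rewrite PrE card_translate.
Qed.

(** Distinct pairs share at most one index, so [ij] has an index outside [kl]. Redrawing that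
    coordinate shows the two closeness events independent; closeness is symmetric, so either index
    of [ij] may play this part. *)
Lemma Pr_close_pairs2 (ij kl : 'I_n * 'I_n) :
  ij \in ordered_pairs n -> kl \in ordered_pairs n -> ij != kl ->
  Pr R (fun f : {ffun 'I_n -> G} => (f ij.1 - f ij.2 \in close) && (f kl.1 - f kl.2 \in close)) <=
  (#|close|%:R / #|{: G}|%:R) ^+ 2.
Proof.
case: ij kl => [i j] [k l]; rewrite !inE /= => ij kl nijkl.
have ij' : i != j by rewrite neq_ltn ij.
have kl' : k != l by rewrite neq_ltn kl.
rewrite le_eqVlt; apply/orP; left; apply/eqP.
have swap (u v : 'I_n) (f : {ffun 'I_n -> G}) : (f u - f v \in close) = (f v - f u \in close).
  by rewrite -closeN opprB.
have [ik|ik] := eqVneq i k.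
  have jk : j != k by rewrite -ik eq_sym.
  have jl : j != l by apply: contraNneq nijkl => ->; rewrite ik.
  rewrite -(Pr_close_resample (a := j) (b := i) _ kl' jk jl) 1?eq_sym//.
  by apply: eq_Pr => f; rewrite andbC (swap i j).
have [il|il] := eqVneq i l.
  have jk : j != k by rewrite neq_ltn (ltn_trans kl) ?orbT// -il.
  have jl : j != l by rewrite -il eq_sym.
  rewrite -(Pr_close_resample (a := j) (b := i) _ kl' jk jl) 1?eq_sym//.
  by apply: eq_Pr => f; rewrite andbC (swap i j).
rewrite -(Pr_close_resample ij' kl' ik il).
by apply: eq_Pr => f; rewrite andbC.
Qed.

Lemma Pr_many_close_pairs (mu : R) : (0 < n)%N -> 2 <= eta ->
  mu = 9 * n%:R ^+ 2 * eta ^+ 2 / #|{: G}|%:R ->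
  Pr R (fun f => 2 * mu <= #|close_pairs f|%:R) <= mu^-1.
Proof.
move=> n0 eta2 muE; have G0' : 0 < #|{: G}|%:R :> R by rewrite ltr0n.
apply: (uncorrelated_count_upper (p := #|close|%:R / #|{: G}|%:R)
   (Z := fun ij (f : {ffun 'I_n -> G}) => f ij.1 - f ij.2 \in close)).
- rewrite muE divr_gt0// !mulr_gt0// ?exprn_gt0 ?ltr0n//; lra.
- rewrite muE mulrA ler_pM2r ?invr_gt0//.
  apply: (@le_trans _ _ (n%:R ^+ 2 * (9 * eta ^+ 2))); last by rewrite mulrA [_ * 9]mulrC.
  apply: ler_pM; rewrite ?card_close// -natrX ler_nat -[X in (_ <= X ^ _)%N]card_ord.
  by rewrite expnS expn1 -card_prod; exact: max_card.
- by rewrite divr_ge0.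
- by move=> ij; rewrite inE => ij'; apply: Pr_close_pair; rewrite neq_ltn ij'.
- by move=> ij kl ijn kln; apply: Pr_close_pairs2.
Qed.

Variable m : nat.

Definition separated (f : {ffun 'I_n -> G}) (i j : 'I_n) : bool :=
  [exists w : 'I_n, [&& (w < m)%N, w \notin [set i; j],
     (n2 (f w - f i))%:R <= rho ^+ 2 & rho ^+ 2 < (n2 (f w - f j))%:R]].

(** An unresolved pair lies outside the set, since distance 0 identifies a landmark. It is therefore
    not close, and a separating landmark has distance 1 to exactly one of its vertices. *)
Lemma metric_dim_upper (f : {ffun 'I_n -> G}) : 
  (forall i j, i != j -> f i - f j \notin close -> separated f i j) ->
  (metric_dim (grid_graph rho f) <= m + #|close_pairs f|)%N.
Proof.
move=> sep; set W1 := [set w : 'I_n | (w < m)%N].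
set W2 := (fun ij : 'I_n * 'I_n => ij.1) @: close_pairs f.
have W1m : (#|W1| <= m)%N.
  have -> : W1 = [set i : 'I_n | (0 <= i <= m.-1)%N && (0 < m)%N].
    by apply/setP => i; rewrite !inE; lia.
  case: m => [|m']; first by rewrite (_ : [set _ | _] = finset.set0) ?cards0//; apply/setP => i; rewrite !inE andbF.
  apply: leq_trans (_ : (_ <= _)%N) (card_ord_interval n 0 m').
  by apply/subset_leq_card/fintype.subsetP => i; rewrite !inE andbT.
apply: leq_trans (leq_trans (metric_dim_le _) (_ : (#|W1 :|: W2| <= _)%N)) _.
- apply/resolvingP => u v uv; apply/eqP; apply/negPn/negP => nuv.
  have notin x y : x != y -> (forall w, w \in W1 :|: W2 ->
      graph_dist (grid_graph rho f) w x = graph_dist (grid_graph rho f) w y) -> x \notin W1 :|: W2.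
    move=> xy h; apply/negP => /h; rewrite graph_distxx => /esym/graph_dist_eq0 yx.
    by rewrite yx eqxx in xy.
  have uW := notin _ _ nuv uv.
  have vW : v \notin W1 :|: W2.
    by apply: (notin v u); [rewrite eq_sym|move=> w /uv].
  case: (boolP (f u - f v \in close)) => cl.
    have [lt|lt] : (u < v)%N \/ (v < u)%N.
      by apply/orP; rewrite -neq_ltn.
    - move/negP: uW; apply; rewrite inE; apply/orP; right; apply/imsetP.
      by exists (u, v) => //; rewrite inE cl andbT inE.
    - move/negP: vW; apply; rewrite inE; apply/orP; right; apply/imsetP.
      by exists (v, u) => //; rewrite inE -closeN opprB cl andbT inE.
  have /existsP[w /and4P[wm wuv wu wv]] := sep _ _ nuv cl.
  have := uv w; rewrite finset.in_setU inE wm => /(_ isT) /eqP.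
  move: wuv; rewrite !inE negb_or => /andP[wu' wv'].
  have := graph_dist_adj (grid_graph rho f) wu'; rewrite {2}/grid_graph wu' wu /=.
  move=> /eqP ->; rewrite eq_sym graph_dist_adj// /grid_graph wv' /=.
  by rewrite leNgt wv.
- exact: leqnn.
- have := cardsUI W1 W2; have := leq_imset_card (fun ij : 'I_n * 'I_n => ij.1) (close_pairs f).
  rewrite -/W2 => h1 h2; apply: leq_trans (leq_addr #|W1 :&: W2| _) _.
  by rewrite h2 leq_add.
Qed.

(** With [i] and [j] fixed and the other points redrawn, each remaining landmark falls in the
    separating region independently. The exponent is [m - 2] because [i] and [j] may be among the
    first [m] vertices. *)
Lemma Pr_not_separated (i j : 'I_n) : i != j -> (m <= n)%N ->
  4 * rho <= M.+1%:R -> 4 <= rho -> 2 <= eta -> eta <= rho / 2 ->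
  Pr R (fun f : {ffun 'I_n -> G} => (f i - f j \notin close) && ~~ separated f i j) <=
    (1 - rho * eta / 8 / #|{: G}|%:R) ^+ (m - 2).
Proof.
move=> ij mn rM r4 e2 er; set s := rho * eta / 8 / _.
rewrite {1}/Pr -(avg_resample (Y := G) (g := fun l a y => if l \in [set i; j] then a else y)) //; last first.
  by move=> l x; case: (l \in _); [exact: card_pred_fst|exact: card_pred_snd].
pose S (x y : G) : {set G} := [set z : G | ((n2 (z - x))%:R <= rho ^+ 2) && (rho ^+ 2 < (n2 (z - y))%:R)].
have Sc x y : x - y \notin close -> rho * eta / 8 <= #|S x y|%:R.
  move=> xy; have -> : #|S x y| = #|[set z : G | ((n2 z)%:R <= rho ^+ 2) &&
                       (rho ^+ 2 < (n2 (z - (y - x)))%:R)]|.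
    rewrite -[RHS](card_translate _ x); apply: eq_card => z; rewrite !inE.
    by rewrite opprB addrA subrK.
  apply: card_separating => //; move: xy.
  by rewrite -closeN opprB inE negb_and -!leNgt.
have s1 : s <= 1.
  rewrite ler_pdivrMr ?ltr0n// mul1r card_prod card_ord natrM; nra.
have s0 : 0 <= (1 - s) ^+ (m - 2) by rewrite exprn_ge0// subr_ge0.
have ii : i \in [set i; j] by rewrite !inE eqxx.
have jj : j \in [set i; j] by rewrite !inE eqxx orbT.
apply: avg_le_cst => // f.
case: (boolP (f i - f j \in close)) => fij.
  by apply: avg_le_cst => // h; rewrite !ffunE ii jj fij.
pose D := [set w : 'I_n | (w < m)%N && (w \notin [set i; j])].
have Dm : (m - 2 <= #|D|)%N.
  have : (m <= #|[set w : 'I_n | (w < m)%N]|)%N.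
    have winj : injective (widen_ord mn) by move=> a b /(congr1 val) /= ab; exact: val_inj.
    rewrite -[X in (X <= _)%N]card_ord -(card_imset _ winj).
    by apply/subset_leq_card/fintype.subsetP => _ /imsetP[w _ ->]; rewrite inE /=.
  rewrite -(cardsID [set i; j]) => /leq_trans h.
  rewrite leq_subLR; apply: h; apply: leq_add.
    by apply: leq_trans (subset_leq_card (subsetIr _ _)) _; rewrite cards2; case: (i != j).
  by apply/subset_leq_card/fintype.subsetP => w; rewrite !inE andbC.
apply: (@le_trans _ _ (Pr R (fun h : {ffun 'I_n -> G} =>
    [forall w, if w \in D then h w \notin S (f i) (f j) else true]))).
  apply: le_avg => h; set b := (X in (nat_of_bool X)%:R <= _).
  suff : b -> [forall w, if w \in D then h w \notin S (f i) (f j) else true].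
    by case: b => [/(_ isT) ->|_]; rewrite ?ler0n.
  rewrite /b => /andP[_ /existsPn nsep]; apply/forallP => w; case: ifP => //.
  rewrite inE => /andP[wm wij]; have := nsep w; rewrite wm wij /= !ffunE (negPf wij).
  by rewrite ii jj inE.
rewrite (Pr_prod R (fun w x => if w \in D then x \notin S (f i) (f j) else true)).
rewrite (eq_bigr (fun w => if w \in D then 1 - #|S (f i) (f j)|%:R / #|{: G}|%:R else 1)); last first.
  move=> w _; case: ifP => _; first exact: Pr_notin.
  by rewrite /Pr avg_cst.
rewrite prod_if_set expr1n mulr1.
have S1 : 0 <= 1 - #|S (f i) (f j)|%:R / #|{: G}|%:R :> R.
  by rewrite -Pr_notin// Pr_ge0.
apply: (@le_trans _ _ ((1 - s) ^+ #|D|)).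
  have s1' : 0 <= 1 - s by rewrite subr_ge0.
  by rewrite lerXn2r ?nnegrE// lerB// ler_wpM2r ?invr_ge0//; exact: Sc.
rewrite ler_wiXn2l ?subr_ge0// lerBlDl lerDr /s !mulr_ge0// ?invr_ge0//; lra.
Qed.

Lemma Pr_metric_dim_upper (mu : R) : (0 < n)%N -> (m <= n)%N ->
  4 * rho <= M.+1%:R -> 4 <= rho -> 2 <= eta -> eta <= rho / 2 ->
  mu = 9 * n%:R ^+ 2 * eta ^+ 2 / #|{: G}|%:R ->
  Pr R (fun f : {ffun 'I_n -> G} => m%:R + 2 * mu < (metric_dim (grid_graph rho f))%:R) <=
    n%:R ^+ 2 * (1 - rho * eta / 8 / #|{: G}|%:R) ^+ (m - 2) + mu^-1.
Proof.
move=> n0 mn rM r4 e2 er muE.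
set s := (_ ^+ (m - 2)).
have s0 : 0 <= s.
  rewrite exprn_ge0// subr_ge0 ler_pdivrMr ?ltr0n// mul1r card_prod card_ord natrM; nra.
pose bad (ij : 'I_n * 'I_n) (f : {ffun 'I_n -> G}) :=
  (ij.1 != ij.2) && ((f ij.1 - f ij.2 \notin close) && ~~ separated f ij.1 ij.2).
apply: (@le_trans _ _ (Pr R (fun f : {ffun 'I_n -> G} => [exists ij, bad ij f] ||
   (2 * mu <= #|close_pairs f|%:R)))).
  apply: sub_Pr => f dim; rewrite orbC; case: leP => //= cl.
  case: (boolP [exists ij, bad ij f]) => // /existsPn nbad; exfalso; move: dim; apply/negP; rewrite -leNgt.
  apply: le_trans (_ : (m + #|close_pairs f|)%:R <= _).
    rewrite ler_nat; apply: metric_dim_upper => i j ij nc.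
    by have := nbad (i, j); rewrite /bad /= ij nc /= negbK.
  by rewrite natrD lerD2l ltW.
apply: le_trans (Pr_or _ _ _) _; apply: lerD; last exact: Pr_many_close_pairs.
apply: le_trans (Pr_exists _ _) _.
have -> : n%:R ^+ 2 * s = \sum_(ij : 'I_n * 'I_n) s.
  by rewrite sumr_const -[RHS]mulr_natl card_prod !card_ord natrM.
apply: ler_sum => -[i j] _; rewrite /bad /=; have [_|ij] := eqVneq i j.
  by apply: avg_le_cst.
exact: Pr_not_separated.
Qed.

End UpperBound.

(** * Cube roots and exponentials of logarithms *)

Section Powers.
Variable R : realType.
Implicit Types a b x y : R.

Lemma powR_div a b x : 0 <= a -> 0 < b -> (a / b) `^ x = a `^ x / b `^ x.
Proof.
move=> a0 b0; have -> : a `^ x = (a / b) `^ x * b `^ x.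
  by rewrite -powRM ?divr_ge0 ?(ltW b0)// divfK ?gt_eqF.
by rewrite mulfK// gt_eqF// powR_gt0.
Qed.

Lemma powR_third_sqr a : 0 <= a -> (a `^ (1 / 3)) ^+ 2 = a `^ (2 / 3).
Proof. by move=> a0; rewrite -powR_mulrn ?powR_ge0// -powRrM; congr (_ `^ _); field. Qed.

Lemma powR_third_cube a : 0 <= a -> (a `^ (1 / 3)) ^+ 3 = a.
Proof.
move=> a0; rewrite -powR_mulrn ?powR_ge0// -powRrM.
by have -> : 1 / 3 * 3%:R = 1 :> R; [field|rewrite powRr1].
Qed.

Lemma expR_opp_ln (n k : nat) : (0 < n)%N -> expR (- (k%:R * ln n%:R)) = n%:R ^- k :> R.
Proof. by move=> n0; rewrite expRN expRM_natl lnK// posrE ltr0n. Qed.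

End Powers.

Lemma upper_bound_grid (R : realType) (n : nat) (r e : R) (M0 : nat) :
  (0 < n)%N -> 2 <= ln n%:R :> R -> ln n%:R <= r <= Num.sqrt n%:R / 4 ->
  0 < e -> 2 / e <= Num.sqrt n%:R -> exists2 M, (M0 <= M)%N &
  Pr R (fun f : {ffun 'I_n -> 'I_M.+1 * 'I_M.+1} =>
    45 * (n%:R * ln n%:R `^ (2 / 3) / r `^ (2 / 3)) <
      (metric_dim (grid_graph (r * M.+1%:R / torus_side R n) f))%:R) <= e.
Proof.
move=> n0 l2 /andP[lr rL] e0 eL.
set L := torus_side R n; rewrite -/(torus_side R n) -/L in rL eL.
have n0' : 0 < n%:R :> R by rewrite ltr0n.
have L0 : 0 < L by rewrite /L sqrtr_gt0.
have L2 : L ^+ 2 = n%:R by rewrite sqr_sqrtr// ltW.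
have r0 : 0 < r by lra.
set l := ln n%:R in l2 lr *.
(* The separation scale in units of the original torus; [eta] below is the same length in grid
   units. *)
pose ep := (l / r) `^ (1 / 3).
have lr0 : 0 < l / r by rewrite divr_gt0//; lra.
have ep0 : 0 < ep by rewrite powR_gt0.
have ep3 : ep ^+ 3 = l / r by rewrite powR_third_cube// ltW.
have ep2 : n%:R * l `^ (2 / 3) / r `^ (2 / 3) = n%:R * ep ^+ 2.
  by rewrite powR_third_sqr ?(ltW lr0)// powR_div// ?mulrA//; lra.
have ep1 : ep <= 1.
  have : ep ^+ 3 <= 1 by rewrite ep3 ler_pdivrMr// mul1r.
  by apply: contraTT; rewrite -!ltNge => h; exact: exprn_egt1.
(* The bound tends to infinity, which absorbs additive constants and makes the inverse of [mu]
   small. *)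
have nep : L <= n%:R * ep ^+ 2.
  have h1 : ep ^+ 3 <= ep ^+ 2 by rewrite exprS ler_piMl ?sqr_ge0.
  have h2 : L^-1 <= ep ^+ 3.
    rewrite ep3 ler_pdivlMr// mulrC ler_pdivrMr//; nra.
  have h3 : L = n%:R * L^-1 by rewrite -L2 expr2 mulfK// gt_eqF.
  rewrite {1}h3 ler_wpM2l//; exact: le_trans h1.
pose M := maxn M0 (Num.truncn (4 * L / r + 2 * L / ep)).
have c1 : 0 <= 4 * L / r by rewrite divr_ge0 ?mulr_ge0// ltW.
have c2 : 0 <= 2 * L / ep by rewrite divr_ge0 ?mulr_ge0// ltW.
have NM : 4 * L / r + 2 * L / ep <= M.+1%:R.
  have /andP[_ /ltW h] := truncn_itv (addr_ge0 c1 c2).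
  by apply: le_trans h _; rewrite ler_nat ltnS leq_maxr.
have N0 : 0 < M.+1%:R :> R by rewrite ltr0n.
exists M; first exact: leq_maxl.
set rho := r * M.+1%:R / L; pose eta := ep * M.+1%:R / L.
rewrite ep2.
(* A landmark separates a given pair with probability at least [r * ep / (8 * n)], so
   [24 * n * ep ^ 2] landmarks have expected number [3 * r * ep ^ 3 = 3 * ln n], which beats the
   [n ^ 2] pairs. The total is [24 + 2 * 9] times [n * ep ^ 2], and 45 absorbs the additive 3. *)
pose m := (Num.truncn (24 * (n%:R * ep ^+ 2))).+3.
have nep0 : 0 <= 24 * (n%:R * ep ^+ 2) by lra.
have m1 : m%:R <= 24 * (n%:R * ep ^+ 2) + 3.
  have /andP[h _] := truncn_itv nep0.
  by rewrite /m -addn3 natrD lerD2r.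
have m2 : 24 * (n%:R * ep ^+ 2) <= (m - 2)%:R.
  have /andP[_ /ltW h] := truncn_itv nep0.
  by rewrite /m !subSS subn0.
move: m m1 m2 => m m1 m2.
(* If [m] exceeds [n], the set of all vertices already gives the bound. *)
have [mn|nm] := leqP m n; last first.
  rewrite (@eq_Pr _ _ _ xpred0) => [|f]; first by rewrite /Pr /avg big1// mul0r ltW.
  apply/negbTE; rewrite -leNgt.
  have : (metric_dim (grid_graph rho f) <= m)%N.
    apply: leq_trans (metric_dim_le (resolving_setT _)) _.
    by rewrite cardsT card_ord ltnW.
  rewrite -(ler_nat R) => h; apply: le_trans h _; lra.
have rho4 : 4 <= rho.
  have : 4 * L / r <= M.+1%:R by lra.
  by rewrite ler_pdivrMr// /rho ler_pdivlMr// [r * _]mulrC.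
have eta2 : 2 <= eta.
  have : 2 * L / ep <= M.+1%:R by lra.
  by rewrite ler_pdivrMr// /eta ler_pdivlMr// [ep * _]mulrC.
have rhoM : 4 * rho <= M.+1%:R.
  by rewrite /rho mulrA ler_pdivrMr//; nra.
have etar : eta <= rho / 2.
  have -> : rho / 2 = (r / 2) * M.+1%:R / L by rewrite /rho; field; rewrite gt_eqF.
  by rewrite /eta ler_pM2r ?invr_gt0// ler_pM2r//; lra.
have GE : #|{: 'I_M.+1 * 'I_M.+1}|%:R = M.+1%:R ^+ 2 :> R.
  by rewrite card_prod card_ord natrM.
have muE : 9 * (n%:R * ep ^+ 2) = 9 * n%:R ^+ 2 * eta ^+ 2 / #|{: 'I_M.+1 * 'I_M.+1}|%:R.
  rewrite GE /eta -L2; field; rewrite !gt_eqF//=.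
apply: (@le_trans _ _ (Pr R (fun f : {ffun 'I_n -> 'I_M.+1 * 'I_M.+1} =>
   m%:R + 2 * (9 * (n%:R * ep ^+ 2)) < (metric_dim (grid_graph rho f))%:R))).
  apply: sub_Pr => f; apply: le_lt_trans.
  have L3 : 3 <= L by lra.
  lra.
apply: le_trans (Pr_metric_dim_upper n0 mn rhoM rho4 eta2 etar muE) _.
have sE : rho * eta / 8 / #|{: 'I_M.+1 * 'I_M.+1}|%:R = r * ep / (8 * n%:R).
  by rewrite GE /rho /eta -L2; field; rewrite !gt_eqF.
rewrite sE; set s := r * ep / _.
have s0 : 0 <= s by rewrite divr_ge0 ?mulr_ge0// ltW.
have s1 : s <= 1.
  rewrite ler_pdivrMr ?mulr_gt0// mul1r -L2; nra.
have h1 : n%:R ^+ 2 * (1 - s) ^+ (m - 2) <= n%:R^-1.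
  apply: (@le_trans _ _ (n%:R ^+ 2 * expR (- (3 * l)))); last first.
    by rewrite expR_opp_ln// le_eqVlt; apply/orP; left; apply/eqP; field; rewrite gt_eqF.
  rewrite ler_wpM2l ?sqr_ge0//.
  apply: (@le_trans _ _ (expR (- s) ^+ (m - 2))).
    by rewrite lerXn2r ?nnegrE ?subr_ge0 ?expR_ge0//; exact: expR_ge1Dx.
  rewrite -expRM_natl ler_expR mulrN lerN2.
  have -> : 3 * l = 24 * (n%:R * ep ^+ 2) * s.
    have -> : 24 * (n%:R * ep ^+ 2) * s = 3 * r * ep ^+ 3 by rewrite /s; field; rewrite gt_eqF.
    by rewrite ep3; field; rewrite gt_eqF.
  by rewrite ler_wpM2r.
have h2 : n%:R^-1 <= L^-1.
  rewrite lef_pV2 ?posrE// -L2; have : 1 <= L by lra.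
  by move=> L1; rewrite expr2 ler_peMr// ltW.
have h3 : (9 * (n%:R * ep ^+ 2))^-1 <= L^-1.
  by rewrite lef_pV2 ?posrE//; lra.
have h4 : 2 * L^-1 <= e by rewrite ler_pdivrMr// mulrC -ler_pdivrMr.
lra.
Qed.

(** * Lower bound from isolated twins *)

Section CoarseCells.
Variables (M k m : nat).
Hypothesis Mkm : M.+1 = (k * m)%N.
Local Notation G := ('I_M.+1 * 'I_M.+1)%type.

Definition coarse (a b : nat) : {set G} :=
  [set z : G | (z.1 %/ m == a)%N && (z.2 %/ m == b)%N].

Let m0 : (0 < m)%N.
Proof.
have : (0 < k * m)%N by rewrite -Mkm.
by rewrite muln_gt0 => /andP[].
Qed.

Lemma card_coarse1 a : (a < k)%N -> #|[set x : 'I_M.+1 | (x %/ m == a)%N]| = m.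
Proof.
move=> ak; have lt (t : 'I_m) : (a * m + t < M.+1)%N.
  by rewrite Mkm; have := leq_mul ak (leqnn m); have := ltn_ord t; rewrite mulSn; lia.
rewrite -[RHS]card_ord -(card_imset _ (f := fun t => Ordinal (lt t))); last first.
  by move=> t u /(congr1 val) /= /addnI/val_inj.
apply: eq_card => x; rewrite inE; apply/eqP/imsetP => [xa|[t _ ->]] /=.
  have tm : (x %% m < m)%N by rewrite ltn_mod.
  by exists (Ordinal tm) => //; apply: val_inj; rewrite /= -xa -divn_eq.
by rewrite divnMDl// divn_small ?addn0.
Qed.

Lemma card_coarse a b : (a < k)%N -> (b < k)%N -> #|coarse a b| = (m ^ 2)%N.
Proof.
move=> ak bk; rewrite -[LHS]/(#|coarse a b|) (_ : coarse a b =
    finset.setX [set x : 'I_M.+1 | (x %/ m == a)%N] [set x : 'I_M.+1 | (x %/ m == b)%N]).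
  by rewrite cardsX !card_coarse1// expnS expn1.
by apply/setP => z; rewrite !inE.
Qed.

Lemma coarse_nrm a b (y z : G) : y \in coarse a b -> z \in coarse a b ->
  (nrm (y.1 - z.1)%R <= m)%N /\ (nrm (y.2 - z.2)%R <= m)%N.
Proof.
rewrite !inE => /andP[/eqP y1 /eqP y2] /andP[/eqP z1 /eqP z2].
have aux (u v : 'I_M.+1) c : (u %/ m = c)%N -> (v %/ m = c)%N -> (nrm (u - v)%R <= m)%N.
  move=> uc vc; wlog uv : u v uc vc / (v <= u)%N.
    move=> H; have [/H//|/ltnW/H] := leqP v u; first exact.
    by rewrite -nrmN opprB; apply.
  rewrite nrm_sub//; apply: leq_trans (geq_minl _ _) _.
  have := divn_eq u m; have := divn_eq v m; rewrite uc vc.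
  by have := ltn_pmod u m0; have := ltn_pmod v m0; lia.
by split; [apply: aux y1 z1|apply: aux y2 z2].
Qed.

Lemma coarse_disjoint (a b c d : nat) : (a, b) != (c, d) -> [disjoint coarse a b & coarse c d].
Proof.
move=> abcd; rewrite -setI_eq0; apply/eqP/setP => z; rewrite !inE.
apply/negP => /andP[/andP[/eqP a1 /eqP b1] /andP[/eqP c1 /eqP d1]].
by move/eqP: abcd; apply; rewrite -a1 -b1 -c1 -d1.
Qed.

End CoarseCells.

Lemma card_le_hit (I X Qt : finType) (Qs : Qt -> {set X}) (f : {ffun I -> X})
    (S : {set Qt}) (W : {set I}) :
  (forall q q', q != q' -> [disjoint Qs q & Qs q']) ->
  (forall q, q \in S -> exists2 w, w \in W & f w \in Qs q) -> (#|S| <= #|W|)%N.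
Proof.
move=> dQ SW; pose g q := [pick w in W | f w \in Qs q].
have gP q : q \in S -> exists2 w, g q = Some w & (w \in W) && (f w \in Qs q).
  move=> /SW[w wW fw]; rewrite /g; case: pickP => [w' h|/(_ w)]; first by exists w'.
  by rewrite wW fw.
rewrite -(card_in_imset (f := g) (D := S)); last first.
  move=> q q' /gP[w -> /andP[_ wq]] /gP[w' -> /andP[_ wq']] [ww]; rewrite -ww in wq'.
  apply/eqP/negPn/negP => /dQ; rewrite -setI_eq0 => /eqP/setP/(_ (f w)).
  by rewrite !inE wq wq'.
rewrite -(card_imset (mem W) (f := Some)); last by move=> ? ? [].
apply/subset_leq_card/fintype.subsetP.
by move=> _ /imsetP[q /gP[w -> /andP[wW _]] ->]; apply: imset_f.
Qed.

Lemma sum_card_disjoint (X Qt : finType) (Qs : Qt -> {set X}) (N : {set Qt}) (T : {set X}) :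
  (forall q q', q != q' -> [disjoint Qs q & Qs q']) ->
  (forall q, q \in N -> Qs q \subset T) -> (\sum_(q in N) #|Qs q| <= #|T|)%N.
Proof.
move=> dQ NT; under eq_bigr do rewrite -sum1_card.
rewrite (exchange_big_dep (mem T)) /=; last by move=> q z /NT /fintype.subsetP; apply.
rewrite -[leqRHS]sum1_card; apply: leq_sum => z _.
rewrite (eq_bigl (mem [set q in N | z \in Qs q])) => [|q]; last by rewrite !inE.
rewrite sum1_card; apply/card_le1_eqP => q q'; rewrite !inE => /andP[_ zq] /andP[_ zq'].
apply/eqP/negPn/negP => /dQ; rewrite -setI_eq0 => /eqP/setP/(_ z).
by rewrite !inE zq zq'.
Qed.

(** * The Euclidean norm on the grid torus *)

Section RealNorm.
Variables (R : realType) (M : nat).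
Local Notation G := ('I_M.+1 * 'I_M.+1)%type.

Definition rn (z : G) : R := Num.sqrt (n2 z)%:R.

Lemma rn_ge0 z : 0 <= rn z. Proof. exact: sqrtr_ge0. Qed.

Lemma rn_sqr z : rn z ^+ 2 = (n2 z)%:R. Proof. by rewrite sqr_sqrtr. Qed.

Lemma rnN z : rn (- z) = rn z.
Proof. by rewrite /rn /n2 !nrmN. Qed.

Lemma rn_le z (c : R) : 0 <= c -> (rn z <= c) = ((n2 z)%:R <= c ^+ 2).
Proof. by move=> c0; rewrite -rn_sqr ler_sqr ?nnegrE ?rn_ge0. Qed.

(** Coordinatewise subadditivity reduces this to the Cauchy-Schwarz inequality, whose defect is a
    square by Lagrange's identity. *)
Lemma rnD y z : rn (y + z) <= rn y + rn z.
Proof.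
rewrite rn_le ?addr_ge0 ?rn_ge0// sqrrD !rn_sqr.
have h1 := nrmD y.1 z.1; have h2 := nrmD y.2 z.2.
have : (n2 (y + z))%:R <= ((nrm y.1 + nrm z.1) ^ 2 + (nrm y.2 + nrm z.2) ^ 2)%:R :> R.
  by rewrite ler_nat leq_add// leq_exp2r.
move=> /le_trans -> //; rewrite /n2 !natrD !natrX !natrD.
suff : (nrm y.1)%:R * (nrm z.1)%:R + (nrm y.2)%:R * (nrm z.2)%:R <= rn y * rn z by lra.
have a0 := ler0n R (nrm y.1); have b0 := ler0n R (nrm z.1).
have c0 := ler0n R (nrm y.2); have d0 := ler0n R (nrm z.2).
rewrite -[leLHS]ger0_norm ?addr_ge0 ?mulr_ge0// -[leRHS]ger0_norm ?mulr_ge0 ?rn_ge0//.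
rewrite -ler_sqr ?nnegrE// !real_normK ?num_real// exprMn !rn_sqr /n2 !natrD !natrX.
move: (nrm y.1)%:R (nrm z.1)%:R (nrm y.2)%:R (nrm z.2)%:R a0 b0 c0 d0 => a b c d *.
rewrite -subr_ge0.
have -> : (a ^+ 2 + c ^+ 2) * (b ^+ 2 + d ^+ 2) - (a * b + c * d) ^+ 2 = (a * d - b * c) ^+ 2 by ring.
exact: sqr_ge0.
Qed.

Lemma rn_bound z (c : R) : (nrm z.1)%:R <= c -> (nrm z.2)%:R <= c -> rn z <= 2 * c.
Proof.
have := ler0n R (nrm z.1); have := ler0n R (nrm z.2).
move=> h1 h2 h3 h4; rewrite rn_le; last lra.
by rewrite /n2 natrD !natrX; nra.
Qed.

End RealNorm.

(** * Pairs of twins in a cell with an empty annulus *)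

Section LowerBound1.
Variables (R : realType) (n M k m : nat) (rho : R).
Hypothesis Mkm : M.+1 = (k * m)%N.
Local Notation G := ('I_M.+1 * 'I_M.+1)%type.
Hypothesis mrho : 8 * m%:R <= rho.

Let m0 : (0 < m)%N.
Proof.
have : (0 < k * m)%N by rewrite -Mkm.
by rewrite muln_gt0 => /andP[].
Qed.

Definition adj (x y : G) : bool := (n2 (x - y))%:R <= rho ^+ 2.

Let adjE x y : adj x y = (rn R (x - y) <= rho).
Proof.
have m1 : 1 <= m%:R :> R by rewrite ler1n.
have mr := mrho.
by rewrite rn_le//; lra.
Qed.

Local Notation Qt := ('I_k * 'I_k)%type.
Let Qs (q : Qt) : {set G} := coarse M m q.1 q.2.
(** Besides the cell, exactly the positions adjacent to some points of the cell but not to all; a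
    point elsewhere cannot tell two points of the cell apart. *)
Let Bs (q : Qt) : {set G} :=
  Qs q :|: [set x : G | [exists y in Qs q, exists y' in Qs q, adj x y && ~~ adj x y']].

Let Qs_card q : #|Qs q| = (m ^ 2)%N.
Proof. by apply: (card_coarse Mkm). Qed.

Let Qs_disjoint q q' : q != q' -> [disjoint Qs q & Qs q'].
Proof.
move=> qq'; apply: coarse_disjoint; apply: contraNneq qq' => -[/val_inj e1 /val_inj e2].
by rewrite [q]surjective_pairing e1 e2 -surjective_pairing.
Qed.

Let Qs_rn q y z : y \in Qs q -> z \in Qs q -> rn R (y - z) <= 2 * m%:R.
Proof.
by move=> yq zq; have [h1 h2] := coarse_nrm Mkm yq zq; apply: rn_bound; rewrite ler_nat.
Qed.

Let Qs_base q : exists y, y \in Qs q.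
Proof. by apply/set0Pn; rewrite -card_gt0 Qs_card expn_gt0 m0. Qed.

Let annulus_rn q x y0 : x \in Bs q -> x \notin Qs q -> y0 \in Qs q ->
  rho - 2 * m%:R <= rn R (x - y0) <= rho + 2 * m%:R.
Proof.
rewrite finset.in_setU => /orP[-> //|]; rewrite inE => /existsP[y /andP[yq]].
move=> /existsP[y' /andP[yq' /andP[]]]; rewrite !adjE -ltNge => h1 h2 _ y0q.
have h3 := rnD R (x - y) (y - y0); have h4 := rnD R (x - y0) (y0 - y').
rewrite !subrKA in h3 h4.
have := Qs_rn yq y0q; have := Qs_rn y0q yq'.
move=> *; apply/andP; split; lra.
Qed.

Let Bs_rn q x y0 : x \in Bs q -> y0 \in Qs q -> rn R (x - y0) <= rho + 2 * m%:R.
Proof.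
have m1 : 1 <= m%:R :> R by rewrite ler1n.
have mr := mrho.
move=> xB y0q; case: (boolP (x \in Qs q)) => xq; last by case/andP: (annulus_rn xB xq y0q).
by have := Qs_rn xq y0q; lra.
Qed.

(** The cell has diameter at most [2 * m], so the rest of the region lies in an annulus of that
    half-width, which gives 200; the cell itself accounts for the last unit. *)
Let Bs_card q : #|Bs q|%:R <= 201 * rho * m%:R :> R.
Proof.
have m1 : 1 <= m%:R :> R by rewrite ler1n.
have mr := mrho.
have [y0 y0q] := Qs_base q.
pose A : {set G} := [set z : G | (rho - 2 * m%:R) ^+ 2 <= (n2 z)%:R <= (rho + 2 * m%:R) ^+ 2].
have Ac : #|A|%:R <= 100 * rho * (2 * m%:R) by apply: card_annulus; lra.
have : (#|Bs q| <= #|Qs q| + #|A|)%N.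
  rewrite -(card_translate A y0).
  apply: (@leq_trans #|Qs q :|: [set x : G | ((x - y0)%R : G) \in A]|).
    apply/subset_leq_card/fintype.subsetP => x xB; rewrite inE.
    case: (boolP (x \in Qs q)) => //= xq; rewrite !inE.
    have /andP[h1 h2] := annulus_rn xB xq y0q.
    by rewrite -rn_sqr !ler_sqr ?nnegrE ?rn_ge0// ?h1 ?h2//; lra.
  rewrite cardsU; apply: leq_trans (leq_subr _ _) _.
  by rewrite leq_add2l cardsE.
rewrite -(ler_nat R) natrD Qs_card natrX => h; apply: le_trans h _; nra.
Qed.

Let near_ (q q' : Qt) : bool := ~~ [disjoint Bs q & Bs q'].

(** Cells with intersecting regions are within [3 * rho] of each other, and disjoint cells of
    [m ^ 2] points are packed into a square of side [6 * rho + 2 <= 8 * rho]. *)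
Let near_card q : #|[set q' | near_ q q']|%:R <= 64 * rho ^+ 2 / m%:R ^+ 2 :> R.
Proof.
have m1 : 1 <= m%:R :> R by rewrite ler1n.
have mr := mrho.
have [y0 y0q] := Qs_base q.
rewrite ler_pdivlMr ?exprn_gt0 ?ltr0n// -natrX -natrM.
pose S : {set 'I_M.+1} := [set a | (nrm a)%:R <= 3 * rho].
have Sc : #|S|%:R <= 2 * (3 * rho) + 2.
  apply: card_nrm_diam => [|a b]; first lra.
  by rewrite !inE => ha hb; have := ler0n R (nrm b); lra.
apply: (@le_trans _ _ #|finset.setX S S|%:R); last first.
  rewrite cardsX natrM; have := ler0n R #|S|; nra.
have <- : #|[set x : G | ((x - y0)%R : G) \in finset.setX S S]| = #|finset.setX S S|.
  by rewrite cardsE card_translate.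
rewrite ler_nat.
rewrite -sum_nat_const (eq_bigr (fun q' => #|Qs q'|)) => [|q' _]; last by rewrite Qs_card.
apply: sum_card_disjoint => // q'; rewrite inE /near_ -setI_eq0 => /set0Pn[x].
rewrite finset.in_setI => /andP[xB xB']; apply/fintype.subsetP => y yq'; rewrite !inE.
have h : rn R (y - y0) <= 3 * rho.
  have := rnD R (x - y0) (y - x); rewrite addrC subrKA.
  have := Bs_rn xB y0q; have := Bs_rn xB' yq'; rewrite -[X in X <= _]rnN opprB; lra.
move: h; rewrite rn_le; last lra.
rewrite /n2 natrD !natrX; have := ler0n R (nrm (y - y0).1); have := ler0n R (nrm (y - y0).2).
move: (nrm _)%:R (nrm _)%:R => a b a0 b0 h; apply/andP; split; rewrite leNgt; apply/negP => ?; nra.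
Qed.

Let isolated_metric_dim (f : {ffun 'I_n -> G}) :
  (#|[set q | isolated_pair Qs Bs q f]| <= metric_dim (grid_graph rho f))%N.
Proof.
have [W We ->] := metric_dimP (grid_graph rho f).
apply: (card_le_hit (Qs := Qs) (f := f)) => // q; rewrite inE => /existsP[[i j] /andP[ijn /forallP h]].
have ij : i != j by move: ijn; rewrite inE /= neq_ltn => ->.
have iq : f i \in Qs q by have := h i; rewrite !inE eqxx.
have jq : f j \in Qs q by have := h j; rewrite !inE eqxx orbT.
have hl l : l != i -> l != j -> f l \notin Bs q.
  by move=> li lj; have := h l; rewrite !inE (negPf li) (negPf lj).
case: (boolP (i \in W)) => iW; first by exists i.
case: (boolP (j \in W)) => jW; first by exists j.
exfalso; move/eqP: ij; apply; move/resolvingP: We; apply => w wW.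
apply: twin_graph_dist.
- move=> x xi xj; rewrite /grid_graph xi xj /=.
  have := hl x xi xj; rewrite finset.in_setU negb_or inE => /andP[_ /existsPn na].
  have naux y y' : y \in Qs q -> y' \in Qs q -> adj (f x) y -> adj (f x) y'.
    move=> yq yq' ay; have := na y; rewrite yq /= => /existsPn/(_ y').
    by rewrite yq' ay /= negbK.
  by apply/idP/idP; apply: naux.
- exact: grid_graph_sym.
- by rewrite /grid_graph !eqxx.
- by apply: contraNneq iW => <-.
- by apply: contraNneq jW => <-.
Qed.

Lemma Pr_metric_dim_lower1 (bb be c : R) : (4 <= n)%N -> (0 < k)%N ->
  201 * rho * m%:R / M.+1%:R ^+ 2 <= bb -> 0 <= bb <= 1 / 8 -> n%:R * bb <= be ->
  c = n%:R ^+ 2 / (4 * k%:R ^+ 2) / expR (2 * be) ->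
  Pr R (fun f : {ffun 'I_n -> G} => (metric_dim (grid_graph rho f))%:R < c / 2) <=
    4 * (c^-1 + 8 * bb + 64 * rho ^+ 2 / M.+1%:R ^+ 2 * expR (4 * be)).
Proof.
move=> n4 k0 hbb bb8 nbb cE.
have n0 : 0 < n%:R :> R by rewrite ltr0n (leq_trans _ n4).
have k0' : 0 < k%:R :> R by rewrite ltr0n.
have m0' : 0 < m%:R :> R by rewrite ltr0n.
have GE : #|{: G}|%:R = M.+1%:R ^+ 2 :> R by rewrite card_prod card_ord natrM.
have NE : M.+1%:R = k%:R * m%:R :> R by rewrite Mkm natrM.
have QE : #|{: Qt}|%:R = k%:R ^+ 2 :> R by rewrite card_prod card_ord natrM.
have pE q : #|Qs q|%:R / #|{: G}|%:R = k%:R ^- 2 :> R.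
  by rewrite Qs_card GE NE natrX; field; rewrite !gt_eqF.
have c0 : 0 < c by rewrite cE !divr_gt0 ?mulr_gt0 ?exprn_gt0 ?expR_gt0.
have cE' : c = #|{: Qt}|%:R * (n%:R ^+ 2 / 4 * (k%:R ^- 2) ^+ 2) / expR (2 * be).
  by rewrite cE QE; congr (_ / _); field; rewrite gt_eqF.
apply: (@le_trans _ _ (Pr R (fun f : {ffun 'I_n -> G} => #|[set q | isolated_pair Qs Bs q f]|%:R < c / 2))).
  by apply: sub_Pr => f; apply: le_lt_trans; rewrite ler_nat.
have G0 : (0 < #|{: G}|)%N by rewrite card_prod card_ord.
have sQB q : Qs q \subset Bs q by exact: finset.subsetUl.
have := Pr_few_isolated (n := n) (near_ := near_) sQB G0 pE (bb := bb) (be := be)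
  (Dl := 64 * rho ^+ 2 / m%:R ^+ 2).
rewrite -cE'; move=> /(_ _ _ near_card _ bb8 nbb c0 n4) h.
apply: le_trans (h _ _ _) _.
- by move=> q q' _ _; apply: Qs_disjoint.
- by move=> q q' _ _; rewrite negbK.
- by move=> q; rewrite GE; apply: le_trans hbb; rewrite ler_pM2r ?Bs_card// invr_gt0 exprn_gt0.
rewrite QE NE ler_wpM2l// lerD2l ler_wpM2r ?expR_ge0//.
by rewrite le_eqVlt; apply/orP; left; apply/eqP; field; rewrite !gt_eqF.
Qed.

End LowerBound1.

Lemma lower_bound1_grid (R : realType) (n : nat) (be r e : R) (M0 : nat) :
  201 <= be -> (4 <= n)%N -> 1608 <= n%:R :> R -> 3 <= r -> 0 < e ->
  4 * (16 * expR (2 * be) + 1608 + 64 * expR (4 * be)) * r ^+ 2 <= e * n%:R ->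
  exists2 M, (M0 <= M)%N &
  Pr R (fun f : {ffun 'I_n -> 'I_M.+1 * 'I_M.+1} =>
    (metric_dim (grid_graph (r * M.+1%:R / torus_side R n) f))%:R <
    (32 * expR (2 * be))^-1 * (n%:R / r ^+ 2)) <= e.
Proof.
move=> be201 n4 n1 r3 e0 hK.
have n0 : 0 < n%:R :> R by lra.
set L := torus_side R n; have L0 : 0 < L by rewrite /L sqrtr_gt0.
have L2 : L ^+ 2 = n%:R by rewrite sqr_sqrtr// ltW.
have L1 : 1 <= L by rewrite leNgt; apply/negP => L1; nra.
have r0 : 0 < r by lra.
have Lr0 : 0 <= L * r by rewrite mulr_ge0// ltW.
(* The cells have width between [1 / (2 * r)] and [1 / r], so that a cell with its annulus has
   bounded area. *)
pose k := (Num.truncn (L * r)).+1.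
have [k1 k2] : L * r <= k%:R /\ k%:R <= 2 * (L * r).
  have /andP[h1 h2] := truncn_itv Lr0; split; first exact: ltW.
  by rewrite /k -natr1; nra.
have k0 : (0 < k)%N by [].
move: k k1 k2 k0 => k k1 k2 k0; have k0' : 0 < k%:R :> R by rewrite ltr0n.
pose m := M0.+1; pose M := (k * m).-1.
have Mkm : M.+1 = (k * m)%N by rewrite prednK// muln_gt0 k0.
have NE : M.+1%:R = k%:R * m%:R :> R by rewrite Mkm natrM.
have m0' : 0 < m%:R :> R by rewrite ltr0n.
exists M; first by rewrite -ltnS Mkm leq_pmull.
set rho := r * M.+1%:R / L.
have rhoE : rho = m%:R * (r * k%:R / L) by rewrite /rho NE; field; rewrite gt_eqF.
have mrho : 8 * m%:R <= rho.
  rewrite rhoE mulrC ler_pM2l// ler_pdivlMr//; nra.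
have E2 : 0 < expR (2 * be) :> R by exact: expR_gt0.
have E4 : 0 < expR (4 * be) :> R by exact: expR_gt0.
(* At most 201 points are expected in a region, whence [201 <= be]; the bound 1608 on [n] is
   [8 * 201]. *)
have hbb : 201 * rho * m%:R / M.+1%:R ^+ 2 <= 201 / n%:R.
  have -> : 201 * rho * m%:R / M.+1%:R ^+ 2 = 201 * (r / (L * k%:R)).
    by rewrite rhoE NE; field; rewrite !gt_eqF.
  rewrite ler_pM2l// ler_pdivrMr ?mulr_gt0// mulrC ler_pdivlMr// -L2; nra.
have bb8 : 0 <= (201 / n%:R : R) <= 1 / 8.
  by rewrite divr_ge0//= ler_pdivrMr//; lra.
have nbb : n%:R * (201 / n%:R) <= be by rewrite mulrCA divff ?mulr1// gt_eqF.
pose c : R := n%:R ^+ 2 / (4 * k%:R ^+ 2) / expR (2 * be).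
have := Pr_metric_dim_lower1 Mkm mrho n4 k0 hbb bb8 nbb (erefl c).
have cge : n%:R / r ^+ 2 / (16 * expR (2 * be)) <= c.
  rewrite /c.
  have -> : n%:R / r ^+ 2 / (16 * expR (2 * be)) = n%:R ^+ 2 / (16 * n%:R * r ^+ 2) / expR (2 * be).
    by field; rewrite !gt_eqF.
  rewrite ler_pM2r ?invr_gt0// ler_pM2l ?exprn_gt0// lef_pV2 ?posrE ?mulr_gt0 ?exprn_gt0//.
  have : k%:R ^+ 2 <= (2 * (L * r)) ^+ 2 by rewrite lerXn2r ?nnegrE ?mulr_ge0// ltW.
  by rewrite !exprMn L2; lra.
have c0 : 0 < n%:R / r ^+ 2 / (16 * expR (2 * be)).
  by rewrite !divr_gt0 ?exprn_gt0 ?mulr_gt0.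
move=> h; apply: le_trans (le_trans _ h) _.
  apply: sub_Pr => f; move=> /lt_le_trans; apply.
  have -> : (32 * expR (2 * be))^-1 * (n%:R / r ^+ 2) = n%:R / r ^+ 2 / (16 * expR (2 * be)) / 2.
    by field; rewrite !gt_eqF.
  by rewrite ler_pM2r.
have h1 : c^-1 <= 16 * expR (2 * be) * (r ^+ 2 / n%:R).
  apply: (@le_trans _ _ (n%:R / r ^+ 2 / (16 * expR (2 * be)))^-1).
    by rewrite lef_pV2 ?posrE//; apply: lt_le_trans cge.
  by rewrite le_eqVlt; apply/orP; left; apply/eqP; field; rewrite !gt_eqF.
have h2 : 8 * (201 / n%:R) <= 1608 * (r ^+ 2 / n%:R).
  rewrite !mulrA ler_pM2r ?invr_gt0//; nra.
have h3 : 64 * rho ^+ 2 / M.+1%:R ^+ 2 * expR (4 * be) = 64 * expR (4 * be) * (r ^+ 2 / n%:R).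
  by rewrite rhoE NE -L2; field; rewrite !gt_eqF.
rewrite h3.
have : 4 * (16 * expR (2 * be) + 1608 + 64 * expR (4 * be)) * (r ^+ 2 / n%:R) <= e.
  by rewrite mulrA ler_pdivrMr.
move: h1 h2; clear; move: (expR _) (expR _) (r ^+ 2 / n%:R) (c^-1) (8 * _) => *; lra.
Qed.

(** * Lower bound from dense blocks *)

Section MixedCells.
Variable R : realType.

(* A disc centred to the right of a small square, and within 45 degrees of the
   horizontal, that meets a cell of the square covers every cell at least two
   cell widths further right in the same row. *)
Lemma disc_crossing (p q x y x' y' d s rho : R) :
  `|x| <= d -> `|y| <= d -> `|x'| <= d -> `|y'| <= d -> `|q| <= p ->
  2 * s <= x' - x -> `|y - y'| <= s -> 0 <= s <= d -> 40 * d <= rho ->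
  (p - x) ^+ 2 + (q - y) ^+ 2 <= rho ^+ 2 ->
  (p - x') ^+ 2 + (q - y') ^+ 2 <= rho ^+ 2.
Proof.
rewrite !ler_norml => /andP[x1 x2] /andP[y1 y2] /andP[x1' x2'] /andP[y1' y2'] /andP[q1 q2].
move=> xx /andP[yy1 yy2] /andP[s0 sd] rd h; rewrite leNgt; apply/negP => h'.
have p0 : 0 <= p by lra.
have d0 : 0 <= d by lra.
have hx : (p - x') ^+ 2 <= (p + d) ^+ 2.
  by rewrite -[X in X <= _]real_normK ?num_real// lerXn2r ?nnegrE ?normr_ge0//; [lra|rewrite ler_norml; lra].
have hy : (q - y') ^+ 2 <= (p + d) ^+ 2.
  by rewrite -[X in X <= _]real_normK ?num_real// lerXn2r ?nnegrE ?normr_ge0//; [lra|rewrite ler_norml; lra].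
(* If the conclusion fails, then [rho ^ 2 < 2 * (p + d) ^ 2], so the centre is far away compared
   with the square. *)
have pd : 27 * d <= p by rewrite leNgt; apply/negP => ?; nra.
(* [e1] is the horizontal gain in squared distance and [e2] bounds the vertical loss; their balance
   is the quantity of [e3]. *)
have e1 : 2 * s * (2 * p - 4 * d) <= (x' - x) * (2 * p - x - x').
  apply: ler_pM; lra.
have e2 : - ((p + d) * 2 * s + s * s) <= 2 * (q - y) * (y' - y) - (y' - y) ^+ 2.
  have : `|(q - y) * (y' - y)| <= (p + d) * s.
    by rewrite normrM ler_pM// ler_norml; lra.
  rewrite ler_norml => /andP[]; have : (y' - y) ^+ 2 <= s ^+ 2.
    by rewrite -[X in X <= _]real_normK ?num_real// lerXn2r ?nnegrE ?normr_ge0// ler_norml; lra.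
  lra.
have e3 : 0 <= s * (2 * p - 10 * d - s) by rewrite mulr_ge0//; lra.
nra.
Qed.

Lemma card_row_spread (K : nat) (S : {set 'I_K * 'I_K}) :
  (forall a a' b, (a, b) \in S -> (a', b) \in S -> (a' <= a + 2)%N) ->
  #|S|%:R <= 3 * K%:R :> R.
Proof.
move=> Sab; have -> : 3 * K%:R = #|[set: 'I_K]|%:R * 3 :> R by rewrite cardsT card_ord mulrC.
apply: card_fibers => [z _|b]; first by rewrite inE.
rewrite ler_nat; apply: card_ord_le_diam => i j; rewrite !inE => ib jb.
exact: Sab jb ib.
Qed.

Lemma card_col_spread (K : nat) (S : {set 'I_K * 'I_K}) :
  (forall a b b', (a, b) \in S -> (a, b') \in S -> (b' <= b + 2)%N) ->
  #|S|%:R <= 3 * K%:R :> R.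
Proof.
move=> Sab; pose sw (z : 'I_K * 'I_K) := (z.2, z.1).
have swinj : injective sw by move=> [? ?] [? ?] [-> ->].
rewrite -(card_imset _ swinj); apply: card_row_spread => a a' b.
move=> /imsetP[[x y] xS [-> ->]] /imsetP[[x' y'] xS' [-> e]].
by apply: (Sab x) => //; rewrite e.
Qed.

Variables (M k m K A0 : nat) (rho : R).
Hypothesis Mkm : M.+1 = (k * m)%N.
Hypothesis rhoM : 4 * rho <= M.+1%:R.
Hypothesis Krho : 40 * (m%:R * K%:R) <= rho.
Hypothesis lowA : (M.+1 < 4 * (m * A0))%N.
Hypothesis highA : (4 * (m * (A0 + K)) <= 3 * M.+1)%N.
Local Notation G := ('I_M.+1 * 'I_M.+1)%type.

Let m0 : (0 < m)%N.
Proof.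
have : (0 < k * m)%N by rewrite -Mkm.
by rewrite muln_gt0 => /andP[].
Qed.

(** For [b] in the middle half of the side, wrapping around matters only when both the cyclic and
    the straight distance exceed [rho]. Discs near the block can thus be treated as planar. *)
Lemma nrm_mid (a b : 'I_M.+1) : (M.+1 < 4 * b)%N -> (4 * b < 3 * M.+1)%N ->
  (nrm (a - b))%:R = `|a%:R - b%:R| :> R \/
  (rho < (nrm (a - b))%:R /\ rho < `|a%:R - b%:R|).
Proof.
move=> b1 b2.
have [d [dE dn dM]] : exists d : nat, [/\ `|a%:R - b%:R| = d%:R :> R,
    nrm (a - b) = minn d (M.+1 - d) & (4 * d < 3 * M.+1)%N].
  have la := ltn_ord a; have [ba|/ltnW ab] := leqP b a.
    exists (a - b)%N; rewrite nrm_sub// natrB// ger0_norm ?subr_ge0 ?ler_nat//; split=> //; lia.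
  exists (b - a)%N; rewrite -nrmN opprB nrm_sub// natrB// distrC ger0_norm ?subr_ge0 ?ler_nat//.
  by split=> //; lia.
rewrite dE dn; have [_|h] := leqP d (M.+1 - d)%N; [by left|right].
have dM' : (M.+1 < 4 * (M.+1 - d))%N by lia.
have h1 : rho < (M.+1 - d)%:R.
  by move: dM' (rhoM); rewrite -(ltr_nat R) natrM; lra.
by split=> //; apply: lt_trans h1 _; rewrite ltr_nat.
Qed.

Lemma n2_mid (u z : G) : (M.+1 < 4 * z.1)%N -> (4 * z.1 < 3 * M.+1)%N ->
  (M.+1 < 4 * z.2)%N -> (4 * z.2 < 3 * M.+1)%N ->
  ((n2 (u - z))%:R <= rho ^+ 2) =
  ((u.1%:R - z.1%:R) ^+ 2 + (u.2%:R - z.2%:R) ^+ 2 <= rho ^+ 2).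
Proof.
move=> z1 z1' z2 z2'; rewrite /n2 natrD !natrX.
have rho0 : 0 <= rho by apply: le_trans Krho; rewrite !mulr_ge0.
have aux (v w v' w' : R) : rho < v \/ rho < w -> 0 <= v -> 0 <= w ->
    (v ^+ 2 + w ^+ 2 <= rho ^+ 2) = false.
  move=> h v0 w0; apply/negbTE; rewrite -ltNge; case: h => h.
    by apply: (@lt_le_trans _ _ (v ^+ 2)); rewrite ?lerDl ?sqr_ge0// ltrXn2r ?nnegrE.
  by apply: (@lt_le_trans _ _ (w ^+ 2)); rewrite ?lerDr ?sqr_ge0// ltrXn2r ?nnegrE.
rewrite -[(u.1%:R - _) ^+ 2]real_normK ?num_real// -[(u.2%:R - _) ^+ 2]real_normK ?num_real//.
case: (nrm_mid u.1 z1 z1') => [->|[h1 h2]]; last by rewrite !aux//; left.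
by case: (nrm_mid u.2 z2 z2') => [->//|[h1 h2]]; rewrite !aux//; right.
Qed.

Local Notation Qt := ('I_K * 'I_K)%type.

Definition block_cell (q : Qt) : {set G} := coarse M m (A0 + q.1) (A0 + q.2).

Definition covered (U : {set G}) (z : G) : bool :=
  [exists u in U, (n2 (u - z))%:R <= rho ^+ 2].

Definition mixed (U : {set G}) : {set Qt} :=
  [set q | [exists z in block_cell q, covered U z] &&
           [exists z in block_cell q, ~~ covered U z]].

Let c : R := (m * A0)%:R.

Let block_cell_coord (q : Qt) z : z \in block_cell q ->
  [/\ m%:R * q.1%:R <= z.1%:R - c <= m%:R * (q.1%:R + 1),
      m%:R * q.2%:R <= z.2%:R - c <= m%:R * (q.2%:R + 1),
      (M.+1 < 4 * z.1)%N /\ (4 * z.1 < 3 * M.+1)%N &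
      (M.+1 < 4 * z.2)%N /\ (4 * z.2 < 3 * M.+1)%N].
Proof.
rewrite inE => /andP[/eqP z1 /eqP z2].
have aux (x : nat) (a : 'I_K) : (x %/ m = A0 + a)%N ->
  (m%:R * a%:R <= x%:R - c <= m%:R * (a%:R + 1)) /\
  ((M.+1 < 4 * x)%N /\ (4 * x < 3 * M.+1)%N).
  move=> xa; have := divn_eq x m; rewrite xa => xE.
  have := ltn_pmod x m0 => xm; have la := ltn_ord a.
  have h1 : (m * A0 + m * a <= x)%N by rewrite xE mulnDl ![(_ * m)%N]mulnC leq_addr.
  have h2 : (x < m * A0 + m * a.+1)%N.
    by rewrite {1}xE mulnDl mulnS ![(m * _)%N]mulnC; lia.
  have h3 : (m * a.+1 <= m * K)%N by rewrite leq_mul2l la orbT.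
  split; last by move: highA lowA; rewrite mulnDr; lia.
  apply/andP; split.
    by rewrite lerBrDr -natrM -natrD ler_nat addnC.
  by rewrite lerBlDr natr1 -natrM -natrD ler_nat addnC ltnW.
by have [] := aux _ _ z1; have [] := aux _ _ z2.
Qed.

(** Cell indices differing by three put points at least two cell widths apart, as [disc_crossing]
    requires; the second alternative is its mirror image under [x -> - x]. *)
Let cross (p q X Y X' Y' : R) (a b a' : 'I_K) :
  m%:R * a%:R <= X <= m%:R * (a%:R + 1) -> m%:R * b%:R <= Y <= m%:R * (b%:R + 1) ->
  m%:R * a'%:R <= X' <= m%:R * (a'%:R + 1) -> m%:R * b%:R <= Y' <= m%:R * (b%:R + 1) ->
  (`|q| <= p /\ (a + 3 <= a')%N) \/ (`|q| <= - p /\ (a' + 3 <= a)%N) ->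
  (p - X) ^+ 2 + (q - Y) ^+ 2 <= rho ^+ 2 ->
  (p - X') ^+ 2 + (q - Y') ^+ 2 <= rho ^+ 2.
Proof.
move=> /andP[X1 X2] /andP[Y1 Y2] /andP[X1' X2'] /andP[Y1' Y2'] h.
have m1 : 1 <= m%:R :> R by rewrite ler1n.
have Kr := Krho.
have bd (t : 'I_K) : 0 <= m%:R * t%:R :> R /\ m%:R * (t%:R + 1) <= m%:R * K%:R :> R.
  rewrite natr1 -natrM ler0n -natrM -natrM ler_nat leq_mul2l.
  by split=> //; apply/orP; right; exact: ltn_ord.
have [a0 aK] := bd a; have [b0 bK] := bd b; have [a0' aK'] := bd a'.
have mK : m%:R <= m%:R * K%:R :> R.
  by rewrite -natrM ler_nat leq_pmulr//; exact: leq_ltn_trans (leq0n a) (ltn_ord a).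
rewrite !mulrDr !mulr1 in X2 Y2 X2' Y2' aK bK aK'.
case: h => -[qp aa].
  apply: (@disc_crossing p q X Y X' Y' (m%:R * K%:R) m%:R) => //; rewrite ?ler_norml; try lra.
  have : m%:R * (a%:R + 3) <= m%:R * a'%:R :> R by rewrite -[3]/(3%:R) -natrD ler_wpM2l// ler_nat.
  by rewrite mulrDr; lra.
have sq (x y : R) : (x - y) ^+ 2 = (- x - - y) ^+ 2 by ring.
rewrite [X in X + _ <= _ -> _]sq [X in _ -> X + _ <= _]sq.
apply: (@disc_crossing (- p) q (- X) Y (- X') Y' (m%:R * K%:R) m%:R) => //; rewrite ?ler_norml; try lra.
have : m%:R * (a'%:R + 3) <= m%:R * a%:R :> R by rewrite -[3]/(3%:R) -natrD ler_wpM2l// ler_nat.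
by rewrite mulrDr; lra.
Qed.

(** Like [mixed], but the cell must be met by a disc whose centre lies in the sector [t], while
    failing to be covered by all the discs together. *)
Let directed (U : {set G}) (t : pred G) : {set Qt} :=
  [set q | [exists u in U, t u && [exists z in block_cell q, (n2 (u - z))%:R <= rho ^+ 2]] &&
           [exists z in block_cell q, ~~ covered U z]].

Let directedP U t q q' : q \in directed U t -> q' \in directed U t ->
  exists u z z', [/\ t u, z \in block_cell q, z' \in block_cell q',
    (u.1%:R - c - (z.1%:R - c)) ^+ 2 + (u.2%:R - c - (z.2%:R - c)) ^+ 2 <= rho ^+ 2 &
    ~~ ((u.1%:R - c - (z'.1%:R - c)) ^+ 2 + (u.2%:R - c - (z'.2%:R - c)) ^+ 2 <= rho ^+ 2)].
Proof.
rewrite !inE => /andP[/existsP[u /andP[uU /andP[tu /existsP[z /andP[zq uz]]]]] _].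
move=> /andP[_ /existsP[z' /andP[zq' /existsPn/(_ u)]]]; rewrite uU /= => uz'.
have [_ _ [h1 h2] [h3 h4]] := block_cell_coord zq.
have [_ _ [h1' h2'] [h3' h4']] := block_cell_coord zq'.
have cc (x y : R) : x - c - (y - c) = x - y by ring.
exists u, z, z'; split=> //; rewrite !cc -n2_mid//.
Qed.

(** Centres are sorted into four sectors around the corner [(c, c)] of the block. In a row, an
    eastern disc that meets a cell covers all cells at least three columns further right, so the
    directed cells of a row span at most three columns. Each sector contributes [3 * K] cells; north
    and south use columns in place of rows. *)
Lemma card_mixed (U : {set G}) : #|mixed U|%:R <= 12 * K%:R :> R.
Proof.
pose tE := [pred u : G | `|u.2%:R - c| <= u.1%:R - c].
pose tW := [pred u : G | `|u.2%:R - c| <= - (u.1%:R - c)].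
pose tN := [pred u : G | `|u.1%:R - c| <= u.2%:R - c].
pose tS := [pred u : G | `|u.1%:R - c| <= - (u.2%:R - c)].
have row (t : pred G) : (forall u, t u -> tE u) \/ (forall u, t u -> tW u) ->
    #|directed U t|%:R <= 3 * K%:R :> R.
  move=> ht; apply: card_row_spread => a a' b qt qt'.
  rewrite leqNgt; apply/negP => aa.
  case: ht => ht.
    have [u [z [z' [tu zq zq' h1 /negP[]]]]] := directedP qt qt'.
    have [z1 z2 _ _] := block_cell_coord zq; have [z1' z2' _ _] := block_cell_coord zq'.
    apply: (cross z1 z2 z1' z2') h1; left; split; first exact: ht.
    by rewrite /= addnS.
  have [u [z [z' [tu zq zq' h1 /negP[]]]]] := directedP qt' qt.
  have [z1 z2 _ _] := block_cell_coord zq; have [z1' z2' _ _] := block_cell_coord zq'.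
  apply: (cross z1 z2 z1' z2') h1; right; split; first exact: ht.
  by rewrite /= addnS.
have col (t : pred G) : (forall u, t u -> tN u) \/ (forall u, t u -> tS u) ->
    #|directed U t|%:R <= 3 * K%:R :> R.
  move=> ht; apply: card_col_spread => a b b' qt qt'.
  rewrite leqNgt; apply/negP => bb.
  case: ht => ht.
    have [u [z [z' [tu zq zq' h1 /negP[]]]]] := directedP qt qt'.
    have [z1 z2 _ _] := block_cell_coord zq; have [z1' z2' _ _] := block_cell_coord zq'.
    rewrite addrC; rewrite addrC in h1.
    apply: (cross z2 z1 z2' z1') h1; left; split; first exact: ht.
    by rewrite /= addnS.
  have [u [z [z' [tu zq zq' h1 /negP[]]]]] := directedP qt' qt.
  have [z1 z2 _ _] := block_cell_coord zq; have [z1' z2' _ _] := block_cell_coord zq'.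
  rewrite addrC; rewrite addrC in h1.
  apply: (cross z2 z1 z2' z1') h1; right; split; first exact: ht.
  by rewrite /= addnS.
have sub : mixed U \subset
    (directed U tE :|: directed U tW) :|: (directed U tN :|: directed U tS).
  apply/fintype.subsetP => q; rewrite inE => /andP[/existsP[z /andP[zq /existsP[u /andP[uU uz]]]] nc].
  have dir (t : pred G) : t u -> q \in directed U t.
    move=> tu; rewrite inE nc andbT; apply/existsP; exists u; rewrite uU tu /=.
    by apply/existsP; exists z; rewrite zq.
  rewrite !finset.in_setU.
  have : [|| tE u, tW u, tN u | tS u].
    rewrite /= !ler_norml; move: (u.1%:R - c) (u.2%:R - c) => x y.
    have [xy|xy] := leP x y; have [xy'|xy'] := leP (- x) y; apply/or4P.
    - by constructor 3; lra.
    - by constructor 2; lra.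
    - by constructor 1; lra.
    - by constructor 4; lra.
  by case/or4P => /dir ->; rewrite ?orbT.
have := row tE (or_introl (fun _ h => h)); have := row tW (or_intror (fun _ h => h)).
have := col tN (or_introl (fun _ h => h)); have := col tS (or_intror (fun _ h => h)).
have := subset_leq_card sub.
have := leq_card_setU (directed U tE :|: directed U tW) (directed U tN :|: directed U tS).
have := leq_card_setU (directed U tE) (directed U tW).
have := leq_card_setU (directed U tN) (directed U tS).
move=> -[h1 _] [h2 _] [h3 _] h4.
have := leq_trans h4 (leq_trans h3 (leq_add h2 h1)).
by rewrite -(ler_nat R) !natrD; lra.
Qed.

End MixedCells.

(** * Landmarks against the cells of a block *)

Section LowerBound2.
Variables (R : realType) (n M k m K A0 : nat) (rho : R).
Hypothesis Mkm : M.+1 = (k * m)%N.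
Hypothesis rhoM : 4 * rho <= M.+1%:R.
Hypothesis Krho : 40 * (m%:R * K%:R) <= rho.
Hypothesis lowA : (M.+1 < 4 * (m * A0))%N.
Hypothesis highA : (4 * (m * (A0 + K)) <= 3 * M.+1)%N.
Hypothesis K0 : (0 < K)%N.
Local Notation G := ('I_M.+1 * 'I_M.+1)%type.
Local Notation Qt := ('I_K * 'I_K)%type.
Local Notation cellq := (@block_cell M m K A0).

Let m0 : (0 < m)%N.
Proof.
have : (0 < k * m)%N by rewrite -Mkm.
by rewrite muln_gt0 => /andP[].
Qed.

Let AK : (A0 + K <= k)%N.
Proof.
have : (m * (4 * (A0 + K)) <= m * (3 * k))%N.
  by move: highA; rewrite Mkm mulnCA [(k * m)%N]mulnC [(3 * (m * k))%N]mulnCA.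
by rewrite leq_mul2l eqn0Ngt m0 /= => h; lia.
Qed.

Definition block : {set G} :=
  [set z : G | (A0 <= z.1 %/ m < A0 + K)%N && (A0 <= z.2 %/ m < A0 + K)%N].

Lemma block_cell_disjoint (q q' : Qt) : q != q' -> [disjoint cellq q & cellq q'].
Proof.
move=> qq'; apply: coarse_disjoint; apply: contraNneq qq' => -[/addnI/val_inj e1 /addnI/val_inj e2].
by rewrite [q]surjective_pairing e1 e2 -surjective_pairing.
Qed.

Lemma card_block_cell (q : Qt) : #|cellq q| = (m ^ 2)%N.
Proof.
by apply: (card_coarse Mkm); apply: leq_trans AK; rewrite ltn_add2l.
Qed.

Lemma block_cell_sub (q : Qt) : cellq q \subset block.
Proof.
apply/fintype.subsetP => z; rewrite !inE => /andP[/eqP -> /eqP ->].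
by rewrite !leq_addr !ltn_add2l !ltn_ord.
Qed.

Lemma blockP z : z \in block -> exists q : Qt, z \in cellq q.
Proof.
rewrite inE => /andP[/andP[a1 a2] /andP[b1 b2]].
have a3 : (z.1 %/ m - A0 < K)%N by rewrite ltn_subLR.
have b3 : (z.2 %/ m - A0 < K)%N by rewrite ltn_subLR.
by exists (Ordinal a3, Ordinal b3); rewrite inE /= !subnKC ?eqxx.
Qed.

Lemma card_block : #|block| = (K ^ 2 * m ^ 2)%N.
Proof.
have sE : (\sum_(q in [set: Qt]) #|cellq q| = K ^ 2 * m ^ 2)%N.
  rewrite (eq_bigr (fun=> m ^ 2)%N) => [|q _]; last exact: card_block_cell.
  by rewrite sum_nat_const cardsT card_prod card_ord expnS expn1.
apply/eqP; rewrite eqn_leq -sE; apply/andP; split; last first.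
  by apply: sum_card_disjoint => [|q _]; [exact: block_cell_disjoint|exact: block_cell_sub].
under eq_bigr do rewrite -sum1_card.
rewrite (exchange_big_dep xpredT)//= -sum1_card big_mkcond; apply: leq_sum => z _.
case: ifP => // /blockP[q zq]; rewrite (bigD1 q)//=.
by rewrite inE.
Qed.

Lemma block_clique (z z' : G) : z \in block -> z' \in block -> (n2 (z - z'))%:R <= rho ^+ 2.
Proof.
rewrite !inE => /andP[/andP[a1 a2] /andP[b1 b2]] /andP[/andP[a1' a2'] /andP[b1' b2']].
have aux (x y : 'I_M.+1) : (A0 <= x %/ m < A0 + K)%N -> (A0 <= y %/ m < A0 + K)%N ->
    (nrm (x - y)%R <= m * K)%N.
  move=> /andP[x1 x2] /andP[y1 y2]; wlog yx : x y x1 x2 y1 y2 / (y <= x)%N.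
    move=> H; have [/H|/ltnW/H] := leqP y x; first exact.
    by rewrite -nrmN opprB; apply.
  rewrite nrm_sub//; apply: leq_trans (geq_minl _ _) _.
  move: y1 x2; rewrite leq_divRL// ltn_divLR// mulnDl ![(_ * m)%N]mulnC; lia.
have h1 := aux z.1 z'.1; have h2 := aux z.2 z'.2.
have {}h1 : (nrm (z.1 - z'.1))%:R <= m%:R * K%:R :> R.
  by rewrite -natrM ler_nat h1// ?a1 ?a1'.
have {}h2 : (nrm (z.2 - z'.2))%:R <= m%:R * K%:R :> R.
  by rewrite -natrM ler_nat h2// ?b1 ?b1'.
have Kr := Krho; have := ler0n R (m * K); rewrite natrM => mK.
rewrite /n2 natrD !natrX.
have := ler0n R (nrm (z.1 - z'.1)); have := ler0n R (nrm (z.2 - z'.2)).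
move: (nrm _)%:R (nrm _)%:R h1 h2 => x y h1 h2 x0 y0; nra.
Qed.

Definition inside (f : {ffun 'I_n -> G}) : {set 'I_n} := [set i | f i \in block].

Definition reached (f : {ffun 'I_n -> G}) (w : 'I_n) (t : nat) : {set G} :=
  [set f a | a in layer (grid_graph rho f) (inside f) w t].

Definition split_cells (f : {ffun 'I_n -> G}) (w : 'I_n) (t : nat) : {set Qt} :=
  [set q in mixed m K A0 rho (reached f w t) | has_pair cellq (inside f) q f].

(** Each cell with an isolated pair is charged to a landmark resolving the pair. A landmark in the
    block is adjacent to all other vertices there and is charged for its own cell only. For an
    outside landmark, exactly one vertex of the pair is covered by the discs around the reached
    points, so the cell is one of its split cells. *)
Lemma isolated_le_metric_dim (f : {ffun 'I_n -> G}) (l : nat) :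
  (forall w t, w \notin inside f -> (t <= n)%N -> (#|split_cells f w t| <= l)%N) ->
  (#|[set q | isolated_pair cellq cellq q f]| <= metric_dim (grid_graph rho f) * l.+1)%N.
Proof.
move=> few; set e := grid_graph rho f; set J := inside f.
have clique : {in J &, forall u v, u != v -> e u v}.
  move=> u v uJ vJ uv; rewrite /e /grid_graph uv /=; apply: block_clique.
    by move: uJ; rewrite inE.
  by move: vJ; rewrite inE.
have [W We ->] := metric_dimP e.
have /choice[t tP] : forall w : 'I_n, exists t, w \notin J -> (t <= n)%N /\
    {in J &, forall u v, seen e (layer e J w t) u = seen e (layer e J w t) v ->
      graph_dist e w u = graph_dist e w v}.
  move=> w; have [wJ|wJ] := boolP (w \in J); first by exists 0%N.
  by have [t tn tP] := clique_graph_dist clique wJ; exists t; rewrite card_ord in tn.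
pose H w : {set Qt} := [set q | f w \in cellq q] :|: (if w \in J then finset.set0 else split_cells f w (t w)).
have Hl w : (#|H w| <= l.+1)%N.
  apply: leq_trans (leq_card_setU _ _).1 _; rewrite -[l.+1]add1n leq_add//.
    apply/card_le1_eqP => q q'; rewrite !inE => wq wq'; apply/eqP/negPn/negP => /block_cell_disjoint.
    rewrite -setI_eq0 => /eqP/setP/(_ (f w)); rewrite inE.
    by rewrite [f w \in cellq q]inE [f w \in cellq q']inE wq wq' inE.
  case: ifPn => wJ; first by rewrite cards0.
  by apply: few => //; have [] := tP w wJ.
apply: leq_trans (_ : (_ <= \sum_(w in W) #|H w|)%N) _; last first.
  by rewrite -sum_nat_const; apply: leq_sum => w _.
apply: leq_trans (subset_leq_card _) (_ : (#|\bigcup_(w in W) H w| <= _)%N); last first.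
  elim/big_rec2: _ => [|w s A _ h]; first by rewrite cards0.
  by apply: leq_trans (leq_card_setU _ _).1 _; rewrite leq_add2l.
apply/fintype.subsetP => q; rewrite inE => /existsP[[i j] /andP[ijn /forallP h]].
have ij : i != j by move: ijn; rewrite inE /= neq_ltn => ->.
have iq : f i \in cellq q by have := h i; rewrite !inE eqxx.
have jq : f j \in cellq q by have := h j; rewrite !inE eqxx orbT.
have iJ : i \in J by rewrite inE (fintype.subsetP (block_cell_sub q)).
have jJ : j \in J by rewrite inE (fintype.subsetP (block_cell_sub q)).
have [w wW dw] : exists2 w, w \in W & graph_dist e w i <> graph_dist e w j.
  apply: contrapT => nw; move/eqP: ij; apply; move/resolvingP: We; apply => w wW.
  by apply: contrapT => dw; apply: nw; exists w.
apply/bigcupP; exists w => //; rewrite finset.in_setU.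
case: (boolP (w \in J)) => wJ.
  rewrite finset.in_set0 orbF inE.
  have [->//|wi] := eqVneq w i; have [->//|wj] := eqVneq w j.
  case: dw; have := graph_dist_adj e wi; have := graph_dist_adj e wj.
  by rewrite !clique// => /eqP -> /eqP ->.
apply/orP; right; rewrite inE; apply/andP; split; last first.
  by apply/existsP; exists (i, j); rewrite iJ jJ ij iq jq.
have [tn tseen] := tP w wJ.
have seenE v : v \in J -> seen e (layer e J w (t w)) v = covered rho (reached f w (t w)) (f v).
  move=> vJ; apply/existsP/existsP => [[a /andP[aT eav]]|[_ /andP[/imsetP[a aT ->] fav]]].
    exists (f a); rewrite imset_f//=; by move: eav; rewrite /e /grid_graph => /andP[].
  exists a; rewrite aT /e /grid_graph fav andbT.
  by rewrite /=; apply/eqP => av; move/negP: (layer_notJ wJ aT); apply; rewrite av.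
have : seen e (layer e J w (t w)) i != seen e (layer e J w (t w)) j.
  by apply/eqP => s; apply: dw; apply: tseen.
rewrite !seenE// inE.
case ci : (covered _ _ (f i)); case cj : (covered _ _ (f j)) => // _.
  apply/andP; split; apply/existsP; first by exists (f i); rewrite iq ci.
  by exists (f j); rewrite jq cj.
apply/andP; split; apply/existsP; first by exists (f j); rewrite jq cj.
by exists (f i); rewrite iq ci.
Qed.

(** The layer index supplied by [clique_graph_dist] depends on the sample, so all indices up to [n]
    are considered. *)
Definition many_split (l : nat) (f : {ffun 'I_n -> G}) : bool :=
  [exists wt : 'I_n * 'I_n.+1, (wt.1 \notin inside f) && (l < #|split_cells f wt.1 wt.2|)%N].

(** Fixing which points lie in the block and the positions of the others fixes the reached set,
    hence the at most [12 * K] mixed cells. The points inside stay uniform on the block, of which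
    each cell is a proportion [K ^- 2], so [Pr_many_double] applies to each of the [n * n.+1]
    landmarks and layers. *)
Lemma Pr_many_split (l : nat) (N : R) :
  Pr R (fun f => many_split l f && (#|inside f|%:R < N)) <=
    n%:R * n.+1%:R * ((12 * K%:R * (N * K%:R ^- 2) ^+ 2) ^+ l.+1 / l.+1`!%:R).
Proof.
have b0 : (0 < #|block|)%N by rewrite card_block muln_gt0 !expn_gt0 K0 m0.
have base0 : 0 <= 12 * K%:R * (N * K%:R ^- 2) ^+ 2 by rewrite mulr_ge0 ?sqr_ge0 ?mulr_ge0.
have bound0 : 0 <= (12 * K%:R * (N * K%:R ^- 2) ^+ 2) ^+ l.+1 / l.+1`!%:R :> R.
  by rewrite divr_ge0// exprn_ge0.
have total0 : 0 <= n%:R * n.+1%:R * ((12 * K%:R * (N * K%:R ^- 2) ^+ 2) ^+ l.+1 / l.+1`!%:R) :> R.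
  by rewrite mulr_ge0// mulr_ge0.
pose Y := {x : G | x \in block}.
have Yc : #|{: Y}| = #|block| by rewrite card_sig; apply: eq_card => x; rewrite inE.
have Y0 : (0 < #|{: Y}|)%N by rewrite Yc.
(* Positions in the block are replaced by fresh ones there, the others are kept. A block point [x]
   arises from any old block position with [y = x], an outside point only from itself with any [y]:
   in both cases [#|Y|] ways. *)
pose g (i : 'I_n) (a : G) (y : Y) := if a \in block then val y else a.
have gE i x : #|[pred ay : G * Y | g i ay.1 ay.2 == x]| = #|{: Y}|.
  have [xb|xb] := boolP (x \in block).
    rewrite Yc -(card_imset (mem block) (f := fun a => (a, Sub x xb : Y))); last by move=> ? ? [].
    apply: eq_card => -[a y]; rewrite !inE /g /=; apply/eqP/imsetP => [|[a' a'b [-> ->]]].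
      case: ifP => ab yx; last by rewrite yx xb in ab.
      by exists a => //; congr (_, _); apply: val_inj.
    by rewrite a'b.
  rewrite -(card_pred_fst Y x); apply: eq_card => -[a y]; rewrite !inE /g /=.
  case: ifP => // ab; apply/eqP/eqP => [yx|ax].
    by move: xb; rewrite -yx (valP y).
  by rewrite -ax ab in xb.
rewrite {1}/Pr -(avg_resample (g := g) _ gE Y0).
apply: avg_le_cst => // f.
set phi := fun h : {ffun 'I_n -> Y} => [ffun i => g i (f i) (h i)].
have phiJ h : inside (phi h) = inside f.
  apply/setP => i; have inP f' : (i \in inside f') = (f' i \in block) by rewrite inE.
  by rewrite !inP ffunE /g; case: ifP => [fb|->//]; exact: valP (h i).
have phi_out h i : i \notin inside f -> phi h i = f i.
  by rewrite inE ffunE /g => /negPf ->.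
have [JN|NJ] := ltP #|inside f|%:R N; last first.
  by apply: avg_le_cst => // h; rewrite -/(phi h) phiJ ltNge NJ andbF.
have reachedE h w t : w \notin inside f -> reached (phi h) w t = reached f w t.
  move=> wJ; rewrite /reached phiJ.
  have -> : layer (grid_graph rho (phi h)) (inside f) w t = layer (grid_graph rho f) (inside f) w t.
    by apply: eq_layer => // a u aJ uJ; rewrite /grid_graph !phi_out.
  by apply: eq_in_imset => a /(layer_notJ wJ) aJ; rewrite phi_out.
pose Qs' (q : Qt) : {set Y} := [set y : Y | val y \in cellq q].
have dQ' q q' : q != q' -> [disjoint Qs' q & Qs' q'].
  move=> /block_cell_disjoint; rewrite -!setI_eq0 => /eqP/setP d; apply/eqP/setP => y.
  by have := d (val y); rewrite !inE.
have Qs'k q : #|Qs' q|%:R / #|{: Y}|%:R <= K%:R ^- 2 :> R.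
  have -> : #|Qs' q| = (m ^ 2)%N.
    rewrite -(card_block_cell q) -(card_imset _ (val_inj : injective (val : Y -> G))).
    apply: eq_card => z; apply/imsetP/idP => [[y + ->]|zq]; first by rewrite inE.
    have zb : z \in block by apply: fintype.subsetP zq; exact: block_cell_sub.
    by exists (Sub z zb : Y); rewrite ?[_ \in Qs' q]inE SubK.
  rewrite Yc card_block natrM !natrX invfM mulrCA divff ?mulr1//.
  by rewrite expf_neq0// pnatr_eq0 -lt0n.
apply: (@le_trans _ _ (Pr R (fun h : {ffun 'I_n -> Y} => [exists wt : 'I_n * 'I_n.+1,
   (wt.1 \notin inside f) && (l.+1 <= #|[set q in mixed m K A0 rho (reached f wt.1 wt.2) |
      has_pair Qs' (inside f) q h]|)%N]))).
  apply: le_avg => h; rewrite -/(phi h).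
  set b1 := (X in (nat_of_bool X)%:R <= _); set b2 := (X in _ <= (nat_of_bool X)%:R).
  suff : b1 -> b2 by case: b1 => [/(_ isT) ->|_]; rewrite ?ler0n.
  rewrite /b1 /b2 => /andP[/existsP[[w t] /= /andP[wJ lt]] _]; rewrite phiJ in wJ.
  apply/existsP; exists (w, t); rewrite wJ /=; apply: leq_trans lt _.
  apply/subset_leq_card/fintype.subsetP => q; rewrite !inE reachedE// phiJ => /andP[-> /=].
  move=> /existsP[[i j] /= /and5P[iJ jJ ij iq jq]]; apply/existsP; exists (i, j).
  rewrite /= iJ jJ ij /=.
  move: iq jq iJ jJ; rewrite !ffunE /g => + + iJ jJ.
  move: (iJ) (jJ); rewrite [i \in _]inE [j \in _]inE => -> -> iq jq.
  by rewrite [h i \in _]inE iq [h j \in _]inE jq.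
apply: le_trans (Pr_exists _ _) _.
have -> (s : R) : n%:R * n.+1%:R * s = \sum_(wt : 'I_n * 'I_n.+1) s.
  by rewrite sumr_const -[RHS]mulr_natl card_prod !card_ord natrM.
apply: ler_sum => -[w t] _ /=.
apply: le_trans (_ : _ <= Pr R (fun h : {ffun 'I_n -> Y} => (l.+1 <= #|[set q in mixed m K A0 rho (reached f w t) |
      has_pair Qs' (inside f) q h]|)%N)) _.
  by apply: sub_Pr => h /andP[].
apply: (Pr_many_double (Qs := Qs')) => //.
- exact: ltW.
- exact: (card_mixed Mkm rhoM Krho lowA highA).
Qed.

Let G0 : (0 < #|{: G}|)%N.
Proof. by rewrite card_prod card_ord. Qed.

Lemma Pr_block : #|block|%:R / #|{: G}|%:R = K%:R ^+ 2 / k%:R ^+ 2 :> R.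
Proof.
have k0 : (0 < k)%N by apply: leq_trans AK; rewrite addn_gt0 K0 orbT.
rewrite card_block natrM !natrX card_prod card_ord natrM Mkm natrM.
by field; rewrite !pnatr_eq0 -!lt0n k0 m0.
Qed.

Lemma Pr_many_inside (mu : R) : (0 < n)%N -> mu = n%:R * (K%:R ^+ 2 / k%:R ^+ 2) ->
  Pr R (fun f => 2 * mu <= #|inside f|%:R) <= mu^-1.
Proof.
move=> n0 muE; have k0 : (0 < k)%N by apply: leq_trans AK; rewrite addn_gt0 K0 orbT.
have Zp i : Pr R (fun f : {ffun 'I_n -> G} => f i \in block) = K%:R ^+ 2 / k%:R ^+ 2.
  by rewrite /Pr (avg_coord i (fun x => (x \in block)%:R)) // -[avg _]/(Pr R (fun x => x \in block)) Pr_in Pr_block.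
rewrite (@eq_Pr _ _ _ (fun f : {ffun 'I_n -> G} => 2 * mu <= #|[set i in [set: 'I_n] | f i \in block]|%:R)); last first.
  by move=> f; congr (_ <= _%:R); apply: eq_card => i; rewrite [RHS]inE [LHS]inE finset.in_setT.
apply: (uncorrelated_count_upper (p := K%:R ^+ 2 / k%:R ^+ 2)
   (Z := fun i (f : {ffun 'I_n -> G}) => f i \in block)).
- by rewrite muE mulr_gt0 ?divr_gt0 ?exprn_gt0 ?ltr0n.
- by rewrite cardsT card_ord muE.
- by rewrite divr_ge0// exprn_ge0.
- by move=> i _; exact: Zp.
- move=> i j _ _ ij.
  have := Pr_resample_coord (R := R) (F := fun f : {ffun 'I_n -> G} => f j \in block)
    (A := fun x y : G => x \in block) (p := K%:R ^+ 2 / k%:R ^+ 2) ij.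
  rewrite Zp -expr2 => <- //.
  + by rewrite le_eqVlt; apply/orP; left; apply/eqP/eq_Pr => f; rewrite andbC.
  + by move=> f g fg; rewrite fg// eq_sym.
  + by move=> _; rewrite Pr_in Pr_block.
Qed.

Lemma Pr_metric_dim_lower2 (l : nat) (c mu be : R) : (4 <= n)%N ->
  k%:R ^- 2 <= 1 / 8 :> R -> n%:R * k%:R ^- 2 <= be ->
  mu = n%:R * (K%:R ^+ 2 / k%:R ^+ 2) ->
  c = K%:R ^+ 2 * (n%:R ^+ 2 / 4 * (k%:R ^- 2) ^+ 2) / expR (2 * be) ->
  Pr R (fun f : {ffun 'I_n -> G} => (metric_dim (grid_graph rho f) * l.+1)%:R < c / 2) <=
    4 * (c^-1 + 8 * k%:R ^- 2 + K%:R ^- 2 * expR (4 * be)) +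
    (mu^-1 + n%:R * n.+1%:R * ((12 * K%:R * (2 * mu * K%:R ^- 2) ^+ 2) ^+ l.+1 / l.+1`!%:R)).
Proof.
move=> n4 k8 nk muE cE.
have n0 : (0 < n)%N by apply: leq_trans n4.
have k0 : (0 < k)%N by apply: leq_trans AK; rewrite addn_gt0 K0 orbT.
have k0' : 0 < k%:R :> R by rewrite ltr0n.
have K0' : 0 < K%:R :> R by rewrite ltr0n.
have m0' : 0 < m%:R :> R by rewrite ltr0n.
have n0' : 0 < n%:R :> R by rewrite ltr0n.
have QE : #|{: Qt}|%:R = K%:R ^+ 2 :> R by rewrite card_prod card_ord natrM.
have pE q : #|cellq q|%:R / #|{: G}|%:R = k%:R ^- 2 :> R.
  rewrite card_block_cell card_prod card_ord Mkm natrX !natrM.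
  by field; rewrite !gt_eqF.
have c0 : 0 < c by rewrite cE !(divr_gt0, mulr_gt0, exprn_gt0, expR_gt0, invr_gt0).
have kk : 0 <= (k%:R ^- 2 : R) <= 1 / 8 by rewrite invr_ge0 exprn_ge0//= k8.
apply: (@le_trans _ _ (Pr R (fun f : {ffun 'I_n -> G} =>
   (#|[set q | isolated_pair cellq cellq q f]|%:R < c / 2) ||
   ((2 * mu <= #|inside f|%:R) || (many_split l f && (#|inside f|%:R < 2 * mu)))))).
  apply: sub_Pr => f dim; have [//|/= lc] := ltP _ (c / 2).
  have [//|/= J2] := leP (2 * mu) _; rewrite andbT.
  case: (boolP (many_split l f)) => // /existsPn nms; exfalso.
  move: dim; apply/negP; rewrite -leNgt; apply: le_trans lc _; rewrite ler_nat.
  apply: isolated_le_metric_dim => w t wJ tn.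
  have tn' : (t < n.+1)%N by [].
  by have := nms (w, Ordinal tn'); rewrite /= wJ /= -leqNgt.
apply: le_trans (Pr_or _ _ _) _; apply: lerD; last first.
  apply: le_trans (Pr_or _ _ _) _; apply: lerD; first exact: Pr_many_inside.
  exact: Pr_many_split.
have sQB q : cellq q \subset cellq q by [].
(* The region of a cell is the cell itself, so a cell is near only to itself. *)
have := Pr_few_isolated (n := n) (near_ := eq_op) sQB G0 pE (bb := k%:R ^- 2) (be := be) (Dl := 1).
have cE' : c = #|{: Qt}|%:R * (n%:R ^+ 2 / 4 * (k%:R ^- 2) ^+ 2) / expR (2 * be) by rewrite QE.
rewrite -cE'; move=> /(_ _ _ _ _ kk nk c0 n4) h.
apply: le_trans (h _ _ _ _) _.
- by move=> q q' _ _; exact: block_cell_disjoint.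
- by move=> q q' _ _; exact: block_cell_disjoint.
- move=> q; rewrite (_ : [set q' | q == q'] = [set q]%SET) ?cards1//.
  by apply/setP => q'; rewrite !inE eq_sym.
- by move=> q; rewrite pE.
by rewrite QE div1r.
Qed.

End LowerBound2.

(** * Poisson tail and choice of the cell width *)

Section LowerBound2Asymptotics.
Variable R : realType.

Lemma expR1_le4 : expR 1 <= 4 :> R.
Proof.
have h : 1 / 2 <= expR (- (1 / 2)) :> R.
  by apply: le_trans (expR_ge1Dx _); lra.
have e0 := expR_gt0 (- (1 / 2) : R).
have e1 : expR (- (1 / 2)) * expR (1 / 2) = 1 :> R by rewrite -expRD addNr expR0.
have -> : expR 1 = expR (1 / 2) ^+ 2 :> R by rewrite -expRM_natl; congr expR; lra.
have := expR_gt0 (1 / 2 : R); move: (expR _) (expR (1 / 2)) h e0 e1 => x y *.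
have : y <= 2 by nra.
nra.
Qed.

(** One term of the exponential series gives [k ^ k / k! <= expR k], so the quotient is at most
    [(6 / 100 * expR 1) ^ k.+1]; and [6 / 100 * expR 1 ^ 2 <= 1] since [expR 1 <= 4]. *)
Lemma poisson_tail (l x : R) (k : nat) : 0 <= x -> x <= 6 / 5 * l -> 20 * l <= k.+1%:R ->
  x ^+ k.+1 / k.+1`!%:R <= expR (- (20 * l)).
Proof.
move=> x0 xl lk; have k0 : 0 < k.+1%:R :> R by rewrite ltr0n.
have f0 : 0 < k.+1`!%:R :> R by rewrite ltr0n fact_gt0.
have h1 : k.+1%:R ^+ k.+1 / k.+1`!%:R <= expR k.+1%:R :> R.
  by apply: le_trans (expR_ge1Dxn k (ltW k0)); rewrite lerDr.
have h2 : x ^+ k.+1 <= (6 / 100) ^+ k.+1 * k.+1%:R ^+ k.+1.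
  by rewrite -exprMn lerXn2r ?nnegrE ?mulr_ge0// ?divr_ge0//; lra.
apply: (@le_trans _ _ ((6 / 100) ^+ k.+1 * expR k.+1%:R)).
  apply: (@le_trans _ _ ((6 / 100) ^+ k.+1 * (k.+1%:R ^+ k.+1 / k.+1`!%:R))).
    by rewrite mulrA ler_pM2r ?invr_gt0.
  by rewrite ler_wpM2l// exprn_ge0// divr_ge0.
have -> : expR k.+1%:R = expR 1 ^+ k.+1 :> R by rewrite -expRM_natl mulr1.
rewrite -exprMn; apply: (@le_trans _ _ (expR (-1) ^+ k.+1)).
  have e1 : expR (-1) * expR 1 = 1 :> R by rewrite -expRD addNr expR0.
  have e0 := expR_gt0 (1 : R); have e4 := expR1_le4; have e0' := expR_gt0 (- 1 : R).
  rewrite lerXn2r ?nnegrE ?mulr_ge0 ?divr_ge0 ?(ltW e0) ?(ltW e0')//.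
  move: (expR 1) (expR (-1)) e0 e1 e4 e0' => y z *; nra.
by rewrite -expRM_natl mulrN1 ler_expR lerN2.
Qed.

(** With [(l / r) ^ (1 / 3)] as cell width, the right side is, up to constants, the expected number
    of isolated pairs in the block divided by the share [l] of one landmark. *)
Lemma powR_lower2 (r l : R) : 0 < r -> 0 < l ->
  r `^ (4 / 3) / l `^ (1 / 3) = (r * (l / r) `^ (1 / 3)) ^+ 2 / l.
Proof.
move=> r0 l0; rewrite powR_div// ?(ltW l0)//.
have -> : r `^ (4 / 3) = (r `^ (1 / 3)) ^+ 4.
  by rewrite -powR_mulrn ?powR_ge0// -powRrM; congr (_ `^ _); field.
have := powR_third_cube (ltW r0); have := powR_third_cube (ltW l0).
have : 0 < r `^ (1 / 3) by rewrite powR_gt0.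
have : 0 < l `^ (1 / 3) by rewrite powR_gt0.
move: (r `^ _) (l `^ _) => a b b0 a0 <- <-.
by field; rewrite !gt_eqF.
Qed.

Lemma lower_bound2_grid (n : nat) (be r e : R) (M0 : nat) :
  1 <= be -> (4 <= n)%N -> 1 <= ln n%:R :> R -> ln n%:R <= r <= Num.sqrt n%:R / 4 ->
  40 <= r -> 0 < e ->
  4 * (4 * 160 ^+ 2 * expR (2 * be) + 1 + 80 ^+ 2 * expR (4 * be)) + 80 ^+ 2 + 1 <= e * r ->
  exists2 M, (M0 <= M)%N &
  Pr R (fun f : {ffun 'I_n -> 'I_M.+1 * 'I_M.+1} =>
    (metric_dim (grid_graph (r * M.+1%:R / torus_side R n) f))%:R <
    (168 * 160 ^+ 2 * expR (2 * be))^-1 * (r `^ (4 / 3) / ln n%:R `^ (1 / 3))) <= e.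
Proof.
move=> be1 n4 l1 /andP[lr rL] r40 e0 hC.
set L := torus_side R n; rewrite -/(torus_side R n) -/L in rL.
have n0 : (0 < n)%N by apply: leq_trans n4.
have n0' : 0 < n%:R :> R by rewrite ltr0n.
have L0 : 0 < L by rewrite /L sqrtr_gt0.
have L2 : L ^+ 2 = n%:R by rewrite sqr_sqrtr// ltW.
have r0 : 0 < r by lra.
set l := ln n%:R in l1 lr *.
have l0 : 0 < l by lra.
pose ep := (l / r) `^ (1 / 3).
have lr0 : 0 < l / r by rewrite divr_gt0.
have ep0 : 0 < ep by rewrite powR_gt0.
have ep3 : ep ^+ 3 = l / r by rewrite powR_third_cube// ltW.
have ep1 : ep <= 1.
  have : ep ^+ 3 <= 1 by rewrite ep3 ler_pdivrMr// mul1r.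
  by apply: contraTT; rewrite -!ltNge => h; exact: exprn_egt1.
rewrite powR_lower2// -/ep.
have rep3 : (r * ep) ^+ 3 = r ^+ 2 * l by rewrite exprMn ep3; field; rewrite gt_eqF.
move: ep ep0 ep1 ep3 rep3 => ep ep0 ep1 ep3 rep3.
have Lep : 0 <= L / ep by rewrite divr_ge0// ltW.
(* The cell width [s = L / k] lies between [ep / 2] and [ep]. *)
have [k [k1 k2]] : exists k : nat, L / ep <= k%:R /\ k%:R <= 2 * (L / ep).
  have /andP[h1 h2] := truncn_itv Lep; exists (Num.truncn (L / ep)).+1; split; first exact: ltW.
  have : 1 <= L / ep by rewrite ler_pdivlMr//; lra.
  rewrite -natr1; move: (Num.truncn _)%:R h1 => t; lra.
have kL : L <= k%:R by apply: le_trans k1; rewrite ler_pdivlMr// ler_piMr// ltW.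
have k0 : 0 < k%:R :> R by lra.
pose s := L / k%:R.
have s0 : 0 < s by rewrite divr_gt0.
have sep : s <= ep by rewrite /s ler_pdivrMr// mulrC -ler_pdivrMr.
have eps : ep <= 2 * s.
  rewrite /s mulrA ler_pdivlMr// mulrC -ler_pdivlMr//; lra.
have s1 : s <= 1 by lra.
have sk : s * k%:R = L by rewrite /s divfK// gt_eqF.
have s40 : 0 < 40 * s by lra.
have rs0 : 0 <= r / (40 * s) by rewrite divr_ge0 ?mulr_ge0// ltW.
(* The side [s * K] of the block lies between [r / 80] and [r / 40]; the factor 40 is the one of
   [disc_crossing]. *)
have [K [K1 K2 K0]] : exists K : nat, [/\ 40 * s * K%:R <= r, r <= 80 * s * K%:R & (0 < K)%N].
  have /andP[h1 h2] := truncn_itv rs0; exists (Num.truncn (r / (40 * s))).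
  have h3 : 1 <= (Num.truncn (r / (40 * s)))%:R :> R.
    rewrite ler1n truncn_gt0 ler_pdivlMr//; clear -s1 r40; lra.
  split.
  - by move: h1; rewrite ler_pdivlMr// mulrC.
  - move: h2; rewrite ltr_pdivrMr// -(natr1 (Num.truncn _)).
    move: (Num.truncn _)%:R h3 => t h3 h2; clear -s0 h2 h3; nra.
  - by rewrite -(ltr_nat R); lra.
have K0' : 0 < K%:R :> R by rewrite ltr0n.
(* The block starts at half the side, and [4 * K <= k] keeps it below three quarters. *)
pose m := M0.+1; pose M := (k * m).-1; pose A0 := k./2.
have k160 : (160 <= k)%N by rewrite -(ler_nat R); lra.
have m0' : 0 < m%:R :> R by rewrite ltr0n.
have Mkm : M.+1 = (k * m)%N by rewrite prednK// muln_gt0 (leq_trans _ k160).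
have NE : M.+1%:R = k%:R * m%:R :> R by rewrite Mkm natrM.
exists M; first by rewrite -ltnS Mkm leq_pmull// (leq_trans _ k160).
set rho := r * M.+1%:R / L.
have rhoE : rho = r * m%:R / s by rewrite /rho NE /s; field; rewrite !gt_eqF.
have rhoM : 4 * rho <= M.+1%:R.
  by rewrite /rho mulrA ler_pdivrMr// mulrA [_ * L]mulrC ler_pM2r ?ltr0n//; lra.
have Krho : 40 * (m%:R * K%:R) <= rho.
  rewrite rhoE ler_pdivlMr//.
  have -> : 40 * (m%:R * K%:R) * s = m%:R * (40 * s * K%:R) by ring.
  by rewrite [r * _]mulrC ler_pM2l.
have Kk : (4 * K <= k)%N.
  rewrite -(ler_nat R) natrM -(ler_pM2l s0) sk; clear -K1 rL s0 K0' r0.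
  move: K%:R K1 K0' => x; nra.
have lowA : (M.+1 < 4 * (m * A0))%N.
  rewrite Mkm mulnCA mulnC ltn_pmul2l// /A0.
  by have := odd_double_half k; move: k160; clear; case: (odd k) => /=; lia.
have highA : (4 * (m * (A0 + K)) <= 3 * M.+1)%N.
  rewrite Mkm mulnCA [(k * m)%N]mulnC [(3 * _)%N]mulnCA leq_pmul2l// /A0.
  by have := odd_double_half k; move: Kk k160; clear; case: (odd k) => /=; lia.
have nk : n%:R * k%:R ^- 2 = s ^+ 2 :> R by rewrite -L2 /s; field; rewrite gt_eqF.
have s2 : s ^+ 2 <= 1 by rewrite exprn_ile1// ltW.
(* The number of split cells allowed per landmark, with the factor 20 of [poisson_tail]. *)
have [j [j1 j2]] : exists j : nat, 20 * l <= j.+1%:R /\ j.+1%:R <= 21 * l.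
  have l20 : 0 <= 20 * l by lra.
  have /andP[h1 h2] := truncn_itv l20; exists (Num.truncn (20 * l)); split; first exact: ltW.
  rewrite -natr1; clear -h1 l1; move: (Num.truncn _)%:R h1 => t; lra.
have E2 := expR_gt0 (2 * be); have E4 := expR_gt0 (4 * be).
pose mu := n%:R * (K%:R ^+ 2 / k%:R ^+ 2) : R.
have muE : mu = (K%:R * s) ^+ 2.
  by rewrite exprMn -nk /mu; field; rewrite gt_eqF.
pose c := K%:R ^+ 2 * (n%:R ^+ 2 / 4 * (k%:R ^- 2) ^+ 2) / expR (2 * be) : R.
have cE : c = (K%:R * s ^+ 2) ^+ 2 / (4 * expR (2 * be)).
  by rewrite -nk /c; field; rewrite !gt_eqF.
have k8 : k%:R ^- 2 <= (1 / 8 : R).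
  rewrite -[leLHS]mul1r ler_pdivrMr ?exprn_gt0//.
  have : 160 <= k%:R :> R by rewrite ler_nat.
  by clear; move: k%:R => x; rewrite expr2; nra.
have nk1 : n%:R * k%:R ^- 2 <= be by rewrite nk; apply: le_trans be1.
have := Pr_metric_dim_lower2 Mkm rhoM Krho lowA highA K0 j n4 k8 nk1 (erefl mu) (erefl c).
(* 160 is [80 * 2], from [r <= 80 * s * K] and [ep <= 2 * s]. *)
have Ks : r * ep <= 160 * (K%:R * s ^+ 2).
  have h1 : r * ep <= r * (2 * s) by rewrite ler_pM2l.
  have h2 : r * (2 * s) <= 80 * s * K%:R * (2 * s) by rewrite ler_pM2r//; clear -s0; lra.
  apply: le_trans h1 (le_trans h2 _).
  by rewrite le_eqVlt; apply/orP; left; apply/eqP; ring.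
have rep0 : 0 < r * ep by rewrite mulr_gt0.
have cge : (r * ep) ^+ 2 / (4 * 160 ^+ 2 * expR (2 * be)) <= c.
  rewrite cE.
  have -> : (r * ep) ^+ 2 / (4 * 160 ^+ 2 * expR (2 * be)) =
      (r * ep / 160) ^+ 2 / (4 * expR (2 * be)) by field; rewrite gt_eqF.
  rewrite ler_pM2r ?invr_gt0 ?mulr_gt0// lerXn2r ?nnegrE//.
  - by rewrite divr_ge0// ltW.
  - by rewrite mulr_ge0// sqr_ge0.
  - rewrite ler_pdivrMr; last by clear; lra.
    by rewrite [_ * 160]mulrC.
move=> h; apply: le_trans (le_trans _ h) _.
  apply: sub_Pr => f dim; rewrite natrM.
  (* 168 is [4 * 2 * 21]: the 4 of the bound for the mean, half the mean, and at most [21 * l] cells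
     per landmark. *)
  apply: (@lt_le_trans _ _ ((168 * 160 ^+ 2 * expR (2 * be))^-1 * ((r * ep) ^+ 2 / l) * (21 * l))).
    apply: (@lt_le_trans _ _ ((168 * 160 ^+ 2 * expR (2 * be))^-1 * ((r * ep) ^+ 2 / l) * j.+1%:R)).
      by rewrite ltr_pM2r ?ltr0n.
    apply: ler_wpM2l j2; apply: mulr_ge0; last by rewrite divr_ge0 ?sqr_ge0 ?(ltW l0).
    rewrite invr_ge0; apply: mulr_ge0; last exact: ltW.
    by apply: mulr_ge0; [exact: ler0n|exact: exprn_ge0].
  have -> : (168 * 160 ^+ 2 * expR (2 * be))^-1 * ((r * ep) ^+ 2 / l) * (21 * l) =
     (r * ep) ^+ 2 / (4 * 160 ^+ 2 * expR (2 * be)) / 2.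
    by field; rewrite !gt_eqF.
  by rewrite ler_pM2r.
have r1 : 0 < r^-1 by rewrite invr_gt0.
have t1 : c^-1 <= 4 * 160 ^+ 2 * expR (2 * be) * r^-1.
  have c0 : 0 < (r * ep) ^+ 2 / (4 * 160 ^+ 2 * expR (2 * be)).
    by rewrite divr_gt0 ?exprn_gt0// !mulr_gt0// exprn_gt0.
  apply: (@le_trans _ _ ((r * ep) ^+ 2 / (4 * 160 ^+ 2 * expR (2 * be)))^-1).
    by rewrite lef_pV2 ?posrE//; apply: lt_le_trans cge.
  rewrite invf_div ler_pM2l; last by rewrite !mulr_gt0// exprn_gt0.
  rewrite lef_pV2 ?posrE ?exprn_gt0//.
  move: rep3 rep0; move: (r * ep) => x x3 x0.
  rewrite leNgt; apply/negP => xr.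
  have : x ^+ 3 >= r ^+ 2 by rewrite x3 ler_peMr// sqr_ge0.
  have : x ^+ 3 <= x * r by rewrite exprS ler_wpM2l ?(ltW x0)// ltW.
  move: (x ^+ 3) => y; move: xr x0 r0 r40; clear; rewrite !expr2; nra.
have t2 : 8 * k%:R ^- 2 <= r^-1.
  rewrite ler_pdivrMr ?exprn_gt0// mulrC ler_pdivlMr//.
  clear -r40 rL kL; move: k%:R kL => x; rewrite expr2; nra.
have K80 : r <= 80 * K%:R by clear -K2 s1 s0 K0'; move: K%:R K2 K0' => x; nra.
have rr : r <= r ^+ 2 by rewrite expr2 ler_peMr ?(ltW r0)//; clear -r40; lra.
have t3 : K%:R ^- 2 <= 80 ^+ 2 * r^-1.
  rewrite -[leLHS]mul1r ler_pdivrMr ?exprn_gt0// mulrAC ler_pdivlMr// mul1r.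
  clear -K80 rr r0; move: K%:R K80 => x; rewrite !expr2 in rr *; nra.
have t4 : mu^-1 <= 80 ^+ 2 * r^-1.
  have Ks80 : r <= 80 * (K%:R * s) by clear -K2; lra.
  have Ks0 : 0 < K%:R * s by rewrite mulr_gt0.
  rewrite muE -[leLHS]mul1r ler_pdivrMr ?exprn_gt0// mulrAC ler_pdivlMr// mul1r.
  clear -Ks80 rr r0; move: (K%:R * s) Ks80 => x; rewrite !expr2 in rr *; nra.
have t5 : n%:R * n.+1%:R * ((12 * K%:R * (2 * mu * K%:R ^- 2) ^+ 2) ^+ j.+1 / j.+1`!%:R) <= r^-1.
  have -> : 12 * K%:R * (2 * mu * K%:R ^- 2) ^+ 2 = 48 * K%:R * s ^+ 4.
    by rewrite muE; field; rewrite gt_eqF.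
  have X0 : 0 <= 48 * K%:R * s ^+ 4 by rewrite mulr_ge0 ?mulr_ge0 ?exprn_ge0// ltW.
  (* The Poisson parameter: [12 * K] mixed cells, each weighted by [(2 * s ^ 2) ^ 2]. Since
     [40 * s * K <= r], the choice [r * ep ^ 3 = l] makes it of order [l]. *)
  have X1 : 48 * K%:R * s ^+ 4 <= 6 / 5 * l.
    have s3 : s ^+ 3 <= l / r by rewrite -ep3 lerXn2r ?nnegrE// ltW.
    have : r * s ^+ 3 <= l by rewrite mulrC -ler_pdivlMr.
    have : 40 * s * K%:R * s ^+ 3 <= r * s ^+ 3 by rewrite ler_wpM2r ?exprn_ge0// ltW.
    have -> : 48 * K%:R * s ^+ 4 = 6 / 5 * (40 * s * K%:R * s ^+ 3) by field.
    move: (40 * s * _ * _) (r * _) => x y; clear; lra.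
  have h5 := poisson_tail X0 X1 j1.
  apply: (@le_trans _ _ (n%:R * n.+1%:R * expR (- (4%:R * l)))).
    rewrite ler_wpM2l ?mulr_ge0//; apply: le_trans h5 _; rewrite ler_expR; clear -l0; lra.
  rewrite expR_opp_ln//.
  have nr : r <= n%:R by rewrite -L2; clear -r40 rL; rewrite expr2; nra.
  have n1r : 1 <= n%:R :> R by rewrite ler1n.
  have n1 : n.+1%:R <= 2 * n%:R :> R by rewrite -natr1; clear -n1r; lra.
  rewrite ler_pdivrMr ?exprn_gt0// [r^-1 * _]mulrC ler_pdivlMr//.
  apply: (@le_trans _ _ (2 * n%:R ^+ 3)).
    have -> : 2 * n%:R ^+ 3 = n%:R * (2 * n%:R) * n%:R :> R by ring.
    by apply: ler_pM => //; [exact: ltW|rewrite ler_wpM2l].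
  rewrite [_ ^+ 4]exprS ler_wpM2r ?exprn_ge0//; clear -nr r40; lra.
have : (4 * (4 * 160 ^+ 2 * expR (2 * be) + 1 + 80 ^+ 2 * expR (4 * be)) + 80 ^+ 2 + 1) * r^-1 <= e.
  by rewrite ler_pdivrMr.
have t3' : K%:R ^- 2 * expR (4 * be) <= 80 ^+ 2 * r^-1 * expR (4 * be) by rewrite ler_pM2r.
move: t1 t2 t3' t4 t5; clear.
move: (160 ^+ 2) (80 ^+ 2) (expR (2 * be)) (expR (4 * be)) r^-1 c^-1 mu^-1 => a b x y z c' mu'.
move: (_ ^- 2 * y) (8 * _) (_ * _ * (_ / _)) => u v w; lra.
Qed.

End LowerBound2Asymptotics.

(** * The two regimes *)

Local Open Scope classical_set_scope.
Local Open Scope ring_scope.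

Lemma near_ln_ge (R : realType) (A : R) : \forall n \near \oo, A <= ln n%:R.
Proof.
have := nbhs_infty_ger (expR A); apply: filterS => n h.
by rewrite -[A]expRK ler_ln ?posrE ?expR_gt0//; apply: lt_le_trans h; exact: expR_gt0.
Qed.

(** [expR l >= l ^ 5 / 5!], and [l >= 120 = 5!] absorbs the factorial. *)
Lemma ln_exp4_le (R : realType) (n : nat) : (0 < n)%N -> 120 <= ln n%:R :> R ->
  ln n%:R ^+ 4 <= n%:R :> R.
Proof.
move=> n0 h; have l0 : 0 <= ln n%:R :> R by lra.
rewrite -[leRHS]lnK ?posrE ?ltr0n//; apply: le_trans (expR_ge1Dxn 4 l0).
rewrite (_ : 5`! = 120)//.
have : 0 <= ln n%:R ^+ 4 :> R by rewrite exprn_ge0.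
rewrite [_ ^+ 5]exprS; move: (ln _) (ln _ ^+ 4) h {l0} => l y; nra.
Qed.

Lemma powR_third4 (R : realType) (x : R) : 0 <= x -> x `^ (4 / 3) = x * x `^ (1 / 3).
Proof.
move=> x0; have x13 : x = (x `^ (1 / 3)) ^+ 3 by rewrite powR_third_cube.
rewrite {2}x13 -exprSr -powR_mulrn ?powR_ge0// -powRrM; by congr (_ `^ _); field.
Qed.

(* The error terms of the two lower bounds are [K r ^ 2 / n] and [K / r]; the
   first bound is available whenever it realizes the maximum, and the second
   one, which needs [ln n <= r], as well. *)
Lemma lower_bound_regimes (R : realType) (N x l K e : R) :
  0 < e -> 1 <= l -> l ^+ 4 <= N -> 1 <= x -> K <= e * l -> K <= e * x ->
  (K * x ^+ 2 <= e * N /\ x `^ (4 / 3) / l `^ (1 / 3) <= N / x ^+ 2) \/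
  (l <= x /\ N / x ^+ 2 <= x `^ (4 / 3) / l `^ (1 / 3)).
Proof.
move=> e0 l1 lN x1 Kl Kx.
have x0 : 0 < x by lra.
have l0 : 0 < l by lra.
have l13 : 0 < l `^ (1 / 3) by rewrite powR_gt0.
have x2 : 0 < x ^+ 2 by rewrite exprn_gt0.
have l4 : l ^+ 4 = (l ^+ 2) ^+ 2 by rewrite -exprM.
have [h|/ltW h] := leP (x `^ (4 / 3) / l `^ (1 / 3)) (N / x ^+ 2).
  (* If [x <= l], then [K * x ^ 2 <= e * l ^ 3 <= e * N]. If [l < x], the other quantity is at least
     [x], so [N >= x ^ 3] and [K <= e * x] suffices. *)
  left; split=> //; rewrite leNgt; apply/negP => hK.
  have xl : l < x.
    rewrite ltNge; apply/negP => xl.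
    have : x ^+ 2 <= l ^+ 2 by rewrite lerXn2r ?nnegrE// ltW.
    have ll : 0 < l ^+ 2 by rewrite exprn_gt0.
    have : l <= l ^+ 2 by rewrite expr2 ler_peMr// ltW.
    rewrite l4 in lN; move: (x ^+ 2) (l ^+ 2) x2 ll hK lN => a b a0 b0 hK bN lb ab.
    have h1 : K * a <= e * b * a by rewrite ler_pM2r//; apply: le_trans Kl _; rewrite ler_pM2l.
    have h2 : e * b * a <= e * b * b by rewrite ler_wpM2l// mulr_ge0// ltW.
    have h3 : e * b * b <= e * N by rewrite -mulrA ler_pM2l// -expr2.
    lra.
  have : x <= x `^ (4 / 3) / l `^ (1 / 3).
    rewrite powR_third4 ?(ltW x0)// -mulrA ler_peMr ?(ltW x0)// ler_pdivlMr// [leLHS]mul1r.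
    by rewrite ge0_ler_powR ?nnegrE ?divr_ge0// ltW.
  move=> /le_trans /(_ h); rewrite ler_pdivlMr// => hx.
  have : K * x ^+ 2 <= e * x * x ^+ 2 by rewrite ler_pM2r.
  have : e * x * x ^+ 2 <= e * N by rewrite -mulrA ler_pM2l.
  lra.
(* If [x < l], then [N / x ^ 2 <= x ^ (4 / 3) <= x ^ 2] yields [N <= x ^ 4 < l ^ 4], a
   contradiction. *)
right; split=> //; rewrite leNgt; apply/negP => xl.
have : N / x ^+ 2 <= x ^+ 2.
  apply: le_trans h _; apply: (@le_trans _ _ (x `^ (4 / 3))).
    rewrite ler_pdivrMr// ler_peMr ?powR_ge0//.
    apply: (@le_trans _ _ (1 `^ (1 / 3))); first by rewrite powR1.
    by rewrite ge0_ler_powR ?nnegrE ?divr_ge0// ltW.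
  by rewrite -powR_mulrn ?(ltW x0)// ler_powR//; lra.
rewrite ler_pdivrMr// -expr2.
have : (x ^+ 2) ^+ 2 < (l ^+ 2) ^+ 2 by rewrite -!exprM ltrXn2r ?nnegrE// ltW.
rewrite -l4; lra.
Qed.

Theorem theorem5p2 (R : realType) :
  (exists c : R, 0 < c /\
     forall r : nat -> R,
       r n @[n --> \oo] --> +oo ->
       (\forall n \near \oo, r n <= Num.sqrt n%:R / 4) ->
       aas_torus r (fun n e =>
         c * Num.max (n%:R / r n ^+ 2)
                     (r n `^ (4 / 3) / ln n%:R `^ (1 / 3))
           <= (metric_dim e)%:R)) /\
  (exists C : R, 0 < C /\
     forall r : nat -> R,
       (\forall n \near \oo, ln n%:R `^ (3 / 2) <= r n <= Num.sqrt n%:R / 4) ->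
       aas_torus r (fun n e =>
         (metric_dim e)%:R
           <= C * (n%:R * ln n%:R `^ (2 / 3) / r n `^ (2 / 3)))).
Proof.
split.
  (* [be] bounds the expected number of points in the region of a cell, 201 in the first lower bound
     and 1 in the second; one value serves both. *)
  have [be be201] : exists be : R, 201 <= be by exists 201.
  have E2 := expR_gt0 (2 * be); have E4 := expR_gt0 (4 * be).
  have c0 : 0 < 168 * 160 ^+ 2 * expR (2 * be) by rewrite !mulr_gt0// exprn_gt0.
  (* The constant of the second lower bound is the smaller one, hence valid for the maximum. *)
  have cc : (168 * 160 ^+ 2 * expR (2 * be))^-1 <= (32 * expR (2 * be))^-1.
    rewrite lef_pV2 ?posrE// ?mulr_gt0// ler_pM2r//.
    by rewrite -natrX -natrM ler_nat.
  exists (168 * 160 ^+ 2 * expR (2 * be))^-1; split; first by rewrite invr_gt0.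
  move=> r roo rn; apply: aas_torus_grid; first exact: cvgry_gt.
  move=> e e0.
  pose K1 := 4 * (16 * expR (2 * be) + 1608 + 64 * expR (4 * be)).
  pose K2 := 4 * (4 * 160 ^+ 2 * expR (2 * be) + 1 + 80 ^+ 2 * expR (4 * be)) + 80 ^+ 2 + 1.
  near=> n => M0.
  have n4 : (4 <= n)%N by near: n; exact: nbhs_infty_ge.
  have n1608 : 1608 <= n%:R :> R by near: n; exact: nbhs_infty_ger.
  have l120 : 120 <= ln n%:R :> R by near: n; exact: near_ln_ge.
  have lK : e^-1 * K1 <= ln n%:R by near: n; exact: near_ln_ge.
  have r40 : 40 <= r n by near: n; exact: cvgry_ge.
  have rK1 : e^-1 * K1 <= r n by near: n; exact: cvgry_ge.
  have rK2 : e^-1 * K2 <= r n by near: n; exact: cvgry_ge.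
  have rL : r n <= Num.sqrt n%:R / 4 by near: n.
  rewrite !ler_pdivrMl// in lK rK1 rK2.
  have l4 := ln_exp4_le (leq_trans (isT : 0 < 4)%N n4) l120.
  have l1 : 1 <= ln n%:R :> R by lra.
  have r1 : 1 <= r n by lra.
  have [[h hmax]|[h hmax]] := lower_bound_regimes e0 l1 l4 r1 lK rK1.
    have r3 : 3 <= r n by lra.
    have [M MM0 le_e] := lower_bound1_grid M0 be201 n4 n1608 r3 e0 h.
    exists M => //; apply: le_trans le_e; apply: sub_Pr => f.
    move=> /asboolPn/negP; rewrite -ltNge max_l// => /lt_le_trans; apply.
    by rewrite ler_wpM2r// divr_ge0// sqr_ge0.
  have be1 : 1 <= be by lra.
  have lrL : ln n%:R <= r n <= Num.sqrt n%:R / 4 by rewrite h.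
  have [M MM0 le_e] := lower_bound2_grid M0 be1 n4 l1 lrL r40 e0 rK2.
  exists M => //; apply: le_trans le_e; apply: sub_Pr => f.
  by move=> /asboolPn/negP; rewrite -ltNge max_r.
exists 45; split=> // r rn.
have lr : \forall n \near \oo, ln n%:R <= r n.
  near=> n; have l1 : 1 <= ln n%:R :> R by near: n; exact: near_ln_ge.
  have /andP[h _] : ln n%:R `^ (3 / 2) <= r n <= Num.sqrt n%:R / 4 by near: n.
  by apply: le_trans h; rewrite le1r_powR//; lra.
apply: aas_torus_grid.
  near=> n; have l1 : 1 <= ln n%:R :> R by near: n; exact: near_ln_ge.
  have lrn : ln n%:R <= r n by near: n.
  lra.
move=> e e0; near=> n => M0.
have n0 : (0 < n)%N by near: n; exact: nbhs_infty_ge.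
have l2 : 2 <= ln n%:R :> R by near: n; exact: near_ln_ge.
have lrL : ln n%:R <= r n <= Num.sqrt n%:R / 4.
  apply/andP; split; first by near: n.
  by have /andP[_ ->] : ln n%:R `^ (3 / 2) <= r n <= Num.sqrt n%:R / 4 by near: n.
have ne : 2 / e <= Num.sqrt n%:R.
  rewrite -[leLHS]ger0_norm ?divr_ge0 ?(ltW e0)// -sqrtr_sqr ler_wsqrtr//.
  by near: n; exact: nbhs_infty_ger.
have [M MM0 le_e] := upper_bound_grid M0 n0 l2 lrL e0 ne.
exists M => //; apply: le_trans le_e; apply: sub_Pr => f.
by move=> /asboolPn/negP; rewrite -ltNge.
Unshelve. all: by end_near.
Qed.
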